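(* Let $n\ge 2$ and $k\ge n+1$. Let $\beta:S^k\to S^n\subset\mathbb{R}^{n+1}$ be a Lipschitz map satisfying condition $( * )$. Then $\beta$ extends to a Lipschitz map $\gamma:D^{k+1}\to\mathbb{R}^{n+1}$ whose derivative has rank at most $n$ almost everywhere.
   Context: Condition $( * )$ on $\beta$: for every $m\ge1$, letting $Y=S^n\vee\cdots\vee S^n$ be the $m$-fold wedge of $n$-spheres and $i_j:S^n\to Y$ the inclusion of the $j$th wedge summand, one has $\bigl(\sum_{j=1}^m i_j\bigr)\circ\beta=\sum_{j=1}^m (i_j\circ\beta)$ in $\pi_k(Y)$ (equivalently, all Hopf–Hilton invariants of $\beta$ vanish); this holds e.g. when $\beta$ is a suspension of a map $S^{k-1}\to S^{n-1}$. $D^{k+1}$ is the closed unit ball in $\mathbb{R}^{k+1}$ with boundary $S^k$. *)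

(* Defs.v *)
From HB Require Import structures.
From mathcomp Require Import all_boot all_order all_algebra.
From mathcomp Require Import all_classical all_reals all_analysis.
Set Implicit Arguments. Unset Strict Implicit. Unset Printing Implicit Defensive.
Import Order.TTheory GRing.Theory Num.Theory.
Import numFieldNormedType.Exports.
Local Open Scope classical_set_scope.
Local Open Scope ring_scope.

Section Defs.
Variable R : realType.

(* Euclidean norm on R^d (the library norm on matrices is the max norm). *)
Definition enorm {d : nat} (x : 'rV[R]_d) : R := Num.sqrt (\sum_(i < d) x 0 i ^+ 2).

Definition sphere (d : nat) : set 'rV[R]_d.+1 := [set x | enorm x = 1].
Definition ball1 (d : nat) : set 'rV[R]_d.+1 := [set x | enorm x <= 1].

Definition lip_on {d e : nat} (A : set 'rV[R]_d) (f : 'rV[R]_d -> 'rV[R]_e) :=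
  exists L : R, forall x y, A x -> A y -> enorm (f x - f y) <= L * enorm (x - y).

Definition leb_null {d : nat} (N : set 'rV[R]_d) :=
  forall eps : R, 0 < eps -> exists a b : nat -> 'rV[R]_d,
    (forall i j, a i 0 j <= b i 0 j) /\
    (forall x, N x -> exists i, forall j, a i 0 j <= x 0 j <= b i 0 j) /\
    (forall M, \sum_(i < M) \prod_(j < d) (b i 0 j - a i 0 j) < eps).

Definition e0 (d : nat) : 'rV[R]_(1 + d) := row_mx (\row_(_ < 1) 1) 0.
Definition spt (d : nat) : 'rV[R]_(1 + d) := - e0 d.

Definition in_cube {d : nat} (x : 'rV[R]_d) := forall i, 0 <= x 0 i <= 1.
Definition on_bd {d : nat} (x : 'rV[R]_d) :=
  in_cube x /\ exists i, x 0 i = 0 \/ x 0 i = 1.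

(* Standard collapse map c_d : I^d -> S^d, sending the boundary to -e_0 and
   mapping the interior homeomorphically onto S^d \ {-e_0}. *)
Definition collapse (d : nat) (x : 'rV[R]_d) : 'rV[R]_(1 + d) :=
  let u := 2 *: x - const_mx 1 in
  let s := \big[Num.max/0]_(i < d) `|u 0 i| in
  row_mx (\row_(_ < 1) cos (pi * s)) ((sin (pi * s) / enorm u) *: u).

(* Cube-model operations for pi_d(Y, 0), Y a subset of R^e with base point 0 *)
Definition coord0 {d : nat} (x : 'rV[R]_d) : R := \sum_(j < d | (j : nat) == 0%N) x 0 j.
Definition setc0 {d : nat} (x : 'rV[R]_d) (t : R) : 'rV[R]_d :=
  \row_(j < d) (if (j : nat) == 0%N then t else x 0 j).

Definition cube_add {d e : nat} (f g : 'rV[R]_d -> 'rV[R]_e) (x : 'rV[R]_d) :=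
  if coord0 x <= 2^-1 then f (setc0 x (2 * coord0 x))
  else g (setc0 x (2 * coord0 x - 1)).

Fixpoint cube_sum_from {d e : nat} (fs : nat -> 'rV[R]_d -> 'rV[R]_e) (j m : nat)
  : 'rV[R]_d -> 'rV[R]_e :=
  match m with
  | 0%N => fun _ => 0
  | m'.+1 => cube_add (fs j) (cube_sum_from fs j.+1 m')
  end.
Definition cube_sum {d e : nat} fs m : 'rV[R]_d -> 'rV[R]_e := cube_sum_from fs 0 m.

Definition rel_htpy {d e : nat} (Y : set 'rV[R]_e) (f g : 'rV[R]_d -> 'rV[R]_e) :=
  exists H : R * 'rV[R]_d -> 'rV[R]_e,
    {within [set p | 0 <= p.1 <= 1 /\ in_cube p.2], continuous H} /\
    (forall t x, 0 <= t <= 1 -> in_cube x -> Y (H (t, x))) /\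
    (forall x, in_cube x -> H (0, x) = f x /\ H (1, x) = g x) /\
    (forall t x, 0 <= t <= 1 -> on_bd x -> H (t, x) = 0).

(* Concrete model of the m-fold wedge of n-spheres: the spheres of radii
   1, ..., m centered at j e_0, pairwise meeting only at the base point 0. *)
Definition wedge_sph (n m : nat) : set 'rV[R]_(1 + n) :=
  [set y | exists j, (j < m)%N /\ enorm (y - j.+1%:R *: e0 n) = j.+1%:R].
Definition incl (n j : nat) (x : 'rV[R]_(1 + n)) : 'rV[R]_(1 + n) :=
  j.+1%:R *: (x + e0 n).

Arguments sphere d _ : clear implicits.
Arguments ball1 d _ : clear implicits.
Arguments collapse d _ : clear implicits.
Arguments spt d : clear implicits.
Arguments e0 d : clear implicits.
Arguments incl n j _ : clear implicits.
Arguments wedge_sph n m _ : clear implicits.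

Definition free_htpy (k n : nat) (f g : 'rV[R]_k.+1 -> 'rV[R]_n.+1) :=
  exists H : R * 'rV[R]_k.+1 -> 'rV[R]_n.+1,
    {within [set p | 0 <= p.1 <= 1 /\ sphere k p.2], continuous H} /\
    (forall t x, 0 <= t <= 1 -> sphere k x -> sphere n (H (t, x))) /\
    (forall x, sphere k x -> H (0, x) = f x /\ H (1, x) = g x).

(* Condition ( * ): for every m >= 1, ((sum_j i_j) o beta) = sum_j (i_j o beta)
   in pi_k(Y), computed with a based representative beta' of the class of beta. *)
Definition cond_star (k n : nat) (beta : 'rV[R]_k.+1 -> 'rV[R]_n.+1) :=
  forall m : nat, (0 < m)%N ->
  exists beta' : 'rV[R]_k.+1 -> 'rV[R]_n.+1,
    {within sphere k, continuous beta'} /\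
    (forall x, sphere k x -> sphere n (beta' x)) /\
    beta' (spt k) = spt n /\
    free_htpy beta beta' /\
    forall s : 'rV[R]_n.+1 -> 'rV[R]_n.+1,
      (forall x, in_cube x ->
         s (collapse n x) = cube_sum (fun j => incl n j \o collapse n) m x) ->
      rel_htpy (wedge_sph n m) (s \o beta' \o collapse k)
               (cube_sum (fun j => incl n j \o beta' \o collapse k) m).

End Defs.
Arguments sphere {R} d _.
Arguments ball1 {R} d _.
Arguments collapse {R} d _.
Arguments spt {R} d.
Arguments e0 {R} d.
Arguments incl {R} n j _.
Arguments wedge_sph {R} n m _.

(* Main.v *)
(* The sup norm turns balls into cubes, so put K v = v / |v|; it suffices to extend K o beta
   to a Lipschitz map F of the ball into the cube such that F x has a rational coordinate for
   almost every x: a level set of a scalar function is null apart from points where its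
   derivative vanishes, so that derivative of F_i is 0 almost everywhere, and composing F
   with the radial map of the cube onto the ball does not increase the rank.
   Condition ( * ) for m = 2 says that pinching beta gives two copies of beta side by side.
   Hence on a cube with two holes, one in each half, there is a map that is K o beta o rad on
   the outer boundary, a half-sized copy of it on each hole, and misses an interior point of
   each half of the target cube; retracting from these two points, some coordinate of it is
   -1, 0 or 1.  Refilling the holes by scaled copies of such maps, with the halving direction
   running cyclically through the coordinates of both cubes, defines F on the complement of
   a null set.  After l steps the target cells have diameter about 2^-(l/(n+1)) and the
   domain cells about 2^-(l/(k+1)); as k > n, F is Lipschitz even if the holes are shrunk by
   a further factor at each step, and the shrinking makes the leftover set null.
   Rademacher's theorem is avoided: the continuous maps above are replaced by maps that are
   locally finite minima of cones, and all further operations preserve differentiability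
   almost everywhere. *)
Require Import Defs.
From HB Require Import structures.
From mathcomp Require Import all_boot all_order all_algebra.
From mathcomp Require Import all_classical all_reals all_analysis.
From mathcomp Require Import ring lra.
Import Order.TTheory GRing.Theory Num.Theory.
Import numFieldNormedType.Exports.
Local Open Scope classical_set_scope.
Local Open Scope ring_scope.
Set Implicit Arguments. Unset Strict Implicit. Unset Printing Implicit Defensive.

(** * Null sets and differentiability almost everywhere *)

(** These homotopies run in the complement [off_poles] of two points. There the sphere of radius 2,
    which encloses both points, is moved by straight segments to its pinched image, each summand of
    which surrounds one of them ([pinch_avoid]); this turns ( * ), a statement about a wedge, into
    one about a cube with two points removed. One pair of halving directions is enough, because a
    quarter turn of coordinates is homotopic to the identity of the sphere. Since a step halves a
    single coordinate, cells are not cubes, and the Lipschitz bound is carried with a separate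
    weight for every coordinate. Smoothing must keep the boundary values exactly, otherwise
    consecutive scales would not fit together; hence it is relative to a closed set, on which the
    map is Lipschitz but perhaps nowhere differentiable. *)

Section NullSets.
Variables (R : realType) (d : nat).
Implicit Types N : set 'rV[R]_d.+1.

Lemma leb_null_sub N N' : N `<=` N' -> leb_null N' -> leb_null N.
Proof.
move=> sN null eps eps0; have [a [b [ab [cov vol]]]] := null eps eps0.
by exists a, b; split=> //; split=> // x /sN /cov.
Qed.

Definition box_vol (a b : 'rV[R]_d.+1) : R := \prod_(j < d.+1) (b 0 j - a 0 j).

Lemma box_vol_ge0 (a b : 'rV[R]_d.+1) : (forall j, a 0 j <= b 0 j) -> 0 <= box_vol a b.
Proof. by move=> ab; apply: prodr_ge0 => j _; rewrite subr_ge0. Qed.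

(** Replaces the sequences and the strict bound of [leb_null] by any countable index type and a
    non-strict bound on finite partial sums, at the price of halving [eps]. Numbers that encode no
    index get the degenerate box at 0, of volume 0 because the dimension is positive. *)
Lemma leb_null_cover N :
  (forall eps : R, 0 < eps -> exists (I : countType) (a b : I -> 'rV[R]_d.+1),
    (forall i j, a i 0 j <= b i 0 j) /\
    (forall x, N x -> exists i, forall j, a i 0 j <= x 0 j <= b i 0 j) /\
    (forall s : seq I, uniq s -> \sum_(i <- s) box_vol (a i) (b i) <= eps)) ->
  leb_null N.
Proof.
move=> H eps eps0.
have [I [a [b [ab [cov vol]]]]] := H (eps / 2) (divr_gt0 eps0 (ltr0Sn _ 1)).
pose ext (f : I -> 'rV[R]_d.+1) m := if pickle_inv m is Some i then f i else 0.
exists (ext a), (ext b); split=> [m j|].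
  by rewrite /ext; case: (pickle_inv m).
split=> [x /cov[i xi]|M].
  by exists (pickle i); rewrite /ext pickleK_inv.
have -> : \sum_(i < M) \prod_(j < d.+1) (ext b i 0 j - ext a i 0 j) =
    \sum_(i <- pmap pickle_inv (iota 0 M)) box_vol (a i) (b i).
  rewrite -(big_mkord xpredT (fun m => box_vol (ext a m) (ext b m))).
  rewrite /index_iota subn0; elim: (iota 0 M) => [|m s IH]; first by rewrite !big_nil.
  rewrite big_cons IH /= /ext; case: (pickle_inv m) => [i|] /=.
    by rewrite big_cons.
  by rewrite /box_vol big_ord_recl !mxE subr0 mul0r add0r.
apply: le_lt_trans (vol _ _) _; last by rewrite gtr_pMr// invf_lt1// ltr1n.
exact: pmap_uniq (@pickle_invK I) _ (iota_uniq 0 M).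
Qed.

Lemma ler_sum_uniq (I : eqType) (s t : seq I) (F : I -> R) :
  uniq s -> uniq t -> {subset s <= t} -> (forall i, 0 <= F i) ->
  \sum_(i <- s) F i <= \sum_(i <- t) F i.
Proof.
move=> us ut st F0; rewrite [leRHS](bigID (mem s)) /=.
rewrite [X in _ <= X + _](_ : _ = \sum_(i <- s) F i).
  by rewrite lerDl; apply: sumr_ge0.
rewrite -big_filter; apply: perm_big; apply: uniq_perm; rewrite ?filter_uniq// => i.
by rewrite mem_filter; apply/andP/idP => [[]|si]//; split=> //; exact: st.
Qed.

Lemma leb_null_bigcup (F : nat -> set 'rV[R]_d.+1) :
  (forall i, leb_null (F i)) -> leb_null [set x | exists i, F i x].
Proof.
move=> nF; apply: leb_null_cover => eps eps0.
have e2 i : 0 < eps / 2 ^+ i.+1 :> R by rewrite divr_gt0// exprn_gt0.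
have /choice[a /choice[b H]] : forall i, exists a b, _ := fun i => nF i _ (e2 i).
exists (nat * nat)%type, (fun p => a p.1 p.2), (fun p => b p.1 p.2); split.
  by move=> [i m] j; have [] := H i.
split=> [x [i Fx]|s us].
  by have [_ [/(_ _ Fx)[m xm] _]] := H i; exists (i, m).
pose M := (\max_(p <- s) maxn p.1 p.2).+1.
have sM p : p \in s -> (p.1 < M)%N && (p.2 < M)%N.
  move=> ps; rewrite !ltnS -geq_max.
  by apply: (@leq_bigmax_seq _ _ xpredT (fun q : nat * nat => maxn q.1 q.2)).
pose t := [seq (i, m) | i <- iota 0 M, m <- iota 0 M].
apply: (@le_trans _ _ (\sum_(p <- t) box_vol (a p.1 p.2) (b p.1 p.2))).
  apply: ler_sum_uniq => //.
  - by apply: allpairs_uniq; rewrite ?iota_uniq// => -[? ?] [? ?].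
  - move=> [i m] /sM /= /andP[iM mM]; apply/allpairsP; exists (i, m).
    by rewrite !mem_iota /= !add0n.
  - by move=> [i m]; apply: box_vol_ge0; have [] := H i.
rewrite /t big_allpairs_dep /=.
apply: (@le_trans _ _ (\sum_(i <- iota 0 M) eps / 2 ^+ i.+1)).
  apply: ler_sum => i _; have [_ [_ /(_ M)]] := H i.
  by rewrite -(big_mkord xpredT (fun m => box_vol (a i m) (b i m))) /index_iota subn0 => /ltW.
have -> m : \sum_(i <- iota 0 m) eps / 2 ^+ i.+1 = eps - eps / 2 ^+ m.
  elim: m => [|m IH]; first by rewrite big_nil expr0 divr1 subrr.
  rewrite -{1}addn1 iotaD big_cat /= IH big_seq1 add0n exprS.
  by field; rewrite expf_neq0.
by rewrite gerBl// divr_ge0// ?ltW// exprn_gt0.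
Qed.

Lemma leb_null0 : leb_null (set0 : set 'rV[R]_d.+1).
Proof.
move=> eps eps0; exists (fun=> 0), (fun=> 0); split=> //; split=> // M.
by rewrite big1// => i _; rewrite big_ord_recl !mxE subr0 mul0r.
Qed.

Lemma leb_null_countable (I : countType) (F : I -> set 'rV[R]_d.+1) :
  (forall i, leb_null (F i)) -> leb_null [set x | exists i, F i x].
Proof.
move=> nF.
apply: (@leb_null_sub _ [set x | exists m, (if unpickle m is Some i then F i else set0) x]).
  by move=> x [i Fx]; exists (pickle i); rewrite pickleK.
apply: leb_null_bigcup => m; case: (unpickle m) => //; exact: leb_null0.
Qed.

Lemma leb_nullU N N' : leb_null N -> leb_null N' -> leb_null (N `|` N').
Proof.
move=> nN nN'; apply: (@leb_null_sub _ [set x | exists b : bool, (if b then N else N') x]).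
  by move=> x [Nx|Nx]; [exists true|exists false].
by apply: (@leb_null_countable bool (fun b => if b then N else N')); case.
Qed.

Lemma leb_null_affine N (c e : 'I_d.+1 -> R) : (forall j, 0 < c j) ->
  leb_null N -> leb_null [set x | exists2 y, N y & forall j, x 0 j = c j * y 0 j + e j].
Proof.
move=> c0 nN eps eps0.
have pc : 0 < \prod_(j < d.+1) c j by apply: prodr_gt0 => j _.
have [a [b [ab [cov vol]]]] := nN (eps / \prod_(j < d.+1) c j) (divr_gt0 eps0 pc).
pose f (v : 'rV[R]_d.+1) : 'rV[R]_d.+1 := \row_j (c j * v 0 j + e j).
exists (f \o a), (f \o b); split=> [i j|].
  by rewrite /= !mxE lerD2r ler_pM2l.
split=> [x [y Ny xy]|M].
  have [i yi] := cov _ Ny; exists i => j; rewrite /= !mxE xy !lerD2r !ler_pM2l//.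
rewrite (eq_bigr (fun i : 'I_M => (\prod_(j < d.+1) c j) *
    \prod_(j < d.+1) (b i 0 j - a i 0 j))) => [|i _]; last first.
  by rewrite -big_split /=; apply: eq_bigr => j _; rewrite !mxE; ring.
by rewrite -mulr_sumr mulrC -ltr_pdivlMr//; exact: vol.
Qed.

(* Cutting the cell into P^d columns parallel to the axis [j], the graph meets each
   column in a box of height O(1/P). *)
Lemma leb_null_graph N (j : 'I_d.+1) (C : R) (c : 'I_d.+1 -> R) : 0 < C ->
  (forall x l, N x -> c l <= x 0 l < c l + 1) ->
  (forall x y (r : R), 0 <= r -> N x -> N y -> (forall l, l != j -> `|x 0 l - y 0 l| <= r) ->
    `|x 0 j - y 0 j| <= C * r) ->
  leb_null N.
Proof.
move=> C0 Nc NC; apply: leb_null_cover => eps eps0.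
pose P := (Num.truncn (2 * C / eps)).+1.
have P0 : 0 < P%:R :> R by rewrite ltr0n.
have PC : 2 * C / P%:R <= eps.
  rewrite ler_pdivrMr// [eps * _]mulrC -ler_pdivrMr//; apply: ltW.
  have /truncn_itv/andP[_] : 0 <= 2 * C / eps by rewrite divr_ge0 ?mulr_ge0 ?ltW.
  exact.
pose T := {ffun 'I_d -> 'I_P}.
pose col (f : T) (x : 'rV[R]_d.+1) := N x /\ forall l,
  c (lift j l) + (f l : nat)%:R / P%:R <= x 0 (lift j l) <= c (lift j l) + (f l).+1%:R / P%:R.
(* A point of [N] in the column fixes the height of its box; in a column that [N] misses, [get]
   returns an arbitrary point, which does no harm. *)
pose z (f : T) : 'rV[R]_d.+1 := get (col f).
pose bx (h : nat -> R) (k : R) (f : T) : 'rV[R]_d.+1 := \row_l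
  if unlift j l is Some l' then c l + h (f l') / P%:R else z f 0 j + k / P%:R.
exists T, (bx (fun n => n%:R) (- C)), (bx (fun n => n.+1%:R) C); split.
  move=> f l; rewrite !mxE; case: unlift => [l'|]; rewrite lerD2l ler_pM2r ?invr_gt0//.
    by rewrite ler_nat.
  by rewrite (le_trans _ (ltW C0))// oppr_le0 ltW.
split=> [x Nx|s us].
  have fP l : (Num.truncn ((x 0 (lift j l) - c (lift j l)) * P%:R)%R < P)%N.
    have /andP[h1 h2] := Nc x (lift j l) Nx.
    have h0 : 0 <= (x 0 (lift j l) - c (lift j l)) * P%:R.
      by rewrite mulr_ge0 ?subr_ge0// ltW.
    rewrite -(ltr_nat R); have /andP[h _] := truncn_itv h0.
    apply: le_lt_trans h _; rewrite gtr_pMl//; lra.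
  pose f : T := [ffun l => Ordinal (fP l)].
  have cx : col f x.
    split=> // l; rewrite ffunE /=.
    have /andP[h1 h2] := Nc x (lift j l) Nx.
    have h0 : 0 <= (x 0 (lift j l) - c (lift j l)) * P%:R.
      by rewrite mulr_ge0 ?subr_ge0// ltW.
    have /andP[h h'] := truncn_itv h0.
    move/ltW: h'; rewrite -(ler_pdivlMr _ _ P0) => h4.
    move: h; rewrite -(ler_pdivrMr _ _ P0) => h3.
    by rewrite -lerBrDl h3 /= -lerBlDl.
  have [Nz cz] : col f (z f) by apply: getI; exact: cx.
  exists f => l; rewrite !mxE; case: unliftP => [l' ->|->].
    by case: cx => _ /(_ l').
  suff : `|x 0 j - z f 0 j| <= C * P%:R^-1.
    by rewrite ler_norml mulNr => /andP[]; lra.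
  apply: NC => // l'.
  case: (unliftP j l') => [l'' ->|->]; last by rewrite eqxx.
  move=> _; case: cx => _ /(_ l'') /andP[h1 h2].
  have /andP[h3 h4] := cz l''.
  have : (f l'').+1%:R / P%:R = (f l'')%:R / P%:R + P%:R^-1 :> R.
    by rewrite -natr1 mulrDl mul1r.
  by rewrite ler_norml; lra.
have vol f : box_vol (bx (fun n => n%:R) (- C) f) (bx (fun n => n.+1%:R) C f) =
    2 * C / P%:R * P%:R^-1 ^+ d.
  rewrite /box_vol (@bigD1_ord _ _ _ _ j)//= !mxE unlift_none.
  congr (_ * _); first by field; rewrite gt_eqF.
  rewrite (eq_bigr (fun=> P%:R^-1)) ?prodr_const ?card_ord// => l _.
  by rewrite !mxE liftK -natr1; field; rewrite gt_eqF.
rewrite (eq_bigr _ (fun f _ => vol f)) big_const_seq count_predT iter_addr_0.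
apply: le_trans PC; rewrite -mulrnAr ler_piMr//.
  by rewrite divr_ge0// mulr_ge0// ltW.
rewrite -mulr_natr exprVn mulrC ler_pdivrMr ?exprn_gt0// mul1r -natrX ler_nat.
have /(uniq_leq_size us) : {subset s <= enum T} by move=> f; rewrite mem_enum.
by rewrite -cardE card_ffun !card_ord.
Qed.
End NullSets.

Section Diff.
Variables (R : realType) (V W : normedModType R).

Lemma differentiable_bound (f : V -> W) (x : V) (e : R) : differentiable f x -> 0 < e ->
  \forall y \near x, `|f y - f x - 'd f x (y - x)| <= e * `|y - x|.
Proof.
move=> /diff_locallyP[_ /eqaddoP H] e0.
rewrite (near_shift 0 x) /=; have := H _ e0; apply: filterS => h /=.
by rewrite subr0 /= addrK !fctE opprD addrA.
Qed.

Lemma bound_differentiable (f : V -> W) (L : {linear V -> W}) (x : V) :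
  continuous L ->
  (forall e : R, 0 < e -> \forall y \near x, `|f y - f x - L (y - x)| <= e * `|y - x|) ->
  differentiable f x /\ 'd f x = L :> (V -> W).
Proof.
move=> cL H; have E : f \o shift x = cst (f x) + L +o_ 0 id.
  apply/eqaddoP => e e0; have := H e e0.
  rewrite (near_shift 0 x) /=; apply: filterS => h /=.
  by rewrite subr0 /= addrK !fctE opprD addrA.
have D := diff_unique cL E.
by split=> //; apply/diff_locallyP; rewrite D.
Qed.

Lemma differentiable_near (f g : V -> W) (x : V) : (\forall y \near x, f y = g y) ->
  differentiable f x -> differentiable g x /\ 'd g x = 'd f x :> (V -> W).
Proof.
move=> fg df; apply: bound_differentiable => [|e e0].
  by have /diff_locallyP[] := df.
have fgx : f x = g x := nbhs_singleton fg.
near=> y; rewrite -fgx -(near fg y)//; near: y.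
exact: differentiable_bound.
Unshelve. all: by end_near. Qed.

Lemma differentiable_small (f : V -> W) (x : V) :
  (forall e : R, 0 < e -> \forall y \near x, `|f y - f x| <= e * `|y - x|) ->
  differentiable f x /\ 'd f x = (fun=> 0) :> (V -> W).
Proof.
move=> H; apply: (@bound_differentiable f \0) => [|e e0]; first exact: cst_continuous.
by have := H e e0; apply: filterS => y /=; rewrite subr0.
Qed.
End Diff.

Section RowNorm.
Variables (R : realType).
Lemma norm_coord d (x : 'rV[R]_d) i : `|x 0 i| <= `|x|.
Proof. by rewrite [leRHS]/Num.norm /= mx_normrE; apply: (le_bigmax _ _ (0, i)). Qed.

Lemma norm_le d (x : 'rV[R]_d) (r : R) : 0 <= r -> (forall i, `|x 0 i| <= r) -> `|x| <= r.
Proof.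
move=> r0 H; rewrite [leLHS]/Num.norm /= mx_normrE; apply: bigmax_le => // -[i j] _ /=.
by rewrite (ord1 i).
Qed.

Lemma norm_lt d (x : 'rV[R]_d) (r : R) : 0 < r -> (forall i, `|x 0 i| < r) -> `|x| < r.
Proof.
move=> r0 H; rewrite [ltLHS]/Num.norm /= mx_normrE; apply: bigmax_lt => // -[i j] _ /=.
by rewrite (ord1 i).
Qed.
End RowNorm.

Lemma invS_lt (R : realType) (e : R) : 0 < e -> exists i : nat, i.+1%:R^-1 < e.
Proof.
move=> e0; exists (Num.truncn e^-1); rewrite invf_plt ?posrE//.
by have /truncn_itv/andP[_] : 0 <= e^-1 by rewrite invr_ge0 ltW.
Qed.

Lemma nbhs_ex_ball (R : realType) (V : normedModType R) (x : V) (P : set V) : (\forall y \near x, P y) ->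
  exists2 e : R, 0 < e & forall y, `|y - x| < e -> P y.
Proof.
move=> /nbhs_ballP[e e0 H]; exists e => // y yx; apply: H.
by rewrite -ball_normE /ball_ /= distrC.
Qed.

(* At such a point the largest partial derivative of [h] controls the others, so that
   nearby zeros of [h] lie on a Lipschitz graph over the remaining coordinates. *)
Lemma leb_null_zero_diff (R : realType) d (h : 'rV[R]_d.+1 -> R) :
  leb_null [set x | h x = 0 /\ differentiable h x /\ exists v, 'd h x v <> 0].
Proof.
(* The estimate reached at the end is [a |u_j| <= a/2 (|u_j| + r) + d r a], that is,
   [|u_j| <= (2 d + 1) r]. *)
pose C : R := (2 * d + 1)%:R.
(* The indices record the coordinate with the largest partial derivative, a scale [1/(i+1)] on which
   the first-order estimate holds, and a grid cell of that side, so that two points of one piece are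
   always within the scale of each other. *)
pose F (p : 'I_d.+1 * nat * {ffun 'I_d.+1 -> int}) : set 'rV[R]_d.+1 :=
  [set x | [/\ h x = 0, (forall y, h y = 0 -> `|y - x| < p.1.2.+1%:R^-1 ->
      forall r, 0 <= r -> (forall l, l != p.1.1 -> `|y 0 l - x 0 l| <= r) ->
      `|y 0 p.1.1 - x 0 p.1.1| <= C * r) &
    forall l, (p.2 l)%:~R <= p.1.2.+1%:R * x 0 l < (p.2 l)%:~R + 1]].
apply: (@leb_null_sub _ _ _ [set x | exists p, F p x]); last first.
  apply: leb_null_countable => -[[j i] c] /=.
  have i0 : 0 < i.+1%:R :> R by rewrite ltr0n.
  have i1 : i.+1%:R^-1 <= 1 :> R by rewrite invf_le1// ler1n.
  apply: (@leb_null_graph _ _ _ j C (fun l => (c l)%:~R / i.+1%:R)).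
  - by rewrite ltr0n addn1.
  - move=> x l [_ _ /(_ l) /= /andP[h1 h2]].
    rewrite ler_pdivrMr// mulrC h1 /=.
    move: h2; rewrite mulrC -ltr_pdivlMr// mulrDl mul1r => /lt_le_trans; apply.
    by rewrite lerD2l.
  - move=> x y r r0 [hx _ cx] [hy H cy]; apply: H => //=.
    apply: norm_lt => [|l]; first by rewrite invr_gt0.
    have /andP[h1 h2] := cx l; have /andP[h3 h4] := cy l.
    rewrite !mxE -[ltRHS]mul1r ltr_pdivlMr// -(gtr0_norm i0) -normrM mulrC mulrBr.
    by rewrite ltr_norml; move: h1 h2 h3 h4 => /=; lra.
move=> x [hx [dx [v dv]]].
pose L := 'd h x; pose g i := L (delta_mx 0 i).
have LE u : L u = \sum_i u 0 i * g i.
  rewrite {1}(row_sum_delta u) linear_sum; apply: eq_bigr => i _.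
  by rewrite linearZ.
have [j _ jmax] := @Order.TotalTheory.arg_maxP _ R _ ord0 xpredT (fun i => `|g i|) isT.
set a := `|g j|; have {}jmax i : `|g i| <= a by exact: jmax.
have a0 : 0 < a.
  rewrite lt_neqAle normr_ge0 andbT; apply/eqP => a0; apply: dv; rewrite -/L LE big1// => i _.
  have := jmax i; rewrite -a0 normr_le0 => /eqP ->; exact: mulr0.
have /nbhs_ex_ball[e e0 He] := differentiable_bound dx (divr_gt0 a0 (ltr0Sn R 1)).
have [i ie] := invS_lt e0.
exists (j, i, [ffun l => Num.floor (i.+1%:R * x 0 l)]); split=> //=; last first.
  by move=> l; rewrite ffunE; have := floor_itv (i.+1%:R * x 0 l); rewrite intrD.
move=> y hy yx r r0 yr; have := He y (lt_trans yx ie).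
rewrite hy hx subrr sub0r normrN -/L.
set u := y - x => Hu.
have ul l : l != j -> `|u 0 l| <= r by move=> lj; rewrite !mxE; exact: yr.
have -> : y 0 j - x 0 j = u 0 j by rewrite !mxE.
have un : `|u| <= `|u 0 j| + r.
  apply: norm_le => [|l]; first by rewrite addr_ge0.
  have [->|lj] := eqVneq l j; first by rewrite lerDl.
  by rewrite (le_trans (ul _ lj))// lerDr.
have h1 : `|u 0 j| * a <= `|L u| + d%:R * (r * a).
  rewrite LE (bigD1 j)//= -normrM.
  set S := \sum_(_ < _ | _) _.
  have HS : `|S| <= d%:R * (r * a).
    apply: (@le_trans _ _ (\sum_(l < d.+1 | l != j) r * a)).
      apply: le_trans (ler_norm_sum _ _ _) _; apply: ler_sum => l lj.
      by rewrite normrM ler_pM// ?ul// jmax.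
    by rewrite sumr_const cardC1 card_ord /= mulr_natl.
  have := ler_normB (u 0 j * g j + S) S; rewrite addrK; lra.
have h2 : `|u 0 j| * a <= a / 2 * (`|u 0 j| + r) + d%:R * (r * a).
  apply: le_trans h1 _; rewrite lerD2r; apply: le_trans Hu _.
  by rewrite ler_pM2l// divr_gt0.
have : a * (`|u 0 j|) <= a * (C * r) by rewrite /C natrD natrM; nra.
by rewrite ler_pM2l.
Qed.

Definition adiff (R : realType) d (Om : set 'rV[R]_d.+1) (f : 'rV[R]_d.+1 -> R) :=
  exists2 N, leb_null N & forall x, Om x -> ~ N x -> differentiable f x.

Section ADiff.
Variables (R : realType) (d : nat) (Om : set 'rV[R]_d.+1).
Implicit Types f g : 'rV[R]_d.+1 -> R.

Lemma differentiable_adiff f : (forall x, Om x -> differentiable f x) -> adiff Om f.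
Proof. by move=> H; exists set0; [exact: leb_null0|move=> x /H]. Qed.

Lemma adiff2 f g (F : ('rV[R]_d.+1 -> R)) :
  (forall x, Om x -> differentiable f x -> differentiable g x -> differentiable F x) ->
  adiff Om f -> adiff Om g -> adiff Om F.
Proof.
move=> H [N nN Nf] [N' nN' Nf']; exists (N `|` N'); first exact: leb_nullU.
by move=> x Ox /not_orP[Nx N'x]; apply: H => //; [exact: Nf|exact: Nf'].
Qed.

Lemma adiffD f g : adiff Om f -> adiff Om g -> adiff Om (fun x => f x + g x).
Proof. by apply: adiff2 => x _; exact: differentiableD. Qed.

Lemma adiffM f g : adiff Om f -> adiff Om g -> adiff Om (fun x => f x * g x).
Proof. by apply: adiff2 => x _; exact: differentiableM. Qed.

Lemma adiff_cst c : adiff Om (fun=> c).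
Proof. by apply: differentiable_adiff => x _; exact: differentiable_cst. Qed.

Lemma adiff_coord i : adiff Om (fun x => x 0 i).
Proof. by apply: differentiable_adiff => x _; exact: differentiable_coord. Qed.

Lemma adiffN f : adiff Om f -> adiff Om (fun x => - f x).
Proof. by move=> af; apply: (adiff2 _ af af) => x _ + _; exact: differentiableN. Qed.

Lemma adiffB f g : adiff Om f -> adiff Om g -> adiff Om (fun x => f x - g x).
Proof. by move=> af ag; apply: adiffD => //; exact: adiffN. Qed.

Lemma adiffV f : (forall x, Om x -> f x != 0) -> adiff Om f -> adiff Om (fun x => (f x)^-1).
Proof. by move=> f0 af; apply: (adiff2 _ af af) => x Ox + _ => /differentiableV; apply; exact: f0. Qed.

Lemma adiff_zero f : adiff Om f ->
  exists2 N, leb_null N & forall x, Om x -> ~ N x -> differentiable f x /\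
    (f x = 0 -> 'd f x = (fun=> 0) :> (_ -> _)).
Proof.
move=> [N nN Nf]; eexists; first exact: (leb_nullU nN (@leb_null_zero_diff _ _ f)).
move=> x Ox /not_orP[Nx Zx]; have df := Nf x Ox Nx; split=> // fx0.
apply/funext => v; apply: contrapT => dv; apply: Zx; split=> //; split=> //.
by exists v.
Qed.

(** Only the zeros of [f] are in question, and at almost every zero the derivative of [f] is 0, so
    that [|f|] has derivative 0 there as well. *)
Lemma adiff_norm f : adiff Om f -> adiff Om (fun x => `|f x|).
Proof.
move=> /adiff_zero[N nN H]; exists N => // x Ox Nx; have [df d0] := H x Ox Nx.
have cf := differentiable_continuous df.
have [f0|f0|f0] := ltgtP (f x) 0.
- apply: (differentiable_near _ (differentiableN df)).1.
  have H1 : \forall y \near x, f y < 0 by apply: (cvgr_lt _ cf).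
  by apply: filterS H1 => y fy; rewrite ltr0_norm.
- apply: (differentiable_near _ df).1.
  have H1 : \forall y \near x, 0 < f y by apply: (cvgr_gt _ cf).
  by apply: filterS H1 => y fy; rewrite gtr0_norm.
- apply: (differentiable_small _).1 => e e0.
  have := differentiable_bound df e0; rewrite (d0 f0) f0; apply: filterS => y.
  by rewrite !subr0 normr0 subr0 normr_id.
Qed.

Lemma adiff_max f g : adiff Om f -> adiff Om g -> adiff Om (fun x => Num.max (f x) (g x)).
Proof.
move=> af ag; rewrite (_ : (fun x => _) = (fun x => 2^-1 * (f x + g x + `|f x - g x|))).
  by apply: adiffM (adiff_cst _) (adiffD (adiffD af ag) (adiff_norm (adiffB af ag))).
by apply/funext => x; rewrite maxr_absE mulrC.
Qed.

Lemma adiff_min f g : adiff Om f -> adiff Om g -> adiff Om (fun x => Num.min (f x) (g x)).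
Proof.
move=> af ag; rewrite (_ : (fun x => _) = (fun x => - Num.max (- f x) (- g x))).
  by apply: adiffN; apply: adiff_max; exact: adiffN.
by apply/funext => x; rewrite -oppr_min opprK.
Qed.

Lemma adiff_bigmax (I : Type) (s : seq I) c (F : I -> 'rV[R]_d.+1 -> R) :
  (forall i, adiff Om (F i)) -> adiff Om (fun x => \big[Num.max/c]_(i <- s) F i x).
Proof.
move=> aF; elim: s => [|i s IH].
  by under eq_fun do rewrite big_nil; exact: adiff_cst.
by under eq_fun do rewrite big_cons; exact: adiff_max.
Qed.

Lemma adiff_bigmin (I : Type) (s : seq I) c (F : I -> 'rV[R]_d.+1 -> R) :
  (forall i, adiff Om (F i)) -> adiff Om (fun x => \big[Num.min/c]_(i <- s) F i x).
Proof.
move=> aF; elim: s => [|i s IH].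
  by under eq_fun do rewrite big_nil; exact: adiff_cst.
by under eq_fun do rewrite big_cons; exact: adiff_min.
Qed.

Lemma adiff_mxnorm n (F : 'rV[R]_d.+1 -> 'rV[R]_n) : (forall i, adiff Om (fun x => F x 0 i)) ->
  adiff Om (fun x => `|F x|).
Proof.
move=> aF; under eq_fun do rewrite /Num.norm /= mx_normrE.
by apply: adiff_bigmax => -[i j] /=; rewrite (ord1 i); apply: adiff_norm.
Qed.

Lemma adiff_eq f g : f =1 g -> adiff Om f -> adiff Om g.
Proof. by move=> /funext ->. Qed.
End ADiff.

(** * Lipschitz smoothing *)

Section InfConv.
Variables (R : realType) (V : normedModType R).
Implicit Types (S : set V) (g : V -> R).

(** The infimal convolution of [g] with a cone: for nonempty [S] and under [minorized], the largest
    [K]-Lipschitz function that is at most [g] on [S]. *)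
Definition inf_conv S g (K : R) (x : V) : R := inf [set g v + K * `|x - v| | v in S].

Definition minorized S g K := forall x, exists m : R, forall v, S v -> m <= g v + K * `|x - v|.

Lemma inf_conv_le S g K x v : minorized S g K -> S v -> inf_conv S g K x <= g v + K * `|x - v|.
Proof.
move=> mS Sv; apply: ge_inf; last by exists v.
by have [m Hm] := mS x; exists m => _ [w Sw <-]; exact: Hm.
Qed.

Lemma inf_conv_ge S g K x m : S !=set0 -> (forall v, S v -> m <= g v + K * `|x - v|) ->
  m <= inf_conv S g K x.
Proof.
move=> [v Sv] H; apply: lb_le_inf; first by exists (g v + K * `|x - v|), v.
by move=> _ [w Sw <-]; exact: H.
Qed.

Lemma inf_conv_lip S g K x y : 0 <= K -> minorized S g K ->
  `|inf_conv S g K x - inf_conv S g K y| <= K * `|x - y|.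
Proof.
move=> K0 mS; have [S0|S0] := eqVneq S set0.
  by rewrite /inf_conv S0 !image_set0 subrr normr0 mulr_ge0.
have {}S0 : S !=set0 by apply/set0P.
wlog : x y / inf_conv S g K y <= inf_conv S g K x.
  move=> W; have [yx|yx] := leP (inf_conv S g K y) (inf_conv S g K x); first exact: W.
  by rewrite distrC [`|x - y|]distrC; apply: W; exact: ltW.
move=> yx; rewrite ger0_norm ?subr_ge0// lerBlDr -lerBlDl; apply: inf_conv_ge => // v Sv.
rewrite lerBlDl; apply: le_trans (inf_conv_le x mS Sv) _.
rewrite addrCA lerD2l -mulrDr ler_wpM2l//.
by rewrite -[x - v](subrKA y) ler_normD.
Qed.

Lemma inf_conv_eq S g K x : minorized S g K -> S x -> (forall v, S v -> g x <= g v + K * `|x - v|) ->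
  inf_conv S g K x = g x.
Proof.
move=> mS Sx H; apply/eqP; rewrite eq_le; apply/andP; split.
  by have := inf_conv_le x mS Sx; rewrite subrr normr0 mulr0 addr0.
by apply: inf_conv_ge => //; exists x.
Qed.

Lemma lip_minorized S g K : (forall x y, S x -> S y -> `|g x - g y| <= K * `|x - y|) ->
  0 <= K -> minorized S g K.
Proof.
move=> H K0 x; have [S0|/set0P[v0 Sv0]] := eqVneq S set0.
  by exists 0 => v; rewrite S0.
exists (g v0 - K * `|x - v0|) => v Sv.
have := H _ _ Sv0 Sv; rewrite ler_norml => /andP[_].
have : K * `|v0 - v| <= K * (`|x - v0| + `|x - v|).
  by rewrite ler_wpM2l// -[v0 - v](subrKA x) (le_trans (ler_normD _ _))// [`|v0 - x|]distrC.
by rewrite mulrDr; lra.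
Qed.

Lemma mcshane S g K : (forall x y, S x -> S y -> `|g x - g y| <= K * `|x - y|) -> 0 <= K ->
  exists2 f, forall x, S x -> f x = g x & forall x y, `|f x - f y| <= K * `|x - y|.
Proof.
move=> H K0; have mS := lip_minorized H K0; exists (inf_conv S g K) => [x Sx|x y].
  apply: inf_conv_eq => // v Sv; have := H _ _ Sx Sv; rewrite ler_norml => /andP[_]; lra.
exact: inf_conv_lip.
Qed.
End InfConv.

Lemma bigmin_seq_le (R : realDomainType) (I : eqType) (s : seq I) (c : R) (F : I -> R) i :
  i \in s -> \big[Num.min/c]_(j <- s) F j <= F i.
Proof.
elim: s => [//|j s IH]; rewrite inE big_cons ge_min => /predU1P[->|/IH ->].
  by rewrite lexx.
by rewrite orbT.
Qed.

Section Smoothing.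
Variables (R : realType) (d : nat).
Implicit Types U A : set 'rV[R]_d.+1.

(* [F] is the infimum of the cones [g v + 2 Lam |x - v|] over [A] and over a countable set
   [V] whose points thin out only at [A]. Near a point off [A] the steepness [2 Lam] leaves
   only finitely many cones active, so [F] is locally a finite minimum of functions that are
   differentiable almost everywhere. *)
Lemma lipschitz_smoothing U A (f : 'rV[R]_d.+1 -> R) (L M eta eps : R) :
  A `<=` U ->
  (forall x, U x -> ~ A x -> exists2 r : R, 0 < r & forall a, A a -> r <= `|x - a|) ->
  (forall x, U x -> `|f x| <= M) ->
  (forall e : R, 0 < e -> exists2 del : R, 0 < del &
    forall x y, U x -> U y -> `|x - y| < del -> `|f x - f y| <= e) ->
  0 < eta ->
  (forall a b, A a -> A b -> `|a - b| < eta -> `|f a - f b| <= L * `|a - b|) ->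
  (forall del : R, 0 < del -> exists2 s : seq 'rV[R]_d.+1, (forall v, v \in s -> U v) &
     forall x, U x -> exists2 v, v \in s & `|x - v| <= del) ->
  0 < eps ->
  exists F, exists2 K : R, 0 <= K & [/\ forall x y, `|F x - F y| <= K * `|x - y|,
    forall a, A a -> F a = f a, forall x, U x -> `|F x - f x| <= eps &
    adiff (U `\` A) F].
Proof.
move=> AU clA fM uf eta0 fL nets eps0.
wlog M0 : M fM / 0 < M.
  by move=> W; apply: (W (Num.max M 1)) => [x /fM h|]; rewrite ?lt_max ?ltr01 ?orbT// le_max h.
(* At distances of at least [eta] the bound [|f| <= M] alone gives the slope [2 M / eta]. *)
pose L0 := Num.max L (2 * M / eta).
have L00 : 0 < L0 by rewrite lt_max orbC divr_gt0// mulr_gt0.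
have fL0 a b : A a -> A b -> `|f a - f b| <= L0 * `|a - b|.
  move=> Aa Ab; have [ab|ab] := ltP `|a - b| eta.
    by apply: le_trans (fL _ _ Aa Ab ab) _; rewrite ler_wpM2r// le_max lexx.
  apply: (@le_trans _ _ (L0 * eta)); last by rewrite ler_pM2l.
  rewrite -ler_pdivrMr// le_max; apply/orP; right; rewrite ler_pM2r ?invr_gt0//.
  have := ler_normB (f a) (f b); have := fM _ (AU _ Aa); have := fM _ (AU _ Ab); lra.
have [E EA EL] := mcshane fL0 (ltW L00).
pose e1 := eps / 4; have e10 : 0 < e1 by rewrite divr_gt0.
have [del del0 fdel] := uf _ e10.
pose eta1 := Num.min del (e1 / L0).
have eta10 : 0 < eta1 by rewrite lt_min del0 divr_gt0.
have eta1d : eta1 <= del by rewrite ge_min lexx.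
have eta1L : L0 * eta1 <= e1 by rewrite mulrC -ler_pdivlMr// ge_min lexx orbT.
pose nearA v r := exists2 a, A a & `|v - a| < r.
(* Off [A] the map [f] is merely uniformly continuous. Close to [A] it is replaced by the Lipschitz
   extension [E] of its values on [A], so that [g] has a Lipschitz bound between any point of [U]
   and any point of [A] ([g3]). *)
pose g v := if `[< nearA v eta1 >] then E v else f v.
have g1 v : U v -> `|g v - f v| <= 2 * e1.
  move=> Uv; rewrite /g; case: asboolP => [[a Aa va]|_]; last first.
    by rewrite subrr normr0 mulr_ge0// ltW.
  have h1 := EL v a; rewrite (EA _ Aa) in h1.
  have h2 : `|f v - f a| <= e1.
    by apply: fdel => //; [exact: AU|exact: lt_le_trans va eta1d].
  have h3 : L0 * `|v - a| <= e1 by apply: le_trans eta1L; rewrite ler_pM2l// ltW.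
  have -> : E v - f v = (E v - f a) - (f v - f a) by ring.
  by have := ler_normB (E v - f a) (f v - f a); lra.
have g2 a : A a -> g a = f a.
  by move=> Aa; rewrite /g; case: asboolP => // _; rewrite EA.
pose Lam := L0 + 2 * M / eta1.
have Lam0 : 0 < Lam by rewrite addr_gt0// divr_gt0// mulr_gt0.
have Meta : 2 * M <= Lam * eta1.
  by rewrite /Lam [_ * eta1]mulrDl divfK ?gt_eqF// lerDr mulr_ge0// ltW.
have g3 v a : U v -> A a -> `|g v - g a| <= Lam * `|v - a|.
  move=> Uv Aa; rewrite (g2 _ Aa) /g; case: asboolP => [_|va].
    rewrite -(EA _ Aa); apply: le_trans (EL _ _) _.
    by rewrite ler_wpM2r// lerDl divr_ge0 ?mulr_ge0// ltW.
  have {}va : eta1 <= `|v - a| by rewrite leNgt; apply/negP => h; apply: va; exists a.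
  apply: le_trans (_ : Lam * eta1 <= _); last by rewrite ler_pM2l.
  have := ler_normB (f v) (f a); have := fM _ (AU _ Aa); have := fM _ Uv; lra.
pose th := Num.min (e1 / (2 * Lam)) (del / 2).
have th0 : 0 < th by rewrite lt_min !divr_gt0// mulr_gt0.
have thd : th < del by rewrite gt_min; apply/orP; right; rewrite gtr_pMr// invf_lt1// ltr1n.
have thL : 2 * Lam * th <= e1 by rewrite mulrC -ler_pdivlMr ?mulr_gt0// ge_min lexx.
pose dl (l : nat) : R := th / 2 ^+ l.
have dl0 l : 0 < dl l by rewrite divr_gt0// exprn_gt0.
have dlS l : dl l = 2 * dl l.+1 by rewrite /dl exprS invfM; field; rewrite expf_neq0.
have dl_le l l' : (l <= l')%N -> dl l' <= dl l.
  move=> /subnK <-; elim: (l' - l)%N => [//|j IH]; apply: le_trans IH.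
  by rewrite addSn (dlS (j + l)); have := dl0 (j + l).+1; lra.
have /choice[N' HN] : forall l, exists s : seq 'rV[R]_d.+1, (forall v, v \in s -> U v) /\
    forall x, U x -> exists2 v, v \in s & `|x - v| <= dl l.
  by move=> l; have [s h1 h2] := nets _ (dl0 l); exists s.
(* 41 = 2 * 20 + 1: if [l > 0] is the first level at which [A] is at distance at least [20 dl l]
   from [x], then [A] comes within [20 dl (l - 1) = 40 dl l] of [x], so the net point of level [l]
   next to [x] is retained. *)
pose V v := exists2 l, v \in N' l & l = 0%N \/ nearA v (41 * dl l).
have VU v : V v -> U v by move=> [l vl _]; exact: (HN l).1.
pose S := V `|` A.
have SU v : S v -> U v by move=> [/VU|/AU].
have gM v : U v -> `|g v| <= M + 2 * e1.
  move=> Uv; have := g1 v Uv; have := fM v Uv; have := ler_normD (g v - f v) (f v).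
  by rewrite subrK; lra.
have K0 : 0 <= 2 * Lam by rewrite mulr_ge0// ltW.
have mS : minorized S g (2 * Lam).
  move=> x; exists (- (M + 2 * e1)) => v /SU /gM; rewrite ler_norml => /andP[h _].
  by apply: le_trans h _; rewrite lerDl mulr_ge0.
pose F := inf_conv S g (2 * Lam).
have SN x : U x -> S !=set0.
  move=> Ux; have [v vN _] := (HN 0%N).2 x Ux; exists v; left; exists 0%N => //; by left.
exists F, (2 * Lam) => //; split.
- by move=> x y; exact: inf_conv_lip.
- move=> a Aa; rewrite -(g2 _ Aa); apply: inf_conv_eq => //; first by right.
  move=> v /SU Uv; have := g3 _ _ Uv Aa; rewrite ler_norml distrC => /andP[h _].
  have : 0 <= Lam * `|a - v| by rewrite mulr_ge0// ltW.
  by rewrite -mulrA; lra.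
- move=> x Ux; rewrite ler_norml; apply/andP; split.
    rewrite lerBrDr; apply: inf_conv_ge => [|v /SU Uv]; first exact: SN Ux.
    have [xv|xv] := ltP `|x - v| del.
      have := g1 v Uv; have := fdel _ _ Ux Uv xv; rewrite !ler_norml => /andP[_ h1] /andP[h2 _].
      have : 0 <= 2 * Lam * `|x - v| by rewrite mulr_ge0.
      by move: h1 h2; rewrite /e1; lra.
    have := gM v Uv; have := fM x Ux; rewrite !ler_norml => /andP[_ h1] /andP[h2 _].
    have : Lam * eta1 <= Lam * `|x - v| by rewrite ler_pM2l//; exact: le_trans eta1d xv.
    by move: h1 h2; rewrite -mulrA /e1; lra.
  have [v vN xv] := (HN 0%N).2 x Ux.
  have Uv := (HN 0%N).1 v vN.
  have Sv : S v by left; exists 0%N => //; left.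
  have := inf_conv_le x mS Sv; rewrite -/(F x).
  have xvt : `|x - v| <= th by move: xv; rewrite /dl expr0 divr1.
  have : 2 * Lam * `|x - v| <= 2 * Lam * th by rewrite ler_wpM2l.
  have := g1 v Uv; have := fdel _ _ Ux Uv (le_lt_trans xvt thd).
  by rewrite !ler_norml => /andP[h1 h1'] /andP[h2 h2']; move: h1 h1' h2 h2' thL; rewrite /e1; lra.
(* Seven further levels suffice: a point retained at level [l + 7] or later is within [41/128 dl l]
   of [A], and its cone is as inactive as the cones issuing from [A]. *)
pose s l := [seq v <- flatten [seq N' l' | l' <- iota 0 (l + 7)] | `[< V v >]].
pose h v (y : 'rV[R]_d.+1) := g v + 2 * Lam * `|y - v|.
pose m l (y : 'rV[R]_d.+1) := \big[Num.min/M + 2 * e1 + 4 * Lam * th]_(v <- s l) h v y.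
have am l : adiff setT (m l).
  apply: adiff_bigmin => v; apply: adiffD; first exact: adiff_cst.
  apply: adiffM; first exact: adiff_cst.
  apply: adiff_mxnorm => i; apply: (@adiff_eq _ _ _ (fun x => x 0 i - v 0 i)).
    by move=> x; rewrite !mxE.
  by apply: adiffB; [exact: adiff_coord|exact: adiff_cst].
suff key x : U x -> ~ A x -> exists l, forall y, `|y - x| <= dl l -> F y = m l y.
  have /choice[N HNl] : forall l, exists N, leb_null N /\ forall x, ~ N x -> differentiable (m l) x.
    by move=> l; have [N n1 n2] := am l; exists N; split => // x; exact: n2.
  exists [set x | exists l, N l x]; first by apply: leb_null_bigcup => l; exact: (HNl l).1.
  move=> x [Ux Ax] Nx; have [l Hl] := key x Ux Ax.
  apply: (differentiable_near _ ((HNl l).2 x _)).1; last by move=> Nlx; apply: Nx; exists l.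
  apply/nbhs_ballP; exists (dl l) => [|y]; first exact: dl0.
  by rewrite -ball_normE /ball_ /= distrC => /ltW /Hl ->.
move=> Ux Ax; have [r r0 Hr] := clA x Ux Ax.
pose P l := `[< ~ nearA x (20 * dl l) >].
have exP : exists l, P l.
  have [i Hi] := invS_lt (divr_gt0 r0 (mulr_gt0 (ltr0Sn R 19) th0)).
  exists i; apply/asboolP => -[a Aa]; apply/negP; rewrite -leNgt; apply: le_trans (Hr a Aa).
  move: Hi; rewrite ltr_pdivlMr ?mulr_gt0// => /ltW; apply: le_trans.
  rewrite /dl [leRHS]mulrCA ler_pM2l// [leRHS]mulrC ler_pM2l// lef_pV2 ?posrE ?exprn_gt0//.
  by rewrite -natrX ler_nat ltn_expl.
case: (ex_minnP exP) => l /asboolP Pl lmin; exists l => y yx.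
set D := dl l in yx *; have D0 : 0 < D := dl0 l.
have [v0 v0N xv0] := (HN l).2 x Ux; rewrite -/D in xv0.
have Uv0 := (HN l).1 _ v0N.
have Vv0 : V v0.
  exists l => //; move: lmin Pl; rewrite /D in xv0 *; case: (l) xv0 => [|l'] xv0 lmin _; first by left.
  right; have : ~~ P l' by apply/negP => /lmin; rewrite ltnn.
  move=> /asboolPn /contrapT[a Aa xa]; exists a => //.
  have : `|v0 - a| <= `|x - v0| + `|x - a|.
    by rewrite -[v0 - a](subrKA x) (le_trans (ler_normD _ _))// [`|v0 - x|]distrC.
  by move: xa xv0; rewrite (dlS l'); have := dl0 l'.+1; lra.
have in_s v l' : (l' < l + 7)%N -> v \in N' l' -> V v -> v \in s l.
  move=> ll' vN Vv; rewrite mem_filter; apply/andP; split; first exact/asboolP.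
  by apply/flattenP; exists (N' l') => //; apply/mapP; exists l' => //; rewrite mem_iota.
have yv0 : `|y - v0| <= 2 * D.
  rewrite -[y - v0](subrKA x) (le_trans (ler_normD _ _))//; lra.
have Dth : D <= th by have := dl_le 0%N l (leq0n _); rewrite /dl expr0 divr1.
apply/eqP; rewrite eq_le; apply/andP; split.
  rewrite /m big_seq; apply: le_bigmin => [|v].
    have := inf_conv_le y mS (or_introl Vv0 : S v0); rewrite -/(F y).
    have : 2 * Lam * `|y - v0| <= 2 * Lam * (2 * th).
      by apply: ler_wpM2l => //; apply: le_trans yv0 _; rewrite ler_pM2l.
    by have := gM v0 Uv0; rewrite ler_norml => /andP[_]; lra.
  by rewrite mem_filter => /andP[/asboolP Vv _]; apply: inf_conv_le => //; left.
apply: inf_conv_ge => [|v Sv]; first exact: SN Ux.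
have [vs|vs] := boolP (v \in s l); first exact: (bigmin_seq_le _ (fun v => h v y)).
have {vs} [a Aa va] : exists2 a, A a & `|v - a| <= D.
  case: Sv => [Vv|Av]; last by exists v; rewrite // subrr normr0 ltW.
  have [l' vN' Hl'] := Vv; have ll' : (l + 7 <= l')%N.
    by rewrite leqNgt; apply: contra vs => ll'; exact: (in_s v l').
  case: Hl' => [l'0|[a Aa va]]; first by move: ll'; rewrite l'0 addnS.
  exists a => //; apply/ltW/(lt_le_trans va).
  have := dl_le _ _ ll'; have := dl0 l.
  have -> : dl (l + 7)%N = dl l / 128 by rewrite /dl exprD; field; rewrite expf_neq0.
  by rewrite /D; lra.
apply: (@le_trans _ _ (h v0 y)).
  apply: (bigmin_seq_le _ (fun v => h v y)); apply: (in_s _ l) => //.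
  by rewrite -[X in (X < _)%N]addn0 ltn_add2l.
rewrite /h; have xa : 20 * D <= `|x - a|.
  by rewrite leNgt; apply/negP => xa; apply: Pl; exists a.
have := g3 _ _ Uv0 Aa; have Uv := SU _ Sv; have := g3 _ _ Uv Aa.
rewrite !ler_norml => /andP[h1 _] /andP[_ h2].
(* Relative to points of [A] the values of [g] vary with slope at most [Lam], while cones rise with
   slope [2 Lam]. As [a] is at distance at least [20 D] from [x], the cone of the nearby point [v0]
   lies below that of [v], which is within [D] of [a]. *)
suff : Lam * (`|v0 - a| + `|v - a| + 2 * `|y - v0|) <= Lam * (2 * `|y - v|).
  rewrite !(mulrDr Lam) => h3; clear -h1 h2 h3. lra.
rewrite ler_pM2l//.
have t1 : `|v0 - a| <= `|x - a| + `|x - v0|.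
  by rewrite -[v0 - a](subrKA x) (le_trans (ler_normD _ _))// [`|v0 - x|]distrC addrC.
have t2 : `|x - a| <= `|y - v| + `|y - x| + `|v - a|.
  rewrite -[x - a](subrKA v) (le_trans (ler_normD _ _))// lerD2r.
  by rewrite -[x - v](subrKA y) (le_trans (ler_normD _ _))// [`|x - y|]distrC addrC.
lra.
Qed.
End Smoothing.

(** * Homotopies *)

Section ContOn.
Variable R : realType.

Definition cont_on (T U : topologicalType) (S : set T) (f : T -> U) :=
  forall x, S x -> f y @[y --> within S (nbhs x)] --> f x.

Lemma cont_onP (T U : topologicalType) (S : set T) (f : T -> U) :
  {within S, continuous f} <-> cont_on S f.
Proof. exact: subspace_continuousP. Qed.

Lemma cont_on_sub (T U : topologicalType) (S S' : set T) (f : T -> U) :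
  S `<=` S' -> cont_on S' f -> cont_on S f.
Proof.
move=> SS' cf x Sx; apply: cvg_trans (cf x (SS' x Sx)).
by apply: cvg_app => A; rewrite /within /= !nbhs_simpl /within /= => H; apply: filterS H => y h /SS' /h.
Qed.

Lemma continuous_cont_on (T U : topologicalType) (S : set T) (f : T -> U) :
  continuous f -> cont_on S f.
Proof. by move=> cf x _; apply: cvg_within_filter; exact: cf. Qed.

Lemma cont_on_comp (T U W : topologicalType) (S : set T) (S' : set U) (f : T -> U) (g : U -> W) :
  cont_on S f -> (forall x, S x -> S' (f x)) -> cont_on S' g -> cont_on S (fun x => g (f x)).
Proof.
move=> cf fS cg x Sx; apply: (cvg_comp _ _ _ (cg _ (fS x Sx))).
move=> A /= /(cf x Sx); rewrite /within /= !nbhs_simpl /within /=; apply: filterS => y H Sy.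
by apply: H => //; exact: fS.
Qed.

Lemma cont_on_eq (T U : topologicalType) (S : set T) (f g : T -> U) :
  (forall x, S x -> f x = g x) -> cont_on S f -> cont_on S g.
Proof.
move=> fg cf x Sx; rewrite -(fg x Sx); apply: cvg_trans (cf x Sx).
apply: near_eq_cvg; rewrite near_withinE; near=> y => Sy; exact: fg.
Unshelve. all: by end_near. Qed.

Lemma cont_on_cst (T U : topologicalType) (S : set T) (c : U) : cont_on S (fun=> c).
Proof. by move=> x _; exact: cvg_cst. Qed.

Lemma cont_on_id (T : topologicalType) (S : set T) : cont_on S (fun x => x).
Proof. by move=> x _; apply: cvg_within. Qed.

Lemma cont_on_pair (T U W : topologicalType) (S : set T) (f : T -> U) (g : T -> W) :
  cont_on S f -> cont_on S g -> cont_on S (fun x => (f x, g x)).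
Proof. by move=> cf cg x Sx; apply: cvg_pair; [exact: cf|exact: cg]. Qed.

Lemma cont_on_fst (U W : topologicalType) (S : set (U * W)) : cont_on S fst.
Proof. by apply: continuous_cont_on => x; exact: cvg_fst. Qed.

Lemma cont_on_snd (U W : topologicalType) (S : set (U * W)) : cont_on S snd.
Proof. by apply: continuous_cont_on => x; exact: cvg_snd. Qed.

Section Arith.
Variables (T : topologicalType) (V : normedModType R) (S : set T).

Lemma cont_onD (f g : T -> V) : cont_on S f -> cont_on S g -> cont_on S (fun x => f x + g x).
Proof. by move=> cf cg x Sx; apply: cvgD; [exact: cf|exact: cg]. Qed.

Lemma cont_onN (f : T -> V) : cont_on S f -> cont_on S (fun x => - f x).
Proof. by move=> cf x Sx; apply: cvgN; exact: cf. Qed.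

Lemma cont_onB (f g : T -> V) : cont_on S f -> cont_on S g -> cont_on S (fun x => f x - g x).
Proof. by move=> cf cg; apply: cont_onD => //; exact: cont_onN. Qed.

Lemma cont_onZ (k : T -> R) (f : T -> V) :
  cont_on S k -> cont_on S f -> cont_on S (fun x => k x *: f x).
Proof. by move=> cf cg x Sx; apply: cvgZ; [exact: cf|exact: cg]. Qed.

Lemma cont_onM (f g : T -> R) : cont_on S f -> cont_on S g -> cont_on S (fun x => f x * g x).
Proof. by move=> cf cg x Sx; apply: cvgM; [exact: cf|exact: cg]. Qed.

Lemma cont_onV (f : T -> R) : (forall x, S x -> f x != 0) -> cont_on S f ->
  cont_on S (fun x => (f x)^-1).
Proof. by move=> f0 cf x Sx; apply: cvgV; [exact: f0|exact: cf]. Qed.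

Lemma cont_on_norm (f : T -> V) : cont_on S f -> cont_on S (fun x => `|f x|).
Proof. by move=> cf x Sx; apply: cvg_norm; exact: cf. Qed.

Lemma cont_onDr (f g : T -> R) : cont_on S f -> cont_on S g -> cont_on S (fun x => f x + g x).
Proof. by move=> cf cg x Sx; apply: cvgD; [exact: cf|exact: cg]. Qed.

Lemma cont_onBr (f g : T -> R) : cont_on S f -> cont_on S g -> cont_on S (fun x => f x - g x).
Proof. by move=> cf cg x Sx; apply: cvgB; [exact: cf|exact: cg]. Qed.

Lemma cont_on_abs (f : T -> R) : cont_on S f -> cont_on S (fun x => `|f x|).
Proof. by move=> cf x Sx; apply: cvg_norm; exact: cf. Qed.

Lemma cont_on_sum (I : Type) (s : seq I) (f : I -> T -> R) : (forall i, cont_on S (f i)) ->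
  cont_on S (fun x => \sum_(i <- s) f i x).
Proof.
move=> cf; elim: s => [|i s IH].
  by under eq_fun do rewrite big_nil; exact: cont_on_cst.
by under eq_fun do rewrite big_cons; exact: cont_onDr.
Qed.

Lemma cont_on_coord d (f : T -> 'rV[R]_d) i : cont_on S f -> cont_on S (fun x => f x 0 i).
Proof.
move=> cf; apply: (@cont_on_comp _ _ _ _ setT _ (fun v : 'rV[R]_d => v 0 i)) => //.
by apply: continuous_cont_on; exact: coord_continuous.
Qed.

Lemma cont_on_row d (f : T -> 'rV[R]_d) : (forall i, cont_on S (fun x => f x 0 i)) ->
  cont_on S f.
Proof.
move=> cf x Sx; have -> : f = (fun y => \sum_i f y 0 i *: delta_mx 0 i).
  by apply/funext => y; rewrite -row_sum_delta.
elim: (index_enum _) => [|i s IH].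
  by under eq_fun do rewrite big_nil; rewrite big_nil; exact: cvg_cst.
under eq_fun do rewrite big_cons; rewrite big_cons.
by apply: cvgD => //; apply: cvgZr_tmp; exact: cf.
Qed.

Lemma cont_on_min (f g : T -> R) : cont_on S f -> cont_on S g ->
  cont_on S (fun x => Num.min (f x) (g x)).
Proof.
move=> cf cg; apply: (@cont_on_eq _ _ _ (fun x => 2^-1 * (f x + g x - `|f x - g x|))).
  by move=> x _; rewrite minr_absE mulrC.
apply: cont_onM; first exact: cont_on_cst.
by apply: cont_onBr; [exact: cont_onDr|apply: cont_on_abs; exact: cont_onBr].
Qed.

Lemma cont_on_glue (U : topologicalType) (phi : T -> R) (f g : T -> U) : cont_on S phi ->
  cont_on (S `&` [set x | phi x <= 0]) f -> cont_on (S `&` [set x | 0 <= phi x]) g ->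
  (forall x, S x -> phi x = 0 -> f x = g x) ->
  cont_on S (fun x => if phi x <= 0 then f x else g x).
Proof.
move=> cp cf cg fg x Sx.
have E (P : set T) : (\forall y \near within (S `&` [set x | phi x <= 0]) (nbhs x), P y) ->
    (\forall y \near within (S `&` [set x | 0 <= phi x]) (nbhs x), P y) ->
    \forall y \near within S (nbhs x), P y.
  rewrite !near_withinE => h1 h2; near=> y => Sy.
  have [py|py] := leP (phi y) 0; first by apply: (near h1 y).
  by apply: (near h2 y) => //; split => //; exact: ltW.
move=> A nA /=; rewrite nbhs_simpl /=.
have [p0|p0|p0] := ltgtP (phi x) 0.
- have := cf x (conj Sx (ltW p0)); rewrite (ltW p0) in nA => /(_ A nA).
  have := cp x Sx => /(@cvgr_lt _ _ _ _ _ _) => /(_ _ p0).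
  rewrite /= !nbhs_simpl /= !near_withinE => h1 h2; apply: (filterS2 _ _ h1 h2) => y h1y h2y Sy.
  have py : phi y < 0 by exact: h1y.
  by rewrite /= (ltW py); apply: h2y; split => //; exact: ltW.
- have := cg x (conj Sx (ltW p0)); rewrite leNgt p0 /= in nA => /(_ A nA).
  have := cp x Sx => /(@cvgr_gt _ _ _ _ _ _) => /(_ _ p0).
  rewrite /= !nbhs_simpl /= !near_withinE => h1 h2; apply: (filterS2 _ _ h1 h2) => y h1y h2y Sy.
  have py : 0 < phi y by exact: h1y.
  by rewrite /= leNgt py /=; apply: h2y; split => //; exact: ltW.
- apply: E.
  + have := cf x; rewrite /= p0 => /(_ (conj Sx (lexx _)) A).
    rewrite p0 lexx in nA => /(_ nA); rewrite /= !nbhs_simpl /= !near_withinE.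
    by move=> h0; apply: (@filterS _ (nbhs x) _ _ _ _ h0) => y h [Sy py]; rewrite /= py; exact: h.
  + have := cg x; rewrite /= p0 => /(_ (conj Sx (lexx _)) A).
    rewrite p0 lexx (fg _ Sx p0) in nA => /(_ nA); rewrite /= !nbhs_simpl /= !near_withinE.
    move=> h0; apply: (@filterS _ (nbhs x) _ _ _ _ h0) => y h [Sy py]; rewrite /=; case: ifP => py'; last exact: h.
    by rewrite fg//; [exact: h|apply/eqP; rewrite eq_le py' py].
Unshelve. all: by end_near. Qed.
End Arith.
End ContOn.

Section Htpy.
Variables (R : realType) (V W : normedModType R).
Implicit Types (S : set V) (Y : set W) (f g h : V -> W).

Definition cyl S : set (R * V) := [set p | 0 <= p.1 <= 1 /\ S p.2].

Definition htpy S Y f g := exists H : R * V -> W, [/\ cont_on (cyl S) H,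
  forall t x, 0 <= t <= 1 -> S x -> Y (H (t, x)) &
  forall x, S x -> H (0, x) = f x /\ H (1, x) = g x].

Lemma htpy_line S Y f g : cont_on S f -> cont_on S g ->
  (forall t x, 0 <= t <= 1 -> S x -> Y ((1 - t) *: f x + t *: g x)) -> htpy S Y f g.
Proof.
move=> cf cg H; exists (fun p => (1 - p.1) *: f p.2 + p.1 *: g p.2); split=> //.
  have c1 : cont_on (cyl S) (fst : R * V -> R) by exact: cont_on_fst.
  have c2 h : cont_on S h -> cont_on (cyl S) (fun p => h p.2).
    by apply: (cont_on_comp (@cont_on_snd _ _ _)) => p [].
  apply: cont_onD; apply: cont_onZ => //; try exact: c2.
  by apply: cont_onB => //; exact: cont_on_cst.
by move=> x Sx /=; rewrite subr0 subrr !scale1r !scale0r addr0 add0r.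
Qed.

Lemma htpy_eq S Y f f' g g' : (forall x, S x -> f x = f' x) -> (forall x, S x -> g x = g' x) ->
  htpy S Y f g -> htpy S Y f' g'.
Proof.
move=> ff gg [H [h1 h2 h3]]; exists H; split=> // x Sx.
by have [-> ->] := h3 x Sx; rewrite ff// gg.
Qed.

Lemma htpy_sym S Y f g : htpy S Y f g -> htpy S Y g f.
Proof.
move=> [H [h1 h2 h3]]; exists (fun p => H (1 - p.1, p.2)); split.
- apply: (@cont_on_comp _ _ _ _ (cyl S) (fun p : R * V => (1 - p.1, p.2))) => //.
    apply: cont_on_pair; last exact: cont_on_snd.
    by apply: cont_onBr; [exact: cont_on_cst|exact: cont_on_fst].
  by move=> [t x] [/= /andP[t0 t1] Sx]; split=> //=; lra.
- by move=> t x t01 Sx /=; apply: h2 => //; lra.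
- by move=> x Sx /=; rewrite subr0 subrr; have [] := h3 x Sx.
Qed.

Lemma htpy_trans S Y f g h : htpy S Y f g -> htpy S Y g h -> htpy S Y f h.
Proof.
move=> [H [h1 h2 h3]] [K [k1 k2 k3]].
exists (fun p => if p.1 - 2^-1 <= 0 then H (2 * p.1, p.2) else K (2 * p.1 - 1, p.2)); split.
- apply: cont_on_glue.
  + by apply: cont_onBr; [exact: cont_on_fst|exact: cont_on_cst].
  + apply: (@cont_on_comp _ _ _ _ (cyl S) (fun p : R * V => (2 * p.1, p.2))) => //.
      apply: cont_on_pair; last exact: cont_on_snd.
      by apply: cont_onM; [exact: cont_on_cst|exact: cont_on_fst].
    by move=> [t x] [[/= /andP[t0 t1] Sx] /= th]; split=> //=; lra.
  + apply: (@cont_on_comp _ _ _ _ (cyl S) (fun p : R * V => (2 * p.1 - 1, p.2))) => //.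
      apply: cont_on_pair; last exact: cont_on_snd.
      apply: cont_onBr; last exact: cont_on_cst.
      by apply: cont_onM; [exact: cont_on_cst|exact: cont_on_fst].
    by move=> [t x] [[/= /andP[t0 t1] Sx] /= th]; split=> //=; lra.
  + move=> [t x] [/= _ Sx] /eqP; rewrite subr_eq0 => /eqP ->.
    by rewrite divff// subrr; have [_ ->] := h3 x Sx; have [-> _] := k3 x Sx.
- move=> t x t01 Sx /=; case: ifP => th; [apply: h2 => //|apply: k2 => //].
    lra.
  by move/negbT: th; rewrite -ltNge; lra.
- move=> x Sx /=; have -> : 0 - 2^-1 <= 0 :> R by lra.
  have -> : (1 - 2^-1 <= 0 :> R) = false by apply/negbTE; rewrite -ltNge; lra.
  rewrite mulr0 mulr1; have -> : 2 - 1 = 1 :> R by lra.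
  by have [-> _] := h3 x Sx; have [_ ->] := k3 x Sx.
Qed.

Lemma htpy_contl S Y f g : htpy S Y f g -> cont_on S f /\ cont_on S g.
Proof.
move=> [H [h1 h2 h3]].
have E (t : R) : 0 <= t <= 1 -> cont_on S (fun x => H (t, x)).
  move=> t01; apply: (@cont_on_comp _ _ _ _ (cyl S) (fun x => (t, x))) => //.
  by apply: cont_on_pair; [exact: cont_on_cst|exact: cont_on_id].
split.
  by apply: cont_on_eq (E 0 _) => [x /h3[]//|]; rewrite lexx ler01.
by apply: cont_on_eq (E 1 _) => [x /h3[]//|]; rewrite lexx ler01.
Qed.

Lemma htpyY S Y f g : htpy S Y f g -> forall x, S x -> Y (f x) /\ Y (g x).
Proof.
move=> [H [h1 h2 h3]] x Sx; have [<- <-] := h3 x Sx.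
by split; apply: h2; rewrite ?lexx ?ler01.
Qed.
End Htpy.

Lemma htpy_post (R : realType) (V W W' : normedModType R) (S : set V) (Y : set W) (Y' : set W')
  f g (q : W -> W') : cont_on Y q -> (forall y, Y y -> Y' (q y)) ->
  htpy S Y f g -> htpy S Y' (fun x => q (f x)) (fun x => q (g x)).
Proof.
move=> cq qY [H [h1 h2 h3]]; exists (fun p => q (H p)); split.
- by apply: (cont_on_comp h1 _ cq) => -[t x] [t01 Sx]; exact: h2.
- by move=> t x t01 Sx; apply: qY; exact: h2.
- by move=> x Sx; have [-> ->] := h3 x Sx.
Qed.

Lemma htpy_pre (R : realType) (V V' W : normedModType R) (S : set V) (S' : set V') (Y : set W)
  f g (c : V' -> V) : cont_on S' c -> (forall x, S' x -> S (c x)) ->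
  htpy S Y f g -> htpy S' Y (fun x => f (c x)) (fun x => g (c x)).
Proof.
move=> cc cS [H [h1 h2 h3]]; exists (fun p => H (p.1, c p.2)); split.
- apply: (@cont_on_comp _ _ _ _ (cyl S) (fun p : R * V' => (p.1, c p.2))) => //.
    apply: cont_on_pair; first exact: cont_on_fst.
    by apply: (cont_on_comp (@cont_on_snd _ _ _) _ cc) => p [].
  by move=> [t x] [t01 Sx]; split=> //; exact: cS.
- by move=> t x t01 Sx; apply: h2 => //; exact: cS.
- by move=> x Sx; have [] := h3 _ (cS x Sx).
Qed.

Definition sup_sphere (R : realType) (V : normedModType R) : set V := [set x | `|x| = 1].
Arguments sup_sphere {R} V.

(** Polar coordinates on the shell: the radius serves as time, running from 0 at radius 1 to 1 at
    radius [mu], and the radial projection as position. *)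
Lemma htpy_shell (R : realType) (V W : normedModType R) (Y : set W) (f g : V -> W) (mu : R) :
  0 < mu < 1 -> htpy (sup_sphere V) Y f g ->
  exists I : V -> W, [/\ cont_on [set z | mu <= `|z| <= 1] I,
    forall z, mu <= `|z| <= 1 -> Y (I z), forall z, `|z| = 1 -> I z = f z &
    forall z, `|z| = 1 -> I (mu *: z) = g z].
Proof.
move=> /andP[mu0 mu1] [H [h1 h2 h3]].
have m1 : 0 < 1 - mu by rewrite subr_gt0.
pose P z : R * V := ((1 - `|z|) / (1 - mu), `|z|^-1 *: z).
have PH z : mu <= `|z| <= 1 -> cyl (sup_sphere V) (P z).
  move=> /andP[z0 z1]; split=> /=.
    apply/andP; split; first by rewrite divr_ge0 ?subr_ge0// ltW.
    by rewrite ler_pdivrMr// mul1r lerD2l lerN2.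
  rewrite /sup_sphere /= normrZ normfV normr_id mulVf// gt_eqF//; exact: lt_le_trans z0.
exists (fun z => H (P z)); split.
- apply: (@cont_on_comp _ _ _ _ (cyl (sup_sphere V)) P) => //.
  have cn : cont_on [set z : V | mu <= `|z| <= 1] (fun z => `|z|).
    by apply: cont_on_norm; exact: cont_on_id.
  apply: cont_on_pair.
    by apply: cont_onM; [apply: cont_onBr|]; rewrite //; exact: cont_on_cst.
  apply: cont_onZ; last exact: cont_on_id.
  apply: cont_onV => // z /andP[z0 _]; rewrite gt_eqF//; exact: lt_le_trans z0.
- by move=> z /PH[t01 Sz]; exact: h2.
- move=> z z1; rewrite /P z1 subrr mul0r invr1 scale1r.
  by have [] := h3 z z1.
- move=> z z1; rewrite /P normrZ z1 mulr1 gtr0_norm// divff ?gt_eqF//.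
  by rewrite scalerA mulVf ?gt_eqF// scale1r; have [] := h3 z z1.
Qed.

(** * Compactness *)

Section Compact.
Variable R : realType.

Lemma seq_pos_lower (I : eqType) (s : seq I) (h : I -> R) : (forall i, i \in s -> 0 < h i) ->
  exists2 e, 0 < e & forall i, i \in s -> e <= h i.
Proof.
elim: s => [_|i s IH H]; first by exists 1.
have [|e e0 He] := IH; first by move=> j js; apply: H; rewrite inE js orbT.
exists (Num.min e (h i)) => [|j]; first by rewrite lt_min e0 H// mem_head.
by rewrite inE ge_min => /predU1P[->|/He ->//]; rewrite lexx orbT.
Qed.

Lemma seq_upper (I : eqType) (s : seq I) (h : I -> R) :
  exists2 e, 0 <= e & forall i, i \in s -> h i <= e.
Proof.
elim: s => [|i s [e e0 He]]; first by exists 0.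
exists (Num.max e (h i)) => [|j]; first by rewrite le_max e0.
by rewrite inE le_max => /predU1P[->|/He ->//]; rewrite lexx orbT.
Qed.

Lemma ball_normP (V : normedModType R) (x : V) (e : R) y : ball x e y <-> `|y - x| < e.
Proof. by rewrite -ball_normE /ball_ /= distrC. Qed.

Lemma compact_seq_cover n (U : set 'rV[R]_n) (r : 'rV[R]_n -> R) : compact U ->
  (forall x, U x -> 0 < r x) -> exists2 s : seq 'rV[R]_n, (forall v, v \in s -> U v) &
     forall x, U x -> exists2 v, v \in s & `|x - v| < r v.
Proof.
rewrite compact_cover => cU r0.
have [v _|x Ux|D' D'U cov] := cU _ U (fun v => ball v (r v)).
- exact: ball_open.
- by exists x => //; apply/ball_normP; rewrite subrr normr0; exact: r0.
exists (finmap.enum_fset D') => [v vD|x Ux]; first by have := D'U v vD; rewrite inE.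
by have [v vD /ball_normP xv] := cov x Ux; exists v.
Qed.

Lemma compact_ucont n (W : normedModType R) (U : set 'rV[R]_n) (f : 'rV[R]_n -> W) :
  compact U -> cont_on U f -> forall e : R, 0 < e -> exists2 del : R, 0 < del &
    forall x y, U x -> U y -> `|x - y| < del -> `|f x - f y| <= e.
Proof.
move=> cU cf e e0; have e2 : 0 < e / 2 by rewrite divr_gt0.
have /choice[r Hr] : forall x, exists r : R, U x -> 0 < r /\
    forall y, U y -> `|y - x| < 2 * r -> `|f y - f x| < e / 2.
  move=> x; have [Ux|nUx] := pselect (U x); last by exists 0.
  have /cvgrPdist_lt /(_ _ e2) := cf x Ux; rewrite near_withinE => /nbhs_ex_ball[r r0 H].
  exists (r / 2) => _; split; first by rewrite divr_gt0.
  by move=> y Uy yx; rewrite distrC; apply: H => //; rewrite mulrC divfK in yx.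
have [s sU cov] := compact_seq_cover cU (fun x Ux => (Hr x Ux).1).
have [del del0 Hdel] := seq_pos_lower (fun v vs => (Hr v (sU v vs)).1).
exists del => // x y Ux Uy xy; have [v vs xv] := cov x Ux.
have [_ H] := Hr v (sU v vs); have dv := Hdel v vs.
have hx : `|f x - f v| < e / 2 by apply: H => //; have := normr_ge0 (x - v); lra.
have hy : `|f y - f v| < e / 2.
  apply: H => //; rewrite -[y - v](subrKA x); apply: le_lt_trans (ler_normD _ _) _.
  by rewrite [`|y - x|]distrC; lra.
have : `|f x - f y| <= `|f x - f v| + `|f y - f v|.
  by rewrite -[f x - f y](subrKA (f v)) [`|f y - f v|]distrC ler_normD.
by lra.
Qed.

Lemma compact_bounded_fun n (W : normedModType R) (U : set 'rV[R]_n) (f : 'rV[R]_n -> W) :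
  compact U -> cont_on U f -> exists M : R, forall x, U x -> `|f x| <= M.
Proof.
move=> cU cf; have [del del0 H] := compact_ucont cU cf ltr01.
have [s sU cov] := @compact_seq_cover _ _ (fun=> del) cU (fun _ _ => del0).
have [M _ HM] := seq_upper s (fun v => `|f v|); exists (M + 1) => x Ux.
have [v vs xv] := cov x Ux; have := H x v Ux (sU v vs) xv; have := HM v vs.
by have := ler_normD (f x - f v) (f v); rewrite subrK; lra.
Qed.

Lemma compact_pos_lower n (U : set 'rV[R]_n) (f : 'rV[R]_n -> R) :
  compact U -> cont_on U f -> (forall x, U x -> 0 < f x) ->
  exists2 e, 0 < e & forall x, U x -> e <= f x.
Proof.
move=> cU cf f0; have cg : cont_on U (fun x => (f x)^-1 : R^o).
  by apply: cont_onV => // x Ux; rewrite gt_eqF// f0.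
have [M HM] := compact_bounded_fun cU cg.
exists (Num.max M 1)^-1 => [|x Ux]; first by rewrite invr_gt0 lt_max ltr01 orbT.
have fx := f0 x Ux; rewrite invf_ple ?posrE ?lt_max ?ltr01 ?orbT//.
by have := HM x Ux; rewrite gtr0_norm ?invr_gt0// le_max => ->.
Qed.

Lemma closed_dist n (A : set 'rV[R]_n) x : closed A -> ~ A x ->
  exists2 r : R, 0 < r & forall a, A a -> r <= `|x - a|.
Proof.
move=> cA Ax; have : \forall y \near x, ~ A y by apply: (closed_openC cA).
move=> /nbhs_ex_ball[r r0 H]; exists r => // a Aa; rewrite leNgt; apply/negP => xa.
by apply: (H a) => //; rewrite distrC.
Qed.

Lemma bounded_closed_compactP n (U : set 'rV[R]_n) (M : R) :
  (forall x, U x -> `|x| <= M) -> closed U -> compact U.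
Proof.
move=> UM; apply: bounded_closed_compact; exists M; split; first exact: num_real.
by move=> M' MM' x /UM xM; apply: le_trans xM (ltW MM').
Qed.

Lemma closed_preimage_le (V : topologicalType) (f : V -> R) (c : R) : continuous f ->
  closed [set x | f x <= c].
Proof. by move=> cf; apply: (@preimage_closed _ _ f [set y | y <= c]) => [x _|]; [exact: cf|exact: closed_le]. Qed.

Lemma closed_preimage_ge (V : topologicalType) (f : V -> R) (c : R) : continuous f ->
  closed [set x | c <= f x].
Proof. by move=> cf; apply: (@preimage_closed _ _ f [set y | c <= y]) => [x _|]; [exact: cf|exact: closed_ge]. Qed.

Lemma closed_preimage_eq (V : topologicalType) (f : V -> R) (c : R) : continuous f ->
  closed [set x | f x = c].
Proof.
move=> cf; rewrite (_ : [set x | _] = [set x | f x <= c] `&` [set x | c <= f x]).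
  by apply: closedI; [exact: closed_preimage_le|exact: closed_preimage_ge].
apply/seteqP; split => x /=; first by move=> ->; rewrite lexx.
by move=> [h1 h2]; apply/eqP; rewrite eq_le h1 h2.
Qed.

Lemma vector_smoothing d n (U A : set 'rV[R]_d.+1) (f : 'rV[R]_d.+1 -> 'rV[R]_n) (L eta eps : R) :
  compact U -> closed A -> A `<=` U -> cont_on U f -> 0 < eta ->
  (forall a b, A a -> A b -> `|a - b| < eta -> `|f a - f b| <= L * `|a - b|) ->
  0 < eps ->
  exists F : 'rV[R]_d.+1 -> 'rV[R]_n, exists2 K : R, 0 <= K &
   [/\ forall x y, `|F x - F y| <= K * `|x - y|,
    forall a, A a -> F a = f a, forall x, U x -> `|F x - f x| <= eps &
    forall i, adiff (U `\` A) (fun x => F x 0 i)].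
Proof.
move=> cU cA AU cf eta0 fL eps0.
have H i : exists F : 'rV[R]_d.+1 -> R, exists2 K : R, 0 <= K &
   [/\ forall x y, `|F x - F y| <= K * `|x - y|,
    forall a, A a -> F a = f a 0 i, forall x, U x -> `|F x - f x 0 i| <= eps &
    adiff (U `\` A) F].
  have [M HM] := compact_bounded_fun cU cf.
  apply: (@lipschitz_smoothing _ _ U A (fun x => f x 0 i) L M eta eps) => //.
  - by move=> x Ux Ax; exact: closed_dist.
  - by move=> x Ux; apply: le_trans (norm_coord _ _) (HM x Ux).
  - move=> e e0; have [del del0 H] := compact_ucont cU cf e0; exists del => // x y Ux Uy xy.
    by apply: le_trans (H x y Ux Uy xy); have := norm_coord (f x - f y) i; rewrite !mxE.
  - move=> a b Aa Ab ab; apply: le_trans (fL a b Aa Ab ab).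
    by have := norm_coord (f a - f b) i; rewrite !mxE.
  - move=> del del0; have [s h1 h2] := @compact_seq_cover _ _ (fun=> del) cU (fun _ _ => del0).
    by exists s => // x /h2[v vs /ltW xv]; exists v.
have /choice[F /choice[K HF]] : forall i, exists F (K : R), 0 <= K /\
   [/\ forall x y, `|F x - F y| <= K * `|x - y|,
    forall a, A a -> F a = f a 0 i, forall x, U x -> `|F x - f x 0 i| <= eps &
    adiff (U `\` A) F].
  by move=> i; have [F [K K0 HF]] := H i; exists F, K.
have [K' K'0 HK'] := seq_upper (enum 'I_n) K.
exists (fun x => \row_i F i x), K' => //; split.
- move=> x y; apply: norm_le => [|i]; first by rewrite mulr_ge0.
  have [_ [h _ _ _]] := HF i; rewrite !mxE; apply: le_trans (h x y) _.
  by rewrite ler_wpM2r// HK'// mem_enum.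
- by move=> a Aa; apply/rowP => i; rewrite mxE; have [_ [_ -> ]] := HF i.
- move=> x Ux; apply: norm_le => [|i]; first exact: ltW.
  by rewrite !mxE; have [_ [_ _ h _]] := HF i; exact: h.
- move=> i; have [_ [_ _ _ h]] := HF i; apply: adiff_eq h => x; by rewrite mxE.
Qed.
End Compact.

(** * Euclidean norm, cubes and spheres *)

Section Enorm.
Variable R : realType.

Lemma enorm_ge0 d (x : 'rV[R]_d) : 0 <= enorm x.
Proof. exact: sqrtr_ge0. Qed.

Lemma enorm_sqr d (x : 'rV[R]_d) : enorm x ^+ 2 = \sum_(i < d) x 0 i ^+ 2.
Proof. by rewrite sqr_sqrtr//; apply: sumr_ge0 => i _; exact: sqr_ge0. Qed.

Lemma coord_le_enorm d (x : 'rV[R]_d) i : `|x 0 i| <= enorm x.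
Proof.
rewrite -(@ler_pXn2r _ 2)// ?nnegrE ?enorm_ge0// enorm_sqr -normrX ger0_norm ?sqr_ge0//.
by rewrite (bigD1 i)//= lerDl; apply: sumr_ge0 => j _; exact: sqr_ge0.
Qed.

Lemma norm_le_enorm d (x : 'rV[R]_d) : `|x| <= enorm x.
Proof. by apply: norm_le => [|i]; [exact: enorm_ge0|exact: coord_le_enorm]. Qed.

Lemma enorm_le d (x : 'rV[R]_d) : enorm x <= d%:R * `|x|.
Proof.
rewrite -(@ler_pXn2r _ 2)// ?nnegrE ?enorm_ge0 ?mulr_ge0// enorm_sqr exprMn.
apply: (@le_trans _ _ (\sum_(i < d) `|x| ^+ 2)).
  apply: ler_sum => i _; rewrite -[leLHS]ger0_norm ?sqr_ge0// normrX.
  by rewrite ler_pXn2r// ?nnegrE//; exact: norm_coord.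
rewrite sumr_const card_ord -[leLHS]mulr_natl ler_wpM2r ?sqr_ge0//.
by rewrite -natrX ler_nat -mulnn; case: (d) => // m; rewrite leq_pmulr.
Qed.

Lemma enormZ d (a : R) (x : 'rV[R]_d) : enorm (a *: x) = `|a| * enorm x.
Proof.
apply/eqP; rewrite -(@eqrXn2 _ 2)// ?mulr_ge0 ?enorm_ge0// exprMn !enorm_sqr real_normK ?num_real//.
by rewrite mulr_sumr; apply/eqP/eq_bigr => i _; rewrite mxE exprMn.
Qed.

Lemma enormN d (x : 'rV[R]_d) : enorm (- x) = enorm x.
Proof. by rewrite -scaleN1r enormZ normrN1 mul1r. Qed.

Lemma enorm0_eq0 d (x : 'rV[R]_d) : enorm x = 0 -> x = 0.
Proof. by move=> x0; apply/eqP; rewrite -normr_le0 -x0; exact: norm_le_enorm. Qed.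

Lemma enorm_gt0 d (x : 'rV[R]_d) : x != 0 -> 0 < enorm x.
Proof.
move=> x0; rewrite lt_neqAle enorm_ge0 andbT eq_sym; apply/eqP => E.
by rewrite (enorm0_eq0 E) eqxx in x0.
Qed.

Lemma enorm_lip d (x y : 'rV[R]_d) : `|enorm x - enorm y| <= d%:R * `|x - y|.
Proof.
have [s0|s0] := eqVneq (enorm x + enorm y) 0.
  have x0 : enorm x = 0 by have := enorm_ge0 x; have := enorm_ge0 y; lra.
  have y0 : enorm y = 0 by have := enorm_ge0 x; have := enorm_ge0 y; lra.
  by rewrite x0 y0 subrr normr0 mulr_ge0.
have {}s0 : 0 < enorm x + enorm y by rewrite lt_neqAle eq_sym s0 addr_ge0 ?enorm_ge0.
rewrite -(ler_pM2r s0) -{1}(gtr0_norm s0) -normrM -subr_sqr !enorm_sqr -sumrB.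
apply: le_trans (ler_norm_sum _ _ _) _; rewrite -mulrA mulr_natl.
rewrite -[leRHS](_ : \sum_(i < d) `|x - y| * (enorm x + enorm y) = _); last first.
  by rewrite sumr_const card_ord.
apply: ler_sum => i _; rewrite subr_sqr normrM ler_pM//.
  by have := norm_coord (x - y) i; rewrite !mxE.
by rewrite (le_trans (ler_normD _ _))// lerD// coord_le_enorm.
Qed.

Lemma continuous_enorm d : continuous (@enorm R d).
Proof.
apply/continuous_subspace_setT/cont_onP.
apply: (@cont_on_eq _ _ _ (fun x : 'rV[R]_d => Num.sqrt (\sum_(i < d) x 0 i ^+ 2))) => //.
apply: (@cont_on_comp _ _ _ setT setT (fun x : 'rV[R]_d => \sum_(i < d) x 0 i ^+ 2) Num.sqrt) => //.
  apply: cont_on_sum => i; apply: cont_onM; apply: cont_on_coord; exact: cont_on_id.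
by apply: continuous_cont_on; exact: sqrt_continuous.
Qed.

Definition rad d (x : 'rV[R]_d) : 'rV[R]_d := (enorm x)^-1 *: x.
Definition cubify d (x : 'rV[R]_d) : 'rV[R]_d := `|x|^-1 *: x.

Lemma enorm_rad d (x : 'rV[R]_d) : x != 0 -> enorm (rad x) = 1.
Proof. by move=> x0; rewrite enormZ gtr0_norm ?invr_gt0 ?enorm_gt0// mulVf// gt_eqF ?enorm_gt0. Qed.

Lemma norm_cubify d (x : 'rV[R]_d) : x != 0 -> `|cubify x| = 1.
Proof. by move=> x0; rewrite normrZ normfV normr_id mulVf// normr_eq0. Qed.

Lemma rad_id d (x : 'rV[R]_d) : enorm x = 1 -> rad x = x.
Proof. by move=> x1; rewrite /rad x1 invr1 scale1r. Qed.

Lemma sphere_neq0 d (x : 'rV[R]_d) : enorm x = 1 -> x != 0.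
Proof.
apply: contra_eq_neq => ->; rewrite -(scale0r (0 : 'rV[R]_d)) enormZ normr0 mul0r.
by rewrite eq_sym oner_eq0.
Qed.

Lemma cont_on_rad d : cont_on [set x : 'rV[R]_d | x != 0] (@rad d).
Proof.
apply: cont_onZ; last exact: cont_on_id.
apply: cont_onV => [x /= /enorm_gt0 x0|]; first by rewrite gt_eqF.
by apply: continuous_cont_on; exact: continuous_enorm.
Qed.

Lemma cont_on_cubify d : cont_on [set x : 'rV[R]_d | x != 0] (@cubify d).
Proof.
apply: cont_onZ; last exact: cont_on_id.
apply: cont_onV => [x /= x0|]; first by rewrite normr_eq0.
by apply: cont_on_norm; exact: cont_on_id.
Qed.

(** A segment between two points of the sphere that are not antipodal misses 0, so the straight
    homotopy can be projected back radially. *)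
Lemma htpy_sphere (V : normedModType R) (S : set V) d (f g : V -> 'rV[R]_d.+1) :
  cont_on S f -> cont_on S g -> (forall x, S x -> sphere d (f x)) ->
  (forall x, S x -> sphere d (g x)) -> (forall x, S x -> f x <> - g x) ->
  htpy S (sphere d) f g.
Proof.
move=> cf cg fS gS fg.
have H : htpy S [set x : 'rV[R]_d.+1 | x != 0] f g.
  apply: htpy_line => // t x /andP[t0 t1] Sx /=; apply/eqP => E.
  have {}E : (1 - t) *: f x = - t *: g x.
    by apply/eqP; rewrite -subr_eq0 scaleNr opprK E.
  have := congr1 (@enorm R _) E; rewrite !enormZ (fS x Sx : enorm _ = _) (gS x Sx : enorm _ = _).
  rewrite !mulr1 normrN !ger0_norm ?subr_ge0// => tE.
  have th : t = 2^-1 by lra.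
  apply: (fg x Sx); move: E; rewrite th scaleNr -scalerN.
  have -> : 1 - 2^-1 = 2^-1 :> R by lra.
  by move/scalerI; apply; rewrite gt_eqF.
apply: (htpy_eq _ _ (htpy_post (@cont_on_rad _) _ H)) => [x Sx|x Sx|x /= x0].
- by rewrite rad_id//; exact: fS.
- by rewrite rad_id//; exact: gS.
- exact: enorm_rad.
Qed.
End Enorm.

Section Collapse.
Variables (R : realType) (d : nat).
Local Notation hd := (ord0 : 'I_(1 + d)).

Lemma lshift10 : lshift d (ord0 : 'I_1) = hd.
Proof. exact: val_inj. Qed.

Lemma sum_head (F : 'I_(1 + d) -> R) : \sum_i F i = F hd + \sum_(j < d) F (rshift 1 j).
Proof. by rewrite big_split_ord /= big_ord1 lshift10. Qed.

Lemma head_ind (P : 'I_(1 + d) -> Prop) : P hd -> (forall j, P (rshift 1 j)) -> forall i, P i.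
Proof.
move=> P0 Pj i; case: (splitP i) => [j|j] ij; last first.
  by have -> : i = rshift 1 j by exact: val_inj.
by have -> : i = hd by apply: val_inj; rewrite /= ij (ord1 j).
Qed.

Lemma row_mx_hd (a : 'rV[R]_1) (u : 'rV[R]_d) : row_mx a u 0 hd = a 0 0.
Proof. by rewrite -lshift10 row_mxEl. Qed.

(** [collapse] after recentring the unit cube to [[-1, 1]^d], where the polar angle is [pi] times
    the sup norm. *)
Definition centered_collapse (u : 'rV[R]_d) : 'rV[R]_(1 + d) :=
  row_mx (\row_(_ < 1) cos (pi * `|u|)) ((sin (pi * `|u|) / enorm u) *: u).

Lemma centered_collapse_hd u : centered_collapse u 0 hd = cos (pi * `|u|).
Proof. by rewrite row_mx_hd mxE. Qed.

Lemma centered_collapse_tl u j : centered_collapse u 0 (rshift 1 j) = sin (pi * `|u|) / enorm u * u 0 j.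
Proof. by rewrite row_mxEr mxE. Qed.

Lemma collapseE (x : 'rV[R]_d) : collapse d x = centered_collapse (2 *: x - const_mx 1).
Proof.
rewrite /collapse /centered_collapse; set u := 2 *: x - const_mx 1.
have -> // : \big[Num.max/0]_(i < d) `|u 0 i| = `|u|.
apply/eqP; rewrite eq_le; apply/andP; split.
  by apply: bigmax_le => // i _; exact: norm_coord.
apply: norm_le => [|i]; first exact: bigmax_ge_id.
by apply: (le_bigmax _ (fun i => `|u 0 i|)).
Qed.

Lemma e0_hd : e0 d 0 hd = 1 :> R. Proof. by rewrite row_mx_hd mxE. Qed.
Lemma e0_tl j : e0 d 0 (rshift 1 j) = 0 :> R. Proof. by rewrite row_mxEr mxE. Qed.

Lemma enorm_e0 : enorm (e0 d : 'rV[R]_(1 + d)) = 1.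
Proof.
rewrite /enorm sum_head e0_hd expr1n big1 ?addr0 ?sqrtr1// => j _.
by rewrite e0_tl expr0n.
Qed.

Lemma centered_collapse_bd u : `|u| = 1 -> centered_collapse u = spt d.
Proof.
move=> u1; apply/rowP; apply: head_ind => [|j].
  by rewrite centered_collapse_hd u1 mulr1 cospi mxE e0_hd.
by rewrite centered_collapse_tl u1 mulr1 sinpi !mul0r mxE e0_tl oppr0.
Qed.

Lemma centered_collapse_sphere u : enorm (centered_collapse u) = 1.
Proof.
rewrite /enorm sum_head centered_collapse_hd.
have -> : \sum_(j < d) centered_collapse u 0 (rshift 1 j) ^+ 2 = sin (pi * `|u|) ^+ 2.
  rewrite (eq_bigr (fun j => (sin (pi * `|u|) / enorm u) ^+ 2 * u 0 j ^+ 2)) => [|j _]; last first.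
    by rewrite centered_collapse_tl exprMn.
  rewrite -mulr_sumr -enorm_sqr exprMn exprVn.
  have [->|u0] := eqVneq u 0; first by rewrite normr0 mulr0 sin0 expr0n /= !mul0r.
  by rewrite divfK// expf_neq0// gt_eqF ?enorm_gt0.
by rewrite cos2Dsin2 sqrtr1.
Qed.

Lemma centered_collapse_inj u v : `|u| <= 1 -> `|v| <= 1 -> centered_collapse u = centered_collapse v -> u = v \/ `|u| = 1 /\ `|v| = 1.
Proof.
move=> u1 v1 E.
have pi0 : 0 < pi :> R by exact: pi_gt0.
have uv : `|u| = `|v|.
  have := congr1 (fun w : 'rV[R]_(1 + d) => w 0 hd) E; rewrite !centered_collapse_hd.
  move=> /cos_inj; rewrite !in_itv /= !mulr_ge0 ?(ltW pi0)//= => H.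
  have /mulfI : pi != 0 :> R by rewrite gt_eqF.
  by apply; apply: H; rewrite ler_piMr// ltW.
have [vE|vn1] := eqVneq `|v| 1; first by right; rewrite uv vE.
left; have [v0|v0] := eqVneq v 0.
  by apply/eqP; rewrite v0 -normr_eq0 uv v0 normr0.
have u0 : u != 0 by rewrite -normr_eq0 uv normr_eq0.
have s0 : 0 < sin (pi * `|v|).
  apply: sin_gt0_pi; apply/andP; split.
    by rewrite mulr_gt0// normr_gt0.
  by rewrite gtr_pMr// lt_neqAle vn1.
have Ej j : (enorm v / enorm u) * u 0 j = v 0 j.
  have := congr1 (fun w : 'rV[R]_(1 + d) => w 0 (rshift 1 j)) E; rewrite !centered_collapse_tl uv -!mulrA.
  move/mulfI; rewrite gt_eqF// => /(_ isT) h.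
  by rewrite h mulVKf// gt_eqF ?enorm_gt0.
have {}Ej : v = (enorm v / enorm u) *: u by apply/rowP => j; rewrite mxE Ej.
have := congr1 Num.norm Ej; rewrite normrZ uv => H.
have t1 : enorm v / enorm u = 1.
  have vn0 : `|v| != 0 by rewrite normr_eq0.
  have : 1 * `|v| = `|enorm v / enorm u| * `|v| by rewrite mul1r.
  by move/(mulIf vn0); rewrite ger0_norm ?divr_ge0 ?enorm_ge0// => <-.
by rewrite Ej t1 scale1r.
Qed.

Lemma centered_collapse_surj (v : 'rV[R]_(1 + d)) : (0 < d)%N -> enorm v = 1 -> exists2 u, `|u| <= 1 & centered_collapse u = v.
Proof.
move=> d0 v1; pose w := \row_(j < d) v 0 (rshift 1 j); pose a := v 0 hd.
have aw : a ^+ 2 + enorm w ^+ 2 = 1.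
  rewrite -(expr1n _ 2) -v1 !enorm_sqr sum_head; congr (_ + _).
  by apply: eq_bigr => j _; rewrite mxE.
have a1 : -1 <= a <= 1.
  by have := sqr_ge0 (enorm w) => h; apply/andP; split; nra.
have [w0|w0] := eqVneq w 0.
  have wj j : v 0 (rshift 1 j) = 0.
    by have := congr1 (fun w : 'rV[R]_d => w 0 j) w0; rewrite !mxE.
  have : a ^+ 2 == 1 ^+ 2.
    by rewrite expr1n -[X in _ == X]aw w0 -(scale0r (0 : 'rV[R]_d)) enormZ normr0 mul0r expr0n addr0.
  rewrite eqf_sqr => /orP[] /eqP aE.
    exists 0; first by rewrite normr0.
    apply/rowP; apply: head_ind => [|j]; first by rewrite centered_collapse_hd normr0 mulr0 cos0 -aE.
    by rewrite centered_collapse_tl mxE mulr0 wj.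
  have n1 : `|const_mx 1 : 'rV[R]_d| = 1.
    apply/eqP; rewrite eq_le; apply/andP; split.
      by apply: norm_le => // i; rewrite mxE normr1.
    by have := norm_coord (const_mx 1 : 'rV[R]_d) (Ordinal d0); rewrite mxE normr1.
  exists (const_mx 1); first by rewrite n1.
  rewrite centered_collapse_bd//; apply/rowP; apply: head_ind => [|j]; first by rewrite mxE e0_hd -aE.
  by rewrite mxE e0_tl oppr0 wj.
have pi0 : 0 < pi :> R by exact: pi_gt0.
pose s := acos a / pi.
have s0 : 0 <= s by rewrite divr_ge0 ?acos_ge0// ltW.
have s1 : s <= 1 by rewrite ler_pdivrMr// mul1r acos_lepi.
have ps : pi * s = acos a by rewrite mulrC divfK// gt_eqF.
have ew0 := enorm_gt0 w0.
have nw0 : 0 < `|w| by rewrite normr_gt0.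
have sna : sin (acos a) = enorm w.
  rewrite sin_acos//; have -> : 1 - a ^+ 2 = enorm w ^+ 2 by rewrite -aw; ring.
  by rewrite sqrtr_sqr ger0_norm// enorm_ge0.
have un : `|(s / `|w|) *: w| = s.
  by rewrite normrZ normrM normfV normr_id (ger0_norm s0) divfK// gt_eqF.
have sn0 : s != 0.
  apply/eqP => sE; move: ps; rewrite sE mulr0 => /esym aE.
  by move: sna; rewrite aE sin0 => ewE; rewrite -ewE ltxx in ew0.
exists ((s / `|w|) *: w); first by rewrite un.
apply/rowP; apply: head_ind => [|j]; first by rewrite centered_collapse_hd un ps acosK.
have sw0 : 0 <= s / `|w| by exact: divr_ge0 s0 (ltW nw0).
rewrite centered_collapse_tl un ps sna enormZ (ger0_norm sw0) !mxE.
by field; rewrite sn0 !gt_eqF.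
Qed.

Lemma continuous_centered_collapse : continuous centered_collapse.
Proof.
apply/continuous_subspace_setT/cont_onP.
have cs : cont_on setT (fun u : 'rV[R]_d => pi * `|u|).
  apply: cont_onM; first exact: cont_on_cst.
  by apply: cont_on_norm; exact: cont_on_id.
have cS : cont_on setT (fun u : 'rV[R]_d => sin (pi * `|u|)).
  apply: (cont_on_comp cs (S' := setT)) => //.
  by apply: continuous_cont_on; exact: continuous_sin.
apply: cont_on_row; apply: head_ind => [|j].
  apply: (@cont_on_eq _ _ _ (fun u => cos (pi * `|u|))) => [x _|]; first by rewrite centered_collapse_hd.
  apply: (cont_on_comp cs (S' := setT)) => //.
  by apply: continuous_cont_on; exact: continuous_cos.
apply: (@cont_on_eq _ _ _ (fun u : 'rV[R]_d => sin (pi * `|u|) / enorm u * u 0 j)) => [x _|].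
  by rewrite centered_collapse_tl.
(* At 0 the quotient [u_j / enorm u] has no limit, but it is bounded by 1 and the sine factor tends
   to 0. *)
move=> x _; have [->|x0] := eqVneq x 0.
  rewrite !mxE mulr0; apply/cvgrPdist_lt => e e0.
  have := cS 0 I; rewrite normr0 mulr0 sin0 => /cvgrPdist_lt /(_ _ e0).
  apply: filterS => y; rewrite !sub0r !normrN; apply: le_lt_trans.
  rewrite -mulrA normrM; have [->|y0] := eqVneq y 0.
    by rewrite mxE mulr0 [X in _ * X]normr0 mulr0.
  rewrite ler_piMr// normrM normfV (ger0_norm (enorm_ge0 _)) mulrC ler_pdivrMr ?enorm_gt0//.
  by rewrite mul1r coord_le_enorm.
apply: cvgM; last by have := @cont_on_coord R _ setT d id j (@cont_on_id _ _) x I.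
apply: cvgM; first exact: (cS x I).
apply: cvgV; first by rewrite gt_eqF ?enorm_gt0.
exact: (continuous_cont_on (@continuous_enorm R d) (I : setT x)).
Qed.

Lemma in_cubeP (x : 'rV[R]_d) : in_cube x <-> `|2 *: x - const_mx 1| <= 1.
Proof.
split=> [H|H i].
  by apply: norm_le => // i; have := H i; rewrite !mxE ler_norml; lra.
by have := le_trans (norm_coord _ i) H; rewrite !mxE ler_norml; lra.
Qed.

Lemma norm1_coord (x : 'rV[R]_d) : `|x| = 1 -> exists i, `|x 0 i| = 1.
Proof.
move=> x1; apply: contrapT => H; suff : `|x| < 1 by rewrite x1 ltxx.
apply: norm_lt => // i; rewrite lt_neqAle; apply/andP; split.
  by apply/eqP => E; apply: H; exists i.
by rewrite -x1 norm_coord.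
Qed.

Lemma on_bdP (x : 'rV[R]_d) : on_bd x <-> `|2 *: x - const_mx 1| = 1.
Proof.
split=> [[/in_cubeP c [i xi]]|E].
  apply/eqP; rewrite eq_le c /=; apply: le_trans (norm_coord _ i); rewrite !mxE.
  case: xi => ->; first by rewrite mulr0 sub0r normrN normr1.
  by rewrite mulr1 (_ : 2 - 1 = 1) ?normr1//; lra.
split; first by apply/in_cubeP; rewrite E.
have [i] := norm1_coord E; rewrite !mxE => xi; exists i.
have : (2 * x 0 i - 1) ^+ 2 = 1 by rewrite -real_normK ?num_real// xi expr1n.
move=> h; have /eqP : x 0 i * (x 0 i - 1) = 0 by nra.
by rewrite mulf_eq0 subr_eq0 => /orP[] /eqP ->; [left|right].
Qed.
End Collapse.

(** * Pinching away from two poles *)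

Section Pinch.
Variables (R : realType) (d : nat).
Local Notation vec := ('rV[R]_(1 + d.+1)).
Local Notation hd := (ord0 : 'I_(1 + d.+1)).
Definition snd_ord : 'I_(1 + d.+1) := rshift 1 (ord0 : 'I_d.+1).
Local Notation o1 := snd_ord.

Definition sg (b : bool) : R := if b then 1 else -1.

Lemma sgK b : sg b * sg b = 1. Proof. by case: b; rewrite /= ?mulr1// mulrNN mulr1. Qed.

(** An interior point of each half of the cube [[-1, 1]^(d+2)] cut by the second coordinate. It is
    off the centre of the half, with first coordinate 1/2, so that the twisted spheres around both
    poles pass through the base point 0. *)
Definition pole (b : bool) : vec :=
  \row_l if l == hd then 2^-1 else if l == o1 then sg b / 2 else 0.

(* A rotation by [sg b * pi / 4] in the first two coordinates, dilated there by the square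
   root of 2: the sphere [w |-> pole b + mtwist b w / 2] is centered at [pole b] and
   passes through the origin. *)
Definition mtwist (b : bool) (y : vec) : vec :=
  \row_l if l == hd then y 0 hd - sg b * y 0 o1
         else if l == o1 then y 0 o1 + sg b * y 0 hd else y 0 l.

Lemma pole_hd b : pole b 0 hd = 2^-1. Proof. by rewrite mxE. Qed.
Lemma pole_o1 b : pole b 0 o1 = sg b / 2. Proof. by rewrite mxE. Qed.
Lemma mtwist_hd b y : mtwist b y 0 hd = y 0 hd - sg b * y 0 o1. Proof. by rewrite mxE. Qed.
Lemma mtwist_o1 b y : mtwist b y 0 o1 = y 0 o1 + sg b * y 0 hd. Proof. by rewrite mxE. Qed.

Lemma enorm1_two (w : vec) : enorm w = 1 -> w 0 hd ^+ 2 + w 0 o1 ^+ 2 <= 1.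
Proof.
move=> w1; rewrite -[leRHS](expr1n _ 2) -w1 enorm_sqr sum_head lerD2l (bigD1 ord0)//= lerDl.
by apply: sumr_ge0 => i _; exact: sqr_ge0.
Qed.

Lemma segment_hd b (v w : vec) t :
  ((1 - t) *: (2 *: v) + t *: (pole b + 2^-1 *: mtwist b w)) 0 hd =
  (1 - t) * (2 * v 0 hd) + t * (2^-1 + 2^-1 * (w 0 hd - sg b * w 0 o1)).
Proof. by rewrite !mxE. Qed.

Lemma segment_o1 b (v w : vec) t :
  ((1 - t) *: (2 *: v) + t *: (pole b + 2^-1 *: mtwist b w)) 0 o1 =
  (1 - t) * (2 * v 0 o1) + t * (sg b / 2 + 2^-1 * (w 0 o1 + sg b * w 0 hd)).
Proof. by rewrite !mxE. Qed.

Lemma rshift_o1 l : l != ord0 -> (rshift 1 l == o1) = false.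
Proof. by move=> l0; apply/negbTE; apply: contra l0 => /eqP/rshift_inj ->. Qed.

Lemma pole_tl b l : l != ord0 -> pole b 0 (rshift 1 l) = 0.
Proof. by move=> l0; rewrite mxE (rshift_o1 l0). Qed.

Lemma segment_tl b (v w : vec) t l : l != ord0 ->
  ((1 - t) *: (2 *: v) + t *: (pole b + 2^-1 *: mtwist b w)) 0 (rshift 1 l) =
  (1 - t) * (2 * v 0 (rshift 1 l)) + t * (2^-1 * w 0 (rshift 1 l)).
Proof. by move=> l0; rewrite !mxE (rshift_o1 l0) /= add0r. Qed.

(** The second coordinate times [sg b] is -1/2 at the opposite pole and stays above that value on
    the segment: it is nonnegative at the first end and [(1 + w_0 + sg b w_1) / 2] at the second,
    where [w_0 + sg b w_1 > -2] for a unit vector. *)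
Lemma segment_neq_opposite_pole (b : bool) (v w : vec) (t : R) : 0 <= t <= 1 ->
  enorm w = 1 -> 0 <= sg b * v 0 o1 ->
  (1 - t) *: (2 *: v) + t *: (pole b + 2^-1 *: mtwist b w) <> pole (~~ b).
Proof.
move=> /andP[t0 t1] w1 sv /(congr1 (fun x : vec => x 0 o1)).
rewrite !mxE /=; have := enorm1_two w1.
set a := w 0 hd; set c := w 0 o1; set y := v 0 o1 in sv * => ac.
have -> : sg (~~ b) = - sg b by case: b {sv}; rewrite //= opprK.
have h : - 2 < a + sg b * c.
  rewrite ltNge; apply/negP; have a1 : -1 <= a by nra.
  have c1 : -1 <= c <= 1 by apply/andP; split; nra.
  by case: b {sv}; rewrite /sg => h; nra.
move=> /(congr1 (fun x => sg b * x)).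
have -> : sg b * ((1 - t) * (2 * y) + t * (sg b / 2 + 2^-1 * (c + sg b * a))) =
  (1 - t) * 2 * (sg b * y) + t / 2 * (sg b * sg b + sg b * c + sg b * sg b * a) by field.
have -> : sg b * (- sg b / 2) = - (sg b * sg b) / 2 by field.
rewrite !sgK mul1r => E.
have e1 : 0 <= (1 - t) * 2 * (sg b * y) by rewrite mulr_ge0// mulr_ge0// subr_ge0.
have : t * (1 + sg b * c + a) <= - 1 by lra.
have [t00|t00] := eqVneq t 0; first by rewrite t00 mul0r; lra.
have : 0 < t by rewrite lt_neqAle eq_sym t00.
nra.
Qed.

Lemma centered_collapse_planar (u : 'rV[R]_d.+1) : (forall l, l != ord0 -> u 0 l = 0) ->
  centered_collapse u 0 hd = cos (pi * u 0 ord0) /\ centered_collapse u 0 o1 = sin (pi * u 0 ord0).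
Proof.
move=> ul; have un : `|u| = `|u 0 ord0|.
  apply/eqP; rewrite eq_le norm_coord andbT; apply: norm_le => // i.
  by have [->|/ul ->] := eqVneq i ord0; rewrite ?normr0.
have ue : enorm u = `|u 0 ord0|.
  rewrite /enorm (bigD1 ord0)//= big1 ?addr0 ?sqrtr_sqr// => i /ul ->.
  by rewrite expr0n.
rewrite centered_collapse_hd centered_collapse_tl un ue; have [u0|u0|u0] := ltrgt0P (u 0 ord0).
- by split=> //; rewrite divfK// gt_eqF.
- by rewrite mulrN cosN sinN; split=> //; field; rewrite lt_eqF.
- by rewrite u0 !mulr0 cos0 sin0.
Qed.

Lemma centered_collapse_coef_ge0 (u : 'rV[R]_d.+1) : `|u| <= 1 -> 0 <= sin (pi * `|u|) / enorm u.
Proof.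
move=> u1; rewrite divr_ge0 ?enorm_ge0// sin_ge0_pi// mulr_ge0 ?pi_ge0//=.
by rewrite ler_piMr// pi_ge0.
Qed.

Lemma centered_collapse_coef_eq0 (u : 'rV[R]_d.+1) : `|u| <= 1 -> u != 0 -> sin (pi * `|u|) / enorm u = 0 -> `|u| = 1.
Proof.
move=> u1 u0 /eqP; rewrite mulf_eq0 invr_eq0 (gt_eqF (enorm_gt0 u0)) orbF => /eqP s0.
apply/eqP; apply: contraT => n1; have : 0 < sin (pi * `|u|).
  apply: sin_gt0_pi; rewrite mulr_gt0 ?pi_gt0 ?normr_gt0//= gtr_pMr ?pi_gt0//.
  by rewrite lt_neqAle n1.
by rewrite s0 ltxx.
Qed.

(* Off the plane of the first two axes, a segment through the pole would force the last
   coordinates of [centered_collapse u] and [centered_collapse u'] to have opposite signs. *)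
Lemma segment_neq_pole (b : bool) (u u' : 'rV[R]_d.+1) (t : R) : 0 <= t <= 1 ->
  `|u| <= 1 -> `|u'| <= 1 -> (forall l, l != ord0 -> u' 0 l = u 0 l) ->
  ((forall l, l != ord0 -> u 0 l = 0) ->
    (1 - t) *: (2 *: centered_collapse u) + t *: (pole b + 2^-1 *: mtwist b (centered_collapse u')) <> pole b) ->
  (1 - t) *: (2 *: centered_collapse u) + t *: (pole b + 2^-1 *: mtwist b (centered_collapse u')) <> pole b.
Proof.
move=> /andP[t0 t1] u1 u1' uu' planar.
have [H|/existsNP[l /not_implyP[l0 ul]]] :=
  pselect (forall l, l != ord0 -> u 0 l = 0); first exact: planar.
move=> E; have El := congr1 (fun x : vec => x 0 (rshift 1 l)) E.
have Eh := congr1 (fun x : vec => x 0 hd) E.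
rewrite segment_tl// pole_tl// !centered_collapse_tl (uu' _ l0) in El.
rewrite segment_hd pole_hd !centered_collapse_hd centered_collapse_tl in Eh.
move/eqP in ul; have un0 : u != 0 by apply: contra ul => /eqP ->; rewrite mxE.
have un0' : u' != 0 by apply: contra ul => /eqP u0; rewrite -(uu' _ l0) u0 mxE.
set A := sin (pi * `|u|) / enorm u in El Eh; set B := sin (pi * `|u'|) / enorm u' in El Eh.
have A0 : 0 <= A := centered_collapse_coef_ge0 u1; have B0 : 0 <= B := centered_collapse_coef_ge0 u1'.
have {}El : ((1 - t) * 2 * A + t / 2 * B) * u 0 l = 0 by rewrite -[RHS]El; field.
move/eqP: El; rewrite mulf_eq0 (negbTE ul) orbF => /eqP El.
have h1 : 0 <= (1 - t) * A by rewrite mulr_ge0// subr_ge0.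
have h2 : 0 <= t * B by rewrite mulr_ge0.
have {}h1 : (1 - t) * A = 0 by lra.
have {}h2 : t * B = 0 by lra.
have [u1n|u1n] := eqVneq `|u| 1.
  move: Eh; rewrite u1n mulr1 cospi.
  move/eqP: h2; rewrite mulf_eq0 => /orP[/eqP ->|/eqP B00].
    by rewrite mul0r; lra.
  have u1n' : `|u'| = 1 by exact: centered_collapse_coef_eq0.
  by rewrite u1n' mulr1 cospi B00 mul0r; lra.
have A1 : A != 0 by apply: contra u1n => /eqP A00; apply/eqP; exact: centered_collapse_coef_eq0.
move/eqP: h1; rewrite mulf_eq0 (negbTE A1) orbF subr_eq0 => /eqP tE.
rewrite -tE mul1r in h2.
have u1n' : `|u'| = 1 by exact: centered_collapse_coef_eq0.
by move: Eh; rewrite -tE u1n' mulr1 cospi h2 mul0r; lra.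
Qed.

Lemma segment_neq_pole_left (u u' : 'rV[R]_d.+1) (t : R) : 0 <= t <= 1 ->
  `|u| <= 1 -> `|u'| <= 1 -> (forall l, l != ord0 -> u' 0 l = u 0 l) ->
  u 0 ord0 <= 0 -> u' 0 ord0 = 2 * u 0 ord0 + 1 ->
  (1 - t) *: (2 *: centered_collapse u) + t *: (pole false + 2^-1 *: mtwist false (centered_collapse u')) <> pole false.
Proof.
move=> t01 u1 u1' uu' uneg u'E; apply: segment_neq_pole => // ul E.
have ul' l : l != ord0 -> u' 0 l = 0 by move=> l0; rewrite uu'// ul.
have Eh := congr1 (fun x : vec => x 0 hd) E; have Eo := congr1 (fun x : vec => x 0 o1) E.
rewrite segment_hd pole_hd in Eh; rewrite segment_o1 pole_o1 /sg in Eo; rewrite /sg in Eh.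
have [vh vo] := centered_collapse_planar ul; have [wh wo] := centered_collapse_planar ul'.
rewrite vh vo wh wo u'E in Eh Eo.
move: Eh Eo; set th := pi * u 0 ord0.
have -> : pi * (2 * u 0 ord0 + 1) = (th + th) + pi by rewrite /th; ring.
rewrite cosDpi sinDpi cosD sinD.
have s0 : sin th <= 0.
  rewrite -oppr_ge0 -sinN sin_ge0_pi// /th -mulrN mulr_ge0 ?pi_ge0 ?oppr_ge0//=.
  rewrite ler_piMr ?pi_ge0//; have := norm_coord u ord0; rewrite ler0_norm//; lra.
have := cos2Dsin2 th; have := sin_geN1 th.
move: (cos th) (sin th) s0 t01 => c s s0 /andP[t0 t1] s1 cs Eh Eo.
(* The multipliers [c - s] and [c + s] eliminate [c] from the two coordinate equations. The result
   has no solution with [-1 <= s <= 0] and [t < 1], and the case [t = 1] is excluded separately. *)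
have K : s * (2 * t - 1) = 2 - 2 * t.
  have E1 := congr1 (fun z => z * (c - s)) Eh; have E2 := congr1 (fun z => z * (c + s)) Eo.
  have : 2 * (1 - t) * (c ^+ 2 + s ^+ 2) - t * s - t * s * (c ^+ 2 + s ^+ 2) + s = 0.
    by move: E1 E2 => /= E1 E2; lra.
  by rewrite cs; lra.
have [tE|tE] := eqVneq t 1.
  by move: Eh Eo K; rewrite tE; nra.
have t1' : t < 1 by rewrite lt_neqAle tE.
have [h|h] := leP (2 * t) 1; nra.
Qed.

Lemma segment_neq_pole_right (u u' : 'rV[R]_d.+1) (t : R) : 0 <= t <= 1 ->
  `|u| <= 1 -> `|u'| <= 1 -> (forall l, l != ord0 -> u' 0 l = u 0 l) ->
  0 <= u 0 ord0 <= 2^-1 -> u' 0 ord0 = 4 * u 0 ord0 - 1 ->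
  (1 - t) *: (2 *: centered_collapse u) + t *: (pole true + 2^-1 *: mtwist true (centered_collapse u')) <> pole true.
Proof.
move=> t01 u1 u1' uu' /andP[upos u2] u'E; apply: segment_neq_pole => // ul E.
have ul' l : l != ord0 -> u' 0 l = 0 by move=> l0; rewrite uu'// ul.
have Eh := congr1 (fun x : vec => x 0 hd) E; have Eo := congr1 (fun x : vec => x 0 o1) E.
rewrite segment_hd pole_hd in Eh; rewrite segment_o1 pole_o1 /sg in Eo; rewrite /sg in Eh.
have [vh vo] := centered_collapse_planar ul; have [wh wo] := centered_collapse_planar ul'.
rewrite vh vo wh wo u'E in Eh Eo.
move: Eh Eo; set th := pi * u 0 ord0.
have pi0 := pi_gt0 R.
have th0 : 0 <= th by rewrite mulr_ge0// ltW.
have th2 : th <= pi / 2 by rewrite ler_pM2l.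
have E4 : pi * (4 * u 0 ord0 - 1) = (th + th + th - pi) + th by rewrite /th; ring.
(* Relative to the angle [th] of the first end, the unit vector that determines the second end is at
   angle [3 th - pi]; [C3] bounds the combination of its coordinates that enters [K1]. It holds
   because [3 th] is at most [3 pi / 2]. *)
have C3 : cos (th + th + th) - sin (th + th + th) <= 1.
  have [h|h] := leP (th + th + th) pi.
    have : 0 <= sin (th + th + th) by rewrite sin_ge0_pi// h andbT; lra.
    by have := cos_le1 (th + th + th); lra.
  have : 0 <= cos (th + th + th - pi).
    by apply: cos_ge0_pihalf; apply/andP; split; lra.
  rewrite cosB cospi sinpi mulr0 addr0 mulrN1.
  by have := sin_geN1 (th + th + th); lra.
rewrite E4 (cosD (th + th + th - pi)) (sinD (th + th + th - pi)); move: C3.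
rewrite -[cos (th + th + th)]opprK -[X in _ - X]opprK.
have -> : - cos (th + th + th) = cos (th + th + th - pi).
  by rewrite cosB cospi sinpi mulr0 addr0 mulrN1.
have -> : - sin (th + th + th) = sin (th + th + th - pi).
  by rewrite sinB cospi sinpi mulr0 subr0 mulrN1.
have := cos2Dsin2 (th + th + th - pi); have := cos2Dsin2 th.
move: (cos (_ - pi)) (sin (_ - pi)) => C S.
have c0 : cos th <= 1 := cos_le1 _; have s1 : sin th <= 1 := sin_le1 _.
move: (cos th) (sin th) c0 s1 t01 => c s c1 s1 /andP[t0 t1] cs CS C3 Eh Eo.
pose m := (c + s) / 2; pose r := 1 - t; pose ka := t / 2.
(* [K1] is the component of the vector equation along [(c, s)], [K2] the equality of the squared
   lengths of its two sides. Eliminating [ka] with the help of [C3] leaves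
   [r^2 (2 (m - 1)^2 + 3/2) <= 0]. *)
have K1 : r * (2 - m) = ka * (S - C).
  have E1 := congr1 (fun z => z * c) Eh; have E2 := congr1 (fun z => z * s) Eo.
  have : 2 * (1 - t) * (c ^+ 2 + s ^+ 2) + t * m +
    t / 2 * (C * (c ^+ 2 + s ^+ 2) - S * (c ^+ 2 + s ^+ 2)) = m.
    by move: E1 E2 => /= E1 E2; rewrite /m; lra.
  by rewrite cs /r /ka; lra.
have K2 : r ^+ 2 * (9 / 2 - 4 * m) = 2 * ka ^+ 2.
  have X : r * (2 * c - 2^-1) = - ka * ((C * c - S * s) - (S * c + C * s)).
    by rewrite /r /ka; lra.
  have Y : r * (2 * s - 2^-1) = - ka * ((C * c - S * s) + (S * c + C * s)).
    by rewrite /r /ka; lra.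
  have : (r * (2 * c - 2^-1)) ^+ 2 + (r * (2 * s - 2^-1)) ^+ 2 =
      2 * ka ^+ 2 * ((C ^+ 2 + S ^+ 2) * (c ^+ 2 + s ^+ 2)) by rewrite X Y; ring.
  rewrite cs CS !mulr1 => <-; rewrite /m.
  have -> : 9 / 2 - 4 * ((c + s) / 2) = 4 * (c ^+ 2 + s ^+ 2) - 2 * (c + s) + 2^-1 by rewrite cs; field.
  by field.
have m1 : m <= 1 by rewrite /m; lra.
have r0 : 0 <= r by rewrite subr_ge0.
have ka0 : 0 <= ka by rewrite divr_ge0.
have K3 : r * (2 - m) <= ka by rewrite K1; nra.
have K4 : (r * (2 - m)) ^+ 2 <= ka ^+ 2.
  by rewrite ler_pXn2r// ?nnegrE// mulr_ge0//; lra.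
have [r00|r00] := eqVneq r 0.
  have : ka ^+ 2 = 0 by move: K2; rewrite r00; nra.
  move/eqP; rewrite expf_eq0 /= => /eqP ka00.
  by move: r00 ka00; rewrite /r /ka; lra.
have r2 : 0 < r ^+ 2 by rewrite exprn_gt0// lt_neqAle eq_sym r00.
have : r ^+ 2 * (2 * (m - 1) ^+ 2 + 3 / 2) <= 0 by nra.
by rewrite pmulr_rle0//; have := sqr_ge0 (m - 1); lra.
Qed.
End Pinch.

Section Maps.
Variables (R : realType) (d : nat).
Definition half (i : 'I_d) (b : bool) (y : 'rV[R]_d) : 'rV[R]_d :=
  \row_l if l == i then (y 0 l + sg R b) / 2 else y 0 l.
Definition unhalf (i : 'I_d) (b : bool) (y : 'rV[R]_d) : 'rV[R]_d :=
  \row_l if l == i then 2 * y 0 l - sg R b else y 0 l.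
(* The factor [mu] is applied twice: once to separate the two holes from each other, once to
   separate them from the boundary of the cube. *)
Definition hole (mu : R) (j : 'I_d) (b : bool) (x : 'rV[R]_d) : 'rV[R]_d :=
  mu *: half j b (mu *: x).
Definition unhole (mu : R) (j : 'I_d) (b : bool) (x : 'rV[R]_d) : 'rV[R]_d :=
  mu^-1 *: unhalf j b (mu^-1 *: x).

Lemma halfK i b : cancel (half i b) (unhalf i b).
Proof. by move=> y; apply/rowP => l; rewrite !mxE; case: eqP => // _; field. Qed.

Lemma unhalfK i b : cancel (unhalf i b) (half i b).
Proof. by move=> y; apply/rowP => l; rewrite !mxE; case: eqP => // _; field. Qed.

Lemma holeK mu j b : mu != 0 -> cancel (hole mu j b) (unhole mu j b).
Proof. by move=> m0 x; rewrite /hole /unhole scalerA mulVf// scale1r halfK scalerA mulVf// scale1r. Qed.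

Lemma unholeK mu j b : mu != 0 -> cancel (unhole mu j b) (hole mu j b).
Proof. by move=> m0 x; rewrite /hole /unhole scalerA divff// scale1r unhalfK scalerA divff// scale1r. Qed.

Lemma cont_on_unhalf (T : topologicalType) (S : set T) (f : T -> 'rV[R]_d) i b : cont_on S f ->
  cont_on S (fun x => unhalf i b (f x)).
Proof.
move=> cf; apply: cont_on_row => l.
apply: (@cont_on_eq _ _ _ (fun x => (if l == i then 2 else 1) * f x 0 l - (if l == i then sg R b else 0))).
  by move=> x _; rewrite mxE; case: eqP => // _; rewrite mul1r subr0.
apply: cont_onBr; last exact: cont_on_cst.
by apply: cont_onM; [exact: cont_on_cst|exact: cont_on_coord].
Qed.

Lemma cont_on_half (T : topologicalType) (S : set T) (f : T -> 'rV[R]_d) i b : cont_on S f ->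
  cont_on S (fun x => half i b (f x)).
Proof.
move=> cf; apply: cont_on_row => l.
apply: (@cont_on_eq _ _ _ (fun x => (if l == i then 2^-1 else 1) * (f x 0 l + (if l == i then sg R b else 0)))).
  by move=> x _; rewrite mxE; case: eqP => _; rewrite ?mul1r ?addr0// mulrC.
apply: cont_onM; first exact: cont_on_cst.
by apply: cont_onDr; [exact: cont_on_coord|exact: cont_on_cst].
Qed.
End Maps.

Section Target.
Variables (R : realType) (d : nat).
Local Notation vec := ('rV[R]_(1 + d.+1)).
Local Notation hd := (ord0 : 'I_(1 + d.+1)).
Local Notation o1 := (snd_ord d).

Lemma sgE b : sg R b = 1 \/ sg R b = -1. Proof. by case: b; [left|right]. Qed.

Lemma sgN b : sg R (~~ b) = - sg R b. Proof. by case: b; rewrite //= opprK. Qed.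

Lemma head2_ind (P : 'I_(1 + d.+1) -> Prop) : P hd -> P o1 ->
  (forall l, l != ord0 -> P (rshift 1 l)) -> forall i, P i.
Proof.
move=> P0 P1 Pl; apply: head_ind => // j.
by have [->|j0] := eqVneq j ord0; [exact: P1|exact: Pl].
Qed.

Lemma mtwist_tl b (y : vec) l : l != ord0 -> mtwist b y 0 (rshift 1 l) = y 0 (rshift 1 l).
Proof. by move=> l0; rewrite mxE (rshift_o1 l0). Qed.

Definition sphere_at_pole b (w : vec) : vec := pole R d b + 2^-1 *: mtwist b w.

Lemma enorm_pole b : enorm (pole R d b) < 1.
Proof.
rewrite -(@ltr_pXn2r _ 2)// ?nnegrE ?enorm_ge0// expr1n enorm_sqr sum_head pole_hd.
rewrite (bigD1 ord0)//= -/o1 pole_o1 big1 ?addr0 => [|l l0]; last first.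
  by rewrite pole_tl// expr0n.
by rewrite exprMn [sg R b ^+ 2]expr2 sgK; lra.
Qed.

Definition off_poles : set vec := [set y | forall b, y <> pole R d b].

Lemma cont_on_mtwist (T : topologicalType) (S : set T) (f : T -> vec) b : cont_on S f ->
  cont_on S (fun x => mtwist b (f x)).
Proof.
move=> cf; apply: cont_on_row; apply: head2_ind => [||l l0].
- apply: (@cont_on_eq _ _ _ (fun x => f x 0 hd - sg R b * f x 0 o1)) => [x _|].
    by rewrite mtwist_hd.
  apply: cont_onBr; first exact: cont_on_coord.
  by apply: cont_onM; [exact: cont_on_cst|exact: cont_on_coord].
- apply: (@cont_on_eq _ _ _ (fun x => f x 0 o1 + sg R b * f x 0 hd)) => [x _|].
    by rewrite mtwist_o1.
  apply: cont_onDr; first exact: cont_on_coord.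
  by apply: cont_onM; [exact: cont_on_cst|exact: cont_on_coord].
- apply: (@cont_on_eq _ _ _ (fun x => f x 0 (rshift 1 l))) => [x _|].
    by rewrite mtwist_tl.
  exact: cont_on_coord.
Qed.

Lemma cont_on_sphere_at_pole (S : set vec) b : cont_on S (sphere_at_pole b).
Proof.
apply: cont_onD; first exact: cont_on_cst.
by apply: cont_onZ; [exact: cont_on_cst|apply: cont_on_mtwist; exact: cont_on_id].
Qed.

Lemma sphere_at_pole_off b w : enorm w = 1 -> off_poles (sphere_at_pole b w).
Proof.
move=> w1 c; have [->|cb] := eqVneq c b; last first.
  have -> : c = ~~ b by case: b c cb => -[].
  have := @segment_neq_opposite_pole R d b 0 w 1; rewrite subrr scale0r add0r scale1r => H E.
  by apply: H E; rewrite ?ler01 ?lexx// mxE mulr0.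
move=> E; have {}E : 2^-1 *: mtwist b w = 0.
  by apply: (addrI (pole R d b)); rewrite addr0.
have {}E : mtwist b w = 0.
  by apply/eqP; move/eqP: E; rewrite scaler_eq0 invr_eq0 pnatr_eq0.
have Ei i := congr1 (fun x : vec => x 0 i) E.
have := Ei hd; have := Ei o1; rewrite mtwist_hd mtwist_o1 !mxE => h1 h2.
have s2 := @sgK R b.
have w0 : w 0 hd = 0 by have [s|s] := sgE b; rewrite s in h1 h2; lra.
have w1' : w 0 o1 = 0 by have [s|s] := sgE b; rewrite s in h1 h2; lra.
move: (sphere_neq0 w1); apply/negP; rewrite negbK; apply/eqP/rowP; apply: head2_ind => [||l l0].
- by rewrite w0 mxE.
- by rewrite w1' mxE.
- by have := Ei (rshift 1 l); rewrite mtwist_tl.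
Qed.

Lemma cont_on_sphere_cubify : cont_on [set w : vec | enorm w = 1] (@cubify R (1 + d.+1)).
Proof. by apply: cont_on_sub (@cont_on_cubify _ _) => w /sphere_neq0. Qed.

(** A twist by 45 degrees never reverses a vector, so the straight segments miss [pole b]. The
    opposite pole could be met only at [t = 0] with [w_0 = -1] and [w_1 = - sg b], which is too long
    for a unit vector. *)
Lemma htpy_pole_small b : htpy [set w : vec | enorm w = 1] off_poles (sphere_at_pole b)
  (fun w => pole R d b + 2^-1 *: w).
Proof.
apply: htpy_line; first exact: cont_on_sphere_at_pole.
  apply: cont_onD; first exact: cont_on_cst.
  by apply: cont_onZ; [exact: cont_on_cst|exact: cont_on_id].
move=> t w /andP[t0 t1] w1 c E.
have Ei i := congr1 (fun x : vec => x 0 i) E.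
have E0 := Ei hd; have E1 := Ei o1.
have h0 : (1 - t) * (2^-1 + 2^-1 * (w 0 hd - sg R b * w 0 o1)) + t * (2^-1 + 2^-1 * w 0 hd) = 2^-1.
  by rewrite -[RHS](pole_hd R d c) -E0 !mxE.
have h1 : (1 - t) * (sg R b / 2 + 2^-1 * (w 0 o1 + sg R b * w 0 hd)) + t * (sg R b / 2 + 2^-1 * w 0 o1)
    = sg R c / 2.
  by rewrite -(pole_o1 R d c) -E1 !mxE.
have w2 := enorm1_two w1.
have [cb|cb] := eqVneq c b; last first.
  have cE : sg R c = - sg R b by rewrite -sgN; congr sg; case: b c cb {E Ei E0 E1 h0 h1} => -[].
  rewrite cE in h1; have := coord_le_enorm w hd; have := coord_le_enorm w o1.
  rewrite w1 !ler_norml => /andP[a1 a2] /andP[a3 a4].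
  have p : 0 <= (1 - t) * (w 0 hd + 1) by rewrite mulr_ge0//; lra.
  have t00 : t = 0 by have [s|s] := sgE b; rewrite s in h1; lra.
  rewrite t00 in h1; have w0E : w 0 hd = -1 by have [s|s] := sgE b; rewrite s in h1; lra.
  rewrite w0E in h1 w2; have w1E : w 0 o1 = - sg R b by have [s|s] := sgE b; rewrite s in h1 *; lra.
  by have := sgK R b; move: w2; rewrite w1E; lra.
rewrite cb in h1.
have w0E : w 0 hd = 0.
  by have [s|s] := sgE b; rewrite s in h0 h1; move: h0 h1 t0 t1; clear; nra.
have w1E : w 0 o1 = 0 by rewrite w0E in h1; lra.
move: (sphere_neq0 w1); apply/negP; rewrite negbK; apply/eqP/rowP; apply: head2_ind => [||l l0].
- by rewrite w0E mxE.
- by rewrite w1E mxE.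
- have := Ei (rshift 1 l); rewrite pole_tl// !mxE (rshift_o1 l0) /= !add0r; lra.
Qed.

(** The centre of the half cube and the pole differ only in the first coordinate. A segment through
    [pole b] therefore forces [w] to be one of the two unit vectors of the first axis, and these are
    checked directly. *)
Lemma htpy_small_half b : htpy [set w : vec | enorm w = 1] off_poles
  (fun w => pole R d b + 2^-1 *: w) (fun w => half o1 b (cubify w)).
Proof.
apply: htpy_line.
- apply: cont_onD; first exact: cont_on_cst.
  by apply: cont_onZ; [exact: cont_on_cst|exact: cont_on_id].
- by apply: cont_on_half; exact: cont_on_sphere_cubify.
move=> t w /andP[t0 t1] w1 c E.
have wn0 := sphere_neq0 w1; have nw0 : 0 < `|w| by rewrite normr_gt0.
pose ka := `|w|^-1; have ka0 : 0 < ka by rewrite invr_gt0.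
have kaw i : `|ka * w 0 i| <= 1.
  by rewrite normrM gtr0_norm// mulrC ler_pdivrMr// mul1r norm_coord.
have Ei i := congr1 (fun x : vec => x 0 i) E.
have E0 := Ei hd; have E1 := Ei o1.
have h0 : (1 - t) * (2^-1 + 2^-1 * w 0 hd) + t * (ka * w 0 hd) = 2^-1.
  by rewrite -[RHS](pole_hd R d c) -E0 !mxE.
have h1 : (1 - t) * (sg R b / 2 + 2^-1 * w 0 o1) + t * ((ka * w 0 o1 + sg R b) / 2) = sg R c / 2.
  by rewrite -(pole_o1 R d c) -E1 !mxE eqxx.
have k1 := kaw o1; have := coord_le_enorm w o1; rewrite w1 => wo1.
have [cb|cb] := eqVneq c b; last first.
  have cE : sg R c = - sg R b by rewrite -sgN; congr sg; case: b c cb {E Ei E0 E1 h0 h1} => -[].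
  move: wo1 k1; rewrite !ler_norml cE in h1 * => /andP[a1 a2] /andP[a3 a4].
  by have [s|s] := sgE b; rewrite s in h1; move: h1 a1 a2 a3 a4 t0 t1; clear; nra.
rewrite cb in h1.
have c0 : 0 < (1 - t) / 2 + t * ka / 2.
  have [->|tn] := eqVneq t 0; first by rewrite subr0 mul0r; lra.
  rewrite ltr_wpDl ?divr_ge0 ?subr_ge0// divr_gt0// mulr_gt0// lt_neqAle eq_sym tn //.
have w1E : w 0 o1 = 0.
  have : ((1 - t) / 2 + t * ka / 2) * w 0 o1 = 0 by lra.
  by move/eqP; rewrite mulf_eq0 gt_eqF//= => /eqP.
have wl l : l != ord0 -> w 0 (rshift 1 l) = 0.
  move=> l0; have := Ei (rshift 1 l); rewrite pole_tl// !mxE (rshift_o1 l0) /= add0r -/ka => El.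
  have : ((1 - t) / 2 + t * ka) * w 0 (rshift 1 l) = 0 by lra.
  move/eqP; rewrite mulf_eq0 gt_eqF/= => [/eqP//|].
  have : 0 <= t * ka by rewrite mulr_ge0// ltW.
  by move: c0; lra.
have w00 : w 0 hd ^+ 2 = 1.
  rewrite -[RHS](expr1n _ 2) -w1 enorm_sqr sum_head big1 ?addr0// => l _.
  by have [->|l0] := eqVneq l ord0; rewrite -?/o1 ?w1E ?wl// expr0n.
have k0 := kaw hd; have : 1 <= ka.
  by rewrite invf_ge1//; have := norm_le_enorm w; rewrite w1.
move: k0; rewrite ler_norml => /andP[]; move: h0 w00 t0 t1; clear.
set x := w 0 hd => h0 w00 t0 t1 a1 a2 a3.
have : (x - 1) * (x + 1) = 0 by nra.
move/eqP; rewrite mulf_eq0 subr_eq0 addr_eq0 => /orP[] /eqP xE; rewrite xE in h0 a1 a2; nra.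
Qed.

(** The points move along rays outside the open Euclidean unit ball, which contains both poles. *)
Lemma htpy_cubify_double : htpy [set w : vec | enorm w = 1] off_poles
  (@cubify R (1 + d.+1)) (fun w => 2 *: w).
Proof.
apply: htpy_line; first exact: cont_on_sphere_cubify.
  by apply: cont_onZ; [exact: cont_on_cst|exact: cont_on_id].
move=> t w /andP[t0 t1] w1 b E; have := enorm_pole b; rewrite -E ltNge.
have wn0 := sphere_neq0 w1; have nw0 : 0 < `|w| by rewrite normr_gt0.
rewrite /cubify !scalerA -scalerDl enormZ w1 mulr1.
have : 1 <= `|w|^-1.
  by rewrite invf_ge1//; have := norm_le_enorm w; rewrite w1.
move=> h; have h2 : 1 <= (1 - t) / `|w| + t * 2 by nra.
by rewrite ger0_norm ?h2// (le_trans _ h2).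
Qed.

(* On the wedge the sign of [|y|^2 - 3 y_0] separates the sphere of radius 1, where
   [|y|^2 = 2 y_0], from the sphere of radius 2, where [|y|^2 = 4 y_0]. *)
Definition pinch_map (y : vec) : vec :=
  if enorm y ^+ 2 - 3 * y 0 hd <= 0 then 2^-1 *: mtwist false y else 4^-1 *: mtwist true y.

Lemma mtwistZ b a (y : vec) : mtwist b (a *: y) = a *: mtwist b y.
Proof.
apply/rowP; apply: head2_ind => [||l l0]; rewrite [in RHS]mxE ?mtwist_hd ?mtwist_o1 ?mtwist_tl// !mxE; ring.
Qed.

Lemma mtwist0 b : mtwist b (0 : vec) = 0.
Proof. by rewrite -(scale0r (0 : vec)) mtwistZ !scale0r. Qed.

Lemma mtwist_e0 b (w : vec) : 2^-1 *: mtwist b (w + e0 d.+1) = sphere_at_pole b w.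
Proof.
apply/rowP; apply: head2_ind => [||l l0].
- rewrite [LHS]mxE mtwist_hd ![(w + _) 0 _]mxE e0_hd e0_tl.
  transitivity (2^-1 + 2^-1 * (w 0 hd - sg R b * w 0 o1)); first by field.
  by rewrite !mxE.
- rewrite [LHS]mxE mtwist_o1 ![(w + _) 0 _]mxE e0_hd e0_tl.
  transitivity (sg R b / 2 + 2^-1 * (w 0 o1 + sg R b * w 0 hd)); first by field.
  by rewrite !mxE.
- rewrite [LHS]mxE mtwist_tl// ![(w + _) 0 _]mxE e0_tl addr0.
  by rewrite mxE pole_tl// mxE mtwist_tl// add0r.
Qed.

Lemma enorm_De0 (w : vec) : enorm w = 1 -> enorm (w + e0 d.+1) ^+ 2 = 2 + 2 * w 0 hd.
Proof.
move=> w1; have E := enorm_sqr w; rewrite w1 expr1n sum_head in E.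
rewrite enorm_sqr sum_head (eq_bigr (fun j => w 0 (rshift 1 j) ^+ 2)) => [|j _].
  by rewrite mxE e0_hd; lra.
by rewrite mxE e0_tl addr0.
Qed.

Lemma incl_hd j (w : vec) : Defs.incl d.+1 j w 0 hd = j.+1%:R * (w 0 hd + 1).
Proof. by rewrite mxE; congr (_ * _); rewrite -(e0_hd R d.+1) mxE. Qed.

Lemma enorm_incl j (w : vec) : enorm w = 1 ->
  enorm (Defs.incl d.+1 j w) ^+ 2 = j.+1%:R ^+ 2 * (2 + 2 * w 0 hd).
Proof. by move=> w1; rewrite enormZ exprMn enorm_De0// real_normK ?num_real. Qed.

Lemma pinch_map_incl0 (w : vec) : enorm w = 1 -> pinch_map (Defs.incl d.+1 0 w) = sphere_at_pole false w.
Proof.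
move=> w1; rewrite /pinch_map enorm_incl// incl_hd.
have := coord_le_enorm w hd; rewrite w1 ler_norml => /andP[h1 h2].
rewrite ifT; last by rewrite expr1n !mul1r; lra.
by rewrite /Defs.incl scale1r mtwist_e0.
Qed.

Lemma pinch_map_incl1 (w : vec) : enorm w = 1 -> pinch_map (Defs.incl d.+1 1 w) = sphere_at_pole true w.
Proof.
move=> w1; rewrite /pinch_map enorm_incl// incl_hd.
have := coord_le_enorm w hd; rewrite w1 ler_norml => /andP[h1 h2].
have [h|h] := eqVneq (w 0 hd) (-1).
  have E : w + e0 d.+1 = 0.
    by apply: enorm0_eq0; apply/eqP; rewrite -sqrf_eq0 enorm_De0// h; apply/eqP; lra.
  by rewrite -[RHS]mtwist_e0 /Defs.incl E scaler0 !mtwist0 !scaler0; case: ifP.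
have h3 : -1 < w 0 hd by rewrite lt_neqAle eq_sym h.
rewrite ifF; last by apply/negbTE; rewrite -ltNge; lra.
by rewrite /Defs.incl mtwistZ scalerA -mtwist_e0; congr (_ *: _); field.
Qed.

Lemma wedge_cases (y : vec) : wedge_sph d.+1 2 y ->
  exists2 w : vec, enorm w = 1 & y = Defs.incl d.+1 0 w \/ y = Defs.incl d.+1 1 w.
Proof.
move=> [j [j2 yj]]; have j0 : (0 : R) < j.+1%:R by rewrite ltr0n.
exists (j.+1%:R^-1 *: y - e0 d.+1).
  apply: (@mulfI _ j.+1%:R); first by rewrite gt_eqF.
  rewrite mulr1 -[in RHS]yj -{1}(gtr0_norm j0) -enormZ scalerBr scalerA divff ?gt_eqF//.
  by rewrite scale1r.
rewrite /Defs.incl subrK.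
by case: j j2 yj j0 => [|[|//]] _ _ j0; [left|right]; rewrite scalerA divff ?scale1r// gt_eqF.
Qed.

Lemma pinch_map_off (y : vec) : wedge_sph d.+1 2 y -> off_poles (pinch_map y).
Proof.
move=> /wedge_cases[w w1 [->|->]].
  by rewrite pinch_map_incl0//; exact: sphere_at_pole_off.
by rewrite pinch_map_incl1//; exact: sphere_at_pole_off.
Qed.

Lemma qmap0 : pinch_map 0 = 0.
Proof. by rewrite /pinch_map !mtwist0 !scaler0; case: ifP. Qed.

Lemma cont_on_pinch_map : cont_on (wedge_sph d.+1 2) pinch_map.
Proof.
apply: cont_on_glue.
- apply: cont_onBr; last first.
    by apply: cont_onM; [exact: cont_on_cst|apply: cont_on_coord; exact: cont_on_id].
  by apply: (@cont_onM R _ _ (@enorm R _) (@enorm R _)); apply: continuous_cont_on; exact: continuous_enorm.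
- by apply: cont_onZ; [exact: cont_on_cst|apply: cont_on_mtwist; exact: cont_on_id].
- by apply: cont_onZ; [exact: cont_on_cst|apply: cont_on_mtwist; exact: cont_on_id].
move=> y /wedge_cases[w w1 H] yE; suff -> : y = 0 by rewrite !mtwist0 !scaler0.
apply: enorm0_eq0; apply/eqP; rewrite -sqrf_eq0.
by case: H yE => ->; rewrite enorm_incl// incl_hd => yE; apply/eqP; lra.
Qed.
End Target.

(** * The cube model of homotopy groups on the boundary of a cube *)

Section Face.
Variables (R : realType) (d : nat).
Local Notation vec := ('rV[R]_(1 + d.+1)).
Local Notation hd := (ord0 : 'I_(1 + d.+1)).

Lemma norm_rsubmx (y : vec) : `|rsubmx y| <= `|y|.
Proof. by apply: norm_le => // i; rewrite mxE; exact: norm_coord. Qed.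

Lemma norm_rsubmx1 (y : vec) : `|y| = 1 -> `|y 0 hd| < 1 -> `|rsubmx y| = 1.
Proof.
move=> y1 h; apply/eqP; rewrite eq_le -{1}y1 norm_rsubmx /=.
have [i] := norm1_coord y1; move: i; apply: head_ind => [E|j <-].
  by rewrite E ltxx in h.
by have := norm_coord (rsubmx y) j; rewrite mxE.
Qed.

(** Transfers a map [f] of the cube with constant boundary value [w] to the boundary of the next
    cube, with the face [y_0 = 1] carrying [f]. The cut can be made at [y_0 = 0], because on the
    sides [0 < y_0 < 1] the projection [rsubmx y] already lies on the boundary. *)
Definition face_ext (W : Type) (w : W) (f : 'rV[R]_d.+1 -> W) (y : vec) : W :=
  if y 0 hd <= 0 then w else f (rsubmx y).

Lemma cont_on_rsubmx (S : set vec) : cont_on S (fun y : vec => rsubmx y).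
Proof.
apply: cont_on_row => i; apply: (@cont_on_eq vec R S (fun y : vec => y 0 (rshift 1 i))).
  by move=> y _; rewrite mxE.
by apply: cont_on_coord; exact: cont_on_id.
Qed.

Lemma face_htpy (W : normedModType R) (Y : set W) (w : W) (f g : 'rV[R]_d.+1 -> W)
    (H : R * 'rV[R]_d.+1 -> W) :
  cont_on (cyl [set u : 'rV[R]_d.+1 | `|u| <= 1]) H -> Y w ->
  (forall t u, 0 <= t <= 1 -> `|u| <= 1 -> Y (H (t, u))) ->
  (forall u, `|u| <= 1 -> H (0, u) = f u /\ H (1, u) = g u) ->
  (forall t u, 0 <= t <= 1 -> `|u| = 1 -> H (t, u) = w) ->
  htpy (sup_sphere vec) Y (face_ext w f) (face_ext w g).
Proof.
move=> cH Yw HY Hfg Hw.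
exists (fun p : R * vec => if p.2 0 hd <= 0 then w else H (p.1, rsubmx p.2)); split.
- apply: cont_on_glue.
  + by apply: cont_on_coord; exact: cont_on_snd.
  + exact: cont_on_cst.
  + apply: (@cont_on_comp _ _ _ _ (cyl [set u : 'rV[R]_d.+1 | `|u| <= 1])
      (fun p : R * vec => (p.1, rsubmx p.2))) => //.
      apply: cont_on_pair; first exact: cont_on_fst.
      apply: (@cont_on_comp _ _ _ _ setT snd (fun y : vec => rsubmx y)) => //.
        exact: cont_on_snd.
      exact: cont_on_rsubmx.
    move=> [t y] [[/= t01 y1] _]; split=> //=; rewrite -y1; exact: norm_rsubmx.
  + move=> [t y] [/= t01 y1] y0; rewrite Hw//; apply: norm_rsubmx1 => //.
    by rewrite y0 normr0.
- move=> t y t01 y1 /=; case: ifP => // _; apply: HY => //; rewrite -y1; exact: norm_rsubmx.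
- move=> y y1 /=; rewrite /face_ext; case: ifP => // _.
  by apply: Hfg; rewrite -y1; exact: norm_rsubmx.
Qed.

(* Collapses the whole boundary of the cube except the face [y_0 = 1] to a point; its value at
   [y] is never antipodal to [rad y], so it is homotopic to [rad]. *)
Definition face_collapse : vec -> vec := face_ext (spt d.+1) (@centered_collapse R d.+1).

Lemma enorm_spt : enorm (spt d.+1 : vec) = 1.
Proof. by rewrite enormN enorm_e0. Qed.

Lemma face_collapse_sphere y : enorm (face_collapse y) = 1.
Proof. by rewrite /face_collapse /face_ext; case: ifP => _; rewrite ?enorm_spt ?centered_collapse_sphere. Qed.

Lemma cont_on_face_collapse : cont_on (sup_sphere vec) face_collapse.
Proof.
suff /htpy_contl[] : htpy (sup_sphere vec) setT face_collapse face_collapse by [].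
apply: (@face_htpy _ _ _ _ _ (fun p => centered_collapse p.2)) => //.
- apply: (@cont_on_comp _ _ _ _ setT snd (@centered_collapse R d.+1)) => //; first exact: cont_on_snd.
  by apply: continuous_cont_on; exact: continuous_centered_collapse.
- by move=> t u _; exact: centered_collapse_bd.
Qed.

Lemma sup_sphere_neq0 (V : normedModType R) (y : V) : `|y| = 1 -> y != 0.
Proof. by move=> y1; rewrite -normr_eq0 y1 oner_eq0. Qed.

Lemma cont_on_sup_sphere_rad : cont_on (sup_sphere vec) (@rad R (1 + d.+1)).
Proof. by apply: cont_on_sub (@cont_on_rad R _) => y /sup_sphere_neq0. Qed.

Lemma htpy_face_collapse_rad : htpy (sup_sphere vec) (sphere (1 + d)) face_collapse (@rad R (1 + d.+1)).
Proof.
apply: htpy_sphere.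
- exact: cont_on_face_collapse.
- exact: cont_on_sup_sphere_rad.
- by move=> y _; exact: face_collapse_sphere.
- by move=> y /sup_sphere_neq0 y0; exact: enorm_rad.
move=> y y1; have y0 := sup_sphere_neq0 y1; have e0' := enorm_gt0 y0.
rewrite /face_collapse /face_ext; case: ifP => [h|/negbT].
  move/(congr1 (fun x : vec => x 0 hd)); rewrite mxE e0_hd [RHS]mxE => /oppr_inj.
  rewrite mxE => E; have : (enorm y)^-1 * y 0 hd <= 0 by rewrite mulr_ge0_le0 ?invr_ge0 ?enorm_ge0.
  by rewrite -E ler10.
rewrite -ltNge => h E.
have NE i : (- rad y) 0 i = - ((enorm y)^-1 * y 0 i) by rewrite !mxE.
have hE := congr1 (fun x : vec => x 0 hd) E; rewrite centered_collapse_hd NE in hE.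
have n1 : `|rsubmx y| <= 1 by rewrite -y1 norm_rsubmx.
have A0 := centered_collapse_coef_ge0 n1.
have u0 : rsubmx y = 0.
  apply/rowP => j; have := congr1 (fun x : vec => x 0 (rshift 1 j)) E.
  rewrite centered_collapse_tl NE [rsubmx y 0 j]mxE => H.
  have : (sin (pi * `|rsubmx y|) / enorm (rsubmx y) + (enorm y)^-1) * y 0 (rshift 1 j) = 0.
    by rewrite mulrDl H addNr.
  move/eqP; rewrite mulf_eq0 gt_eqF /=; last by rewrite ltr_wpDl// invr_gt0.
  by move/eqP => E0; rewrite !mxE E0.
move: hE; rewrite u0 normr0 mulr0 cos0.
have : 0 < (enorm y)^-1 * y 0 hd by rewrite mulr_gt0// invr_gt0.
lra.
Qed.
End Face.

Section CubeSum.
Variables (R : realType) (d : nat).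
Implicit Types (u : 'rV[R]_d.+1).

Definition tocube u : 'rV[R]_d.+1 := 2^-1 *: (u + const_mx 1).

Lemma tocubeK u : 2 *: tocube u - const_mx 1 = u.
Proof. by rewrite /tocube scalerA divff// scale1r addrK. Qed.

Lemma tocube_in u : `|u| <= 1 -> in_cube (tocube u).
Proof. by move=> u1; apply/in_cubeP; rewrite tocubeK. Qed.

Lemma tocube_bd u : `|u| = 1 -> on_bd (tocube u).
Proof. by move=> u1; apply/on_bdP; rewrite tocubeK. Qed.

Lemma collapse_tocube u : collapse d.+1 (tocube u) = centered_collapse u.
Proof. by rewrite collapseE tocubeK. Qed.

Lemma coord0E u : Defs.coord0 u = u 0 ord0.
Proof. by rewrite /Defs.coord0 (big_pred1 ord0)// => j. Qed.

Lemma setc0_hd u t : setc0 u t 0 ord0 = t. Proof. by rewrite mxE. Qed.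

Lemma setc0_tl u t l : l != ord0 -> setc0 u t 0 l = u 0 l.
Proof. by move=> l0; rewrite mxE ifF//; apply: contraNF l0 => /eqP h; apply/eqP/val_inj. Qed.

Lemma setc0_tocube u t : setc0 (tocube u) t = tocube (setc0 u (2 * t - 1)).
Proof.
apply/rowP => l; have [->|l0] := eqVneq l ord0.
  by rewrite setc0_hd mxE [in RHS]mxE setc0_hd mxE; field.
by rewrite setc0_tl// mxE [in RHS]mxE [in LHS]mxE [in RHS]mxE setc0_tl.
Qed.

Lemma norm_setc0 u t : `|u| <= 1 -> `|t| <= 1 -> `|setc0 u t| <= 1.
Proof.
move=> u1 t1; apply: norm_le => // l; have [->|l0] := eqVneq l ord0; first by rewrite setc0_hd.
by rewrite setc0_tl// (le_trans (norm_coord _ _)).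
Qed.

Lemma norm_setc0_bd u t : `|u| <= 1 -> `|t| <= 1 ->
  (`|t| = 1 \/ exists2 l, l != ord0 & `|u 0 l| = 1) -> `|setc0 u t| = 1.
Proof.
move=> u1 t1 H; apply/eqP; rewrite eq_le norm_setc0//=.
case: H => [<-|[l l0 <-]]; first by have := norm_coord (setc0 u t) ord0; rewrite setc0_hd.
by have := norm_coord (setc0 u t) l; rewrite setc0_tl.
Qed.

Lemma cube_add_tocube e (f g : 'rV[R]_d.+1 -> 'rV[R]_e) u :
  cube_add f g (tocube u) = if u 0 ord0 <= 0 then f (tocube (setc0 u (2 * u 0 ord0 + 1)))
    else g (tocube (setc0 u (2 * u 0 ord0 - 1))).
Proof.
rewrite /cube_add coord0E !setc0_tocube.
have -> : (tocube u 0 ord0 <= 2^-1) = (u 0 ord0 <= 0).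
  by rewrite !mxE; apply/idP/idP; lra.
have -> : 2 * (2 * tocube u 0 ord0) - 1 = 2 * u 0 ord0 + 1 by rewrite !mxE; field.
by have -> : 2 * (2 * tocube u 0 ord0 - 1) - 1 = 2 * u 0 ord0 - 1 by rewrite !mxE; field.
Qed.

(** [cube_sum] nests to the right and ends with a constant: the second summand fills only
    [0 <= u_0 <= 1/2], at fourfold speed, and the last quarter is constant. *)
Lemma cube_sum2E e (f : nat -> 'rV[R]_d.+1 -> 'rV[R]_e) u :
  cube_sum f 2 (tocube u) = if u 0 ord0 <= 0 then f 0%N (tocube (setc0 u (2 * u 0 ord0 + 1)))
    else if u 0 ord0 <= 2^-1 then f 1%N (tocube (setc0 u (4 * u 0 ord0 - 1))) else 0.
Proof.
rewrite /cube_sum /= cube_add_tocube; case: ifP => // _.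
rewrite cube_add_tocube setc0_hd.
have -> : (2 * u 0 ord0 - 1 <= 0) = (u 0 ord0 <= 2^-1) by apply/idP/idP; lra.
case: ifP => // _; congr (f _ (tocube _)); apply/rowP => l.
have [->|l0] := eqVneq l ord0; first by rewrite !setc0_hd; ring.
by rewrite !setc0_tl.
Qed.

Lemma setc0_id u : setc0 u (u 0 ord0) = u.
Proof.
by apply/rowP => l; have [->|l0] := eqVneq l ord0; rewrite ?setc0_hd ?setc0_tl.
Qed.

Lemma norm1_setc0 u : `|u| = 1 -> `|u 0 ord0| = 1 \/ exists2 l, l != ord0 & `|u 0 l| = 1.
Proof.
move=> /norm1_coord[l E]; have [l0|l0] := eqVneq l ord0; first by left; rewrite -l0.
by right; exists l.
Qed.

Lemma cube_sum2_bd e (f : nat -> 'rV[R]_d.+1 -> 'rV[R]_e) u :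
  (forall j v, `|v| = 1 -> f j (tocube v) = 0) -> `|u| = 1 -> cube_sum f 2 (tocube u) = 0.
Proof.
move=> f0 u1; have un : `|u| <= 1 by rewrite u1.
have := norm_coord u ord0; rewrite u1 ler_norml => /andP[a1 a2].
rewrite cube_sum2E; case: leP => h.
  apply: f0; apply: norm_setc0_bd => //; first by rewrite ler_norml; lra.
  case: (norm1_setc0 u1) => [E|]; last by right.
  left; rewrite (ler0_norm h) in E; have -> : u 0 ord0 = -1 by lra.
  by rewrite mulrN1 (_ : -2 + 1 = -1) ?normrN1//; lra.
case: leP => // h2; apply: f0; apply: norm_setc0_bd => //; first by rewrite ler_norml; lra.
case: (norm1_setc0 u1) => [E|]; last by right.
by exfalso; rewrite (gtr0_norm h) in E; lra.
Qed.

Lemma incl_spt j : Defs.incl d.+1 j (spt d.+1 : 'rV[R]_(1 + d.+1)) = 0.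
Proof. by rewrite /Defs.incl addNr scaler0. Qed.

(** On the two summands both poles are excluded by the segment lemmas. On the last quarter the
    pinched map is 0, and the segment is radial with nonpositive first coordinate because
    [|u| > 1/2], whereas both poles have first coordinate 1/2. *)
Lemma pinch_avoid u (t : R) : `|u| <= 1 -> 0 <= t <= 1 ->
  off_poles ((1 - t) *: (2 *: centered_collapse u) +
    t *: pinch_map (cube_sum (fun j => Defs.incl d.+1 j \o collapse d.+1) 2 (tocube u))).
Proof.
move=> u1 t01; have /andP[t0 t1] := t01.
have := norm_coord u ord0 => /le_trans /(_ u1); rewrite ler_norml => /andP[a1 a2].
rewrite cube_sum2E /= !collapse_tocube.
have A0 := centered_collapse_coef_ge0 u1.
case: leP => h.
  have n' : `|setc0 u (2 * u 0 ord0 + 1)| <= 1 by apply: norm_setc0 => //; rewrite ler_norml; lra.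
  rewrite pinch_map_incl0 ?centered_collapse_sphere// => -[].
    apply: (@segment_neq_opposite_pole R d false) => //; first exact: centered_collapse_sphere.
    by rewrite /sg mulN1r oppr_ge0 centered_collapse_tl mulr_ge0_le0.
  apply: segment_neq_pole_left => //; first by move=> l l0; rewrite setc0_tl.
  by rewrite setc0_hd.
case: leP => h2.
  have n' : `|setc0 u (4 * u 0 ord0 - 1)| <= 1 by apply: norm_setc0 => //; rewrite ler_norml; lra.
  rewrite pinch_map_incl1 ?centered_collapse_sphere// => -[].
    apply: segment_neq_pole_right => //; first by move=> l l0; rewrite setc0_tl.
      by rewrite ltW.
    by rewrite setc0_hd.
  apply: (@segment_neq_opposite_pole R d true) => //; first exact: centered_collapse_sphere.
  by rewrite /sg mul1r centered_collapse_tl mulr_ge0// ltW.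
rewrite qmap0 scaler0 addr0 => b /(congr1 (fun x : 'rV[R]_(1 + d.+1) => x 0 ord0)).
rewrite pole_hd mxE [X in _ * X]mxE centered_collapse_hd => E.
have : 0 <= cos (pi * `|u| - pi).
  have := norm_coord u ord0; rewrite gtr0_norm// => un.
  have p0 := pi_gt0 R.
  by apply: cos_ge0_pihalf; apply/andP; split; nra.
rewrite cosB cospi sinpi mulr0 addr0 mulrN1 => c0.
by nra.
Qed.
End CubeSum.

(** * Filling a cube with two holes *)

Section Fill.
Variables (R : realType) (k n : nat).
Local Notation dom := ('rV[R]_(1 + k.+1)).
Local Notation cod := ('rV[R]_(1 + n.+1)).
Local Notation hd := (ord0 : 'I_(1 + k.+1)).
Local Notation o1 := (snd_ord k).
Local Notation ho1 := (snd_ord n).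

(** Condition ( * ) speaks about a given pinch [s], so one has to be produced. The cube sum factors
    through the collapse because it is 0 on the boundary of the cube, where alone the collapse fails
    to be injective. *)
Lemma pinch_exists : exists s : cod -> cod, forall x : 'rV[R]_n.+1, in_cube x ->
  s (collapse n.+1 x) = cube_sum (fun j => Defs.incl n.+1 j \o collapse n.+1) 2 x.
Proof.
pose f := cube_sum (fun j => Defs.incl n.+1 j \o collapse n.+1) 2 : 'rV[R]_n.+1 -> cod.
exists (fun v => f (get [set x | in_cube x /\ collapse n.+1 x = v])) => x cx.
set y := get _; have [cy yE] : in_cube y /\ collapse n.+1 y = collapse n.+1 x.
  by apply: (@getI _ [set z | in_cube z /\ collapse n.+1 z = collapse n.+1 x] x).
have xE : x = tocube (2 *: x - const_mx 1).
  by rewrite /tocube subrK scalerA mulVf ?scale1r.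
have yE' : y = tocube (2 *: y - const_mx 1).
  by rewrite /tocube subrK scalerA mulVf ?scale1r.
rewrite !collapseE in yE; move/in_cubeP: cx => cx; move/in_cubeP: cy => cy.
have [E|[h1 h2]] := centered_collapse_inj cy cx yE; first by rewrite yE' E -xE.
have H j v : `|v| = 1 -> (Defs.incl n.+1 j \o collapse n.+1) (tocube v) = 0 :> cod.
  by move=> v1; rewrite /= collapse_tocube centered_collapse_bd// incl_spt.
by rewrite -/f yE' xE /f !cube_sum2_bd.
Qed.

Lemma rel_htpyP (Y : set cod) (f g : 'rV[R]_k.+1 -> cod) : rel_htpy Y f g ->
  exists H : R * 'rV[R]_k.+1 -> cod, [/\
    cont_on (cyl [set u : 'rV[R]_k.+1 | `|u| <= 1]) H,
    forall t u, 0 <= t <= 1 -> `|u| <= 1 -> Y (H (t, u)),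
    forall u, `|u| <= 1 -> H (0, u) = f (tocube u) /\ H (1, u) = g (tocube u) &
    forall t u, 0 <= t <= 1 -> `|u| = 1 -> H (t, u) = 0].
Proof.
move=> [H [/cont_onP cH [HY [Hfg H0]]]]; exists (fun p => H (p.1, tocube p.2)); split.
- apply: (@cont_on_comp _ _ _ _ _ (fun p : R * 'rV[R]_k.+1 => (p.1, tocube p.2)) H _ _ cH).
    apply: cont_on_pair; first exact: cont_on_fst.
    apply: cont_onZ; first exact: cont_on_cst.
    by apply: cont_onD; [exact: cont_on_snd|exact: cont_on_cst].
  by move=> [t u] [/= t01 u1]; split=> //; exact: tocube_in.
- by move=> t u t01 u1; apply: HY => //; exact: tocube_in.
- by move=> u u1; apply: Hfg; exact: tocube_in.
- by move=> t u t01 u1; apply: H0 => //; exact: tocube_bd.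
Qed.

Lemma sphere_at_pole_spt b : sphere_at_pole b (spt n.+1 : cod) = 0.
Proof. by rewrite -mtwist_e0 addNr mtwist0 scaler0. Qed.

Lemma pinch_map_incl j (w : cod) : (j < 2)%N -> enorm w = 1 ->
  pinch_map (Defs.incl n.+1 j w) = sphere_at_pole (j == 1%N) w.
Proof. by case: j => [|[|//]] _ w1; [exact: pinch_map_incl0|exact: pinch_map_incl1]. Qed.

Section Based.
Variables (beta' b : dom -> cod).
Hypothesis cb' : cont_on (sphere k.+1) beta'.
Hypothesis b'S : forall x, sphere k.+1 x -> sphere n.+1 (beta' x).
Hypothesis b'spt : beta' (spt k.+1) = spt n.+1.
Hypothesis bb' : htpy (sphere k.+1) (sphere n.+1) b beta'.

Let fs j : 'rV[R]_k.+1 -> cod := Defs.incl n.+1 j \o beta' \o collapse k.+1.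

Lemma fsE j u : fs j (tocube u) = Defs.incl n.+1 j (beta' (centered_collapse u)).
Proof. by rewrite /fs /= collapse_tocube. Qed.

Lemma fs_bd j u : `|u| = 1 -> fs j (tocube u) = 0.
Proof. by move=> u1; rewrite fsE centered_collapse_bd// b'spt incl_spt. Qed.

Let ccS u : sphere k.+1 (centered_collapse u : dom). Proof. exact: centered_collapse_sphere. Qed.
Let b'cc u : enorm (beta' (centered_collapse u)) = 1. Proof. exact: b'S. Qed.

(** Since [face_collapse] is homotopic to [rad] and [b] to [beta'], a radial extension may be traded
    for a based map, to which the cube model applies. *)
Lemma htpy_rad_maps (Y : set cod) (g : cod -> cod) : cont_on (sphere n.+1) g ->
  (forall x, sphere n.+1 x -> Y (g x)) ->
  htpy (sup_sphere dom) Y (fun y => g (b (rad y))) (fun y => g (beta' (face_collapse y))).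
Proof.
move=> cg gY; apply: (@htpy_trans _ _ _ _ _ _ (fun y => g (beta' (rad y)))).
  apply: (htpy_post cg gY); apply: htpy_pre bb'; first exact: cont_on_sup_sphere_rad.
  by move=> y /sup_sphere_neq0 y0; exact: enorm_rad.
apply: htpy_sym; apply: (htpy_post cg gY).
apply: (@htpy_post _ _ _ _ _ (sphere k.+1) (sphere n.+1) _ _ beta' cb' b'S).
exact: htpy_face_collapse_rad.
Qed.

(** The chain inflates the target to the sphere of radius 2, passes from [b] to the based map
    [beta'], and pinches the target along the segments of [pinch_avoid]; only then does ( * ) move
    the pinch from the target to the domain. *)
Lemma outer_htpy (s : cod -> cod) :
  (forall x : 'rV[R]_n.+1, in_cube x ->
    s (collapse n.+1 x) = cube_sum (fun j => Defs.incl n.+1 j \o collapse n.+1) 2 x) ->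
  rel_htpy (wedge_sph n.+1 2) (s \o beta' \o collapse k.+1) (cube_sum fs 2) ->
  htpy (sup_sphere dom) (@off_poles R n) (fun y => cubify (b (rad y)))
    (face_ext 0 (fun u => pinch_map (cube_sum fs 2 (tocube u)))).
Proof.
move=> sP /rel_htpyP[H [cH HY Hfg H0]].
have sE (v : cod) : enorm v = 1 -> exists2 u, `|u| <= 1 &
    v = centered_collapse u /\ s v = cube_sum (fun j => Defs.incl n.+1 j \o collapse n.+1) 2 (tocube u).
  move=> /centered_collapse_surj -/(_ isT)[u u1 <-]; exists u => //; split=> //.
  by rewrite -sP ?collapse_tocube//; exact: tocube_in.
have off0 : @off_poles R n 0.
  by rewrite -(sphere_at_pole_spt true); apply: sphere_at_pole_off; exact: enorm_spt.
(* The base point is the collapse of boundary points only, and there the cube sum is 0. *)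
have sspt : s (spt n.+1) = 0.
  have [u u1 [uE ->]] := sE _ (enorm_spt R n).
  have u1' : `|u| = 1.
    have n1 : `|const_mx 1 : 'rV[R]_n.+1| = 1.
      apply/eqP; rewrite eq_le; apply/andP; split.
        by apply: norm_le => // i; rewrite mxE normr1.
      by have := norm_coord (const_mx 1 : 'rV[R]_n.+1) ord0; rewrite mxE normr1.
    have n1' : `|const_mx 1 : 'rV[R]_n.+1| <= 1 by rewrite n1.
    by rewrite -(centered_collapse_bd n1) in uE; have [->//|[//]] := centered_collapse_inj u1 n1' (esym uE).
  apply: cube_sum2_bd => // j v v1 /=; by rewrite collapse_tocube centered_collapse_bd// incl_spt.
have H3 : htpy (sup_sphere dom) (@off_poles R n) (face_ext 0 (fun u => pinch_map (s (beta' (centered_collapse u)))))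
    (face_ext 0 (fun u => pinch_map (cube_sum fs 2 (tocube u)))).
  apply: (@face_htpy _ _ _ _ _ _ _ (fun p => pinch_map (H p))) => //.
  - by apply: (cont_on_comp cH _ (@cont_on_pinch_map R n)) => -[t u] [t01 u1]; exact: HY.
  - by move=> t u t01 u1; apply: pinch_map_off; exact: HY.
  - by move=> u u1; have [-> ->] := Hfg u u1; rewrite /= collapse_tocube.
  - by move=> t u t01 u1; rewrite H0// qmap0.
have E3 y : face_ext 0 (fun u => pinch_map (s (beta' (centered_collapse u)))) y = pinch_map (s (beta' (face_collapse y))).
  by rewrite /face_collapse /face_ext; case: ifP => // _; rewrite b'spt sspt qmap0.
have [c3 _] := htpy_contl H3.
apply: htpy_trans H3; apply: (htpy_eq (fun _ _ => erefl) (fun y _ => esym (E3 y))).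
apply: (@htpy_trans _ _ _ _ _ _ (fun y => 2 *: beta' (face_collapse y))).
  apply: (@htpy_trans _ _ _ _ _ _ (fun y => 2 *: b (rad y))).
    apply: (@htpy_pre _ _ _ _ _ _ _ _ _ (fun y : dom => b (rad y)) _ _ (@htpy_cubify_double R n)).
      have [cb _] := htpy_contl bb'.
      apply: (cont_on_comp (@cont_on_sup_sphere_rad R k) _ cb) => y /sup_sphere_neq0; exact: enorm_rad.
    by move=> y /sup_sphere_neq0 y0; have [] := htpyY bb' (enorm_rad y0 : sphere k.+1 _).
  apply: (@htpy_rad_maps _ (fun w => 2 *: w)).
    by apply: cont_onZ; [exact: cont_on_cst|exact: cont_on_id].
  move=> w w1 c E; have [_ h] := htpyY (@htpy_cubify_double R n) w1.
  exact: h E.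
apply: htpy_line.
- apply: cont_onZ; first exact: cont_on_cst.
  by apply: (cont_on_comp (@cont_on_face_collapse R k) _ cb') => y _; exact: face_collapse_sphere.
- by apply: cont_on_eq c3 => y _; exact: E3.
move=> t y t01 y1; have [u u1 [-> ->]] := sE _ (b'S (face_collapse_sphere y : sphere k.+1 _)).
exact: pinch_avoid.
Qed.

Lemma inner_htpy c : htpy (sup_sphere dom) (@off_poles R n)
  (fun y => sphere_at_pole c (beta' (face_collapse y)))
  (fun y => half ho1 c (cubify (b (rad y)))).
Proof.
apply: (@htpy_trans _ _ _ _ _ _ (fun y => sphere_at_pole c (b (rad y)))).
  apply: htpy_sym; apply: htpy_rad_maps; first exact: cont_on_sphere_at_pole.
  by move=> w w1; exact: sphere_at_pole_off.
apply: (@htpy_pre _ _ _ _ _ _ _ _ _ (fun y : dom => b (rad y)) _ _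
  (htpy_trans (@htpy_pole_small R n c) (@htpy_small_half R n c))).
  have [cb _] := htpy_contl bb'.
  apply: (cont_on_comp (@cont_on_sup_sphere_rad R k) _ cb) => y /sup_sphere_neq0; exact: enorm_rad.
by move=> y /sup_sphere_neq0 y0; have [] := htpyY bb' (enorm_rad y0 : sphere k.+1 _).
Qed.

Lemma face_ext_pole j y : (j < 2)%N ->
  face_ext 0 (fun u => pinch_map (fs j (tocube u))) y = sphere_at_pole (j == 1%N) (beta' (face_collapse y)).
Proof.
move=> j2; rewrite /face_collapse /face_ext; case: ifP => _.
  by rewrite b'spt sphere_at_pole_spt.
by rewrite fsE pinch_map_incl.
Qed.

Let stretch (t : R) (u : 'rV[R]_k.+1) := setc0 u (Num.min 1 ((2 - t) * (u 0 ord0 + 1) - 1)).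

(** Because [cube_sum] ends with a constant, the second half of the pinch is a squeezed copy of the
    summand followed by 0. The homotopy stretches the copy back over the cube; a first coordinate
    that would exceed 1 is cut off there, on the boundary, where the value is 0. *)
Lemma stretch_htpy : htpy (sup_sphere dom) (@off_poles R n)
  (face_ext 0 (fun u => if u 0 ord0 <= 0 then pinch_map (fs 1 (tocube (setc0 u (2 * u 0 ord0 + 1)))) else 0))
  (fun y => sphere_at_pole true (beta' (face_collapse y))).
Proof.
have qE u : pinch_map (fs 1 (tocube u)) = sphere_at_pole true (beta' (centered_collapse u)).
  by rewrite fsE pinch_map_incl.
have off0 : @off_poles R n 0.
  by rewrite -(sphere_at_pole_spt true); apply: sphere_at_pole_off; exact: enorm_spt.
have cu (u : 'rV[R]_k.+1) : `|u| <= 1 -> -1 <= u 0 ord0 <= 1.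
  by rewrite -ler_norml; apply: le_trans; exact: norm_coord.
have mn (t x : R) : 0 <= t <= 1 -> -1 <= x <= 1 -> `|Num.min 1 ((2 - t) * (x + 1) - 1)| <= 1.
  move=> t01 x1; rewrite ler_norml ge_min lexx le_min /= andbT; apply/andP; split; first lra.
  by rewrite lerBrDr addNr mulr_ge0//; lra.
apply: (htpy_eq (fun _ _ => erefl) (fun y _ => @face_ext_pole 1 y isT)).
apply: (@face_htpy _ _ _ _ _ _ _ (fun p => sphere_at_pole true (beta' (centered_collapse (stretch p.1 p.2))))) => //.
- pose S' := [set v : cod | True].
  apply: (@cont_on_comp _ _ _ _ S' (fun p : R * 'rV[R]_k.+1 => beta' (centered_collapse (stretch p.1 p.2)))) => //; last first.
    exact: cont_on_sphere_at_pole.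
  apply: (@cont_on_comp _ _ _ _ (sphere k.+1) (fun p : R * 'rV[R]_k.+1 => centered_collapse (stretch p.1 p.2))) => //.
  apply: (@cont_on_comp _ _ _ _ setT (fun p : R * 'rV[R]_k.+1 => stretch p.1 p.2)) => //; last first.
    by apply: continuous_cont_on; exact: continuous_centered_collapse.
  have cc0 l : cont_on (cyl [set u : 'rV[R]_k.+1 | `|u| <= 1]) (fun p => p.2 0 l).
    by apply: cont_on_coord; exact: cont_on_snd.
  apply: cont_on_row => l; have [->|l0] := eqVneq l ord0; last first.
    by apply: cont_on_eq (cc0 l) => p _; rewrite /stretch setc0_tl.
  apply: (@cont_on_eq _ _ _ (fun p : R * 'rV[R]_k.+1 => Num.min 1 ((2 - p.1) * (p.2 0 ord0 + 1) - 1))).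
    by move=> p _; rewrite /stretch setc0_hd.
  apply: cont_on_min; first exact: cont_on_cst.
  apply: cont_onBr; last exact: cont_on_cst.
  apply: cont_onM.
    by apply: cont_onBr; [exact: cont_on_cst|exact: cont_on_fst].
  by apply: cont_onDr => //; exact: cont_on_cst.
- by move=> t u t01 u1; apply: sphere_at_pole_off.
- move=> u u1 /=; split; last first.
    rewrite qE /stretch (_ : Num.min _ _ = u 0 ord0) ?setc0_id//.
    have -> : (2 - 1) * (u 0 ord0 + 1) - 1 = u 0 ord0 by ring.
    by apply/min_r; have /andP[] := cu u u1.
  rewrite /stretch subr0 qE; case: leP => h.
    have -> // : Num.min 1 (2 * (u 0 ord0 + 1) - 1) = 2 * u 0 ord0 + 1.
    by rewrite min_r; [ring|lra].
  rewrite min_l; last lra.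
  by rewrite centered_collapse_bd ?b'spt ?sphere_at_pole_spt//; apply: norm_setc0_bd; rewrite ?normr1//; left.
- move=> t u t01 u1 /=; have u1' : `|u| <= 1 by rewrite u1.
  rewrite centered_collapse_bd ?b'spt ?sphere_at_pole_spt//; apply: norm_setc0_bd => //.
    by apply: mn => //; exact: cu.
  case: (norm1_setc0 u1) => [E|]; last by right.
  left; have /andP[t0 t1] := t01.
  have /eqP : (u 0 ord0 + 1) * (u 0 ord0 - 1) = 0.
    have : (u 0 ord0) ^+ 2 = 1 by rewrite -real_normK ?num_real// E expr1n.
    by lra.
  rewrite mulf_eq0 addr_eq0 subr_eq0 => /orP[] /eqP ->.
    by rewrite addNr mulr0 sub0r min_r ?normrN1//; lra.
  by rewrite min_l ?normr1//; lra.
Qed.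
End Based.
End Fill.

Section Assemble.
Variables (R : realType) (d : nat).
Implicit Types (j : 'I_d) (x z : 'rV[R]_d).

Definition holed (mu : R) j : set 'rV[R]_d :=
  [set x | `|x| <= 1 /\ forall b, 1 <= `|unhole mu j b x|].

Lemma sg_abs b : `|sg R b| = 1. Proof. by case: b; rewrite /= ?normrN normr1. Qed.

Lemma norm_unhalf j b z : `|z| <= 1 -> 0 <= sg R b * z 0 j -> `|unhalf j b z| <= 1.
Proof.
move=> z1 sz; apply: norm_le => // l; have := le_trans (norm_coord z l) z1.
rewrite mxE; case: eqP => [->|//]; rewrite !ler_norml.
by case: b sz; rewrite /sg; lra.
Qed.

Lemma norm_unhalf1 j b z : `|z| = 1 -> 0 <= sg R b * z 0 j -> `|unhalf j b z| = 1.
Proof.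
move=> z1 sz; apply/eqP; rewrite eq_le norm_unhalf ?z1//=.
have [l zl] := norm1_coord z1; apply: le_trans (norm_coord _ l); rewrite mxE.
case: eqP => [lj|_]; last by rewrite zl.
rewrite lj in zl *; have {}zl : sg R b * z 0 j = 1.
  by rewrite -zl -[LHS]ger0_norm// normrM sg_abs mul1r.
by case: b zl {sz}; rewrite /sg => zl; [rewrite ger0_norm|rewrite ler0_norm]; lra.
Qed.

Lemma norm_unhalf0 j b z : `|z| <= 1 -> z 0 j = 0 -> `|unhalf j b z| = 1.
Proof.
move=> z1 zj; apply/eqP; rewrite eq_le norm_unhalf ?zj ?mulr0//=.
by apply: le_trans (norm_coord _ j); rewrite mxE eqxx zj mulr0 sub0r normrN sg_abs.
Qed.

Lemma norm_half_lt (mu : R) j b x : 0 < mu < 1 -> `|x| <= 1 -> `|half j b (mu *: x)| < 1.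
Proof.
move=> /andP[m0 m1] x1; apply: norm_lt => // l; have := le_trans (norm_coord x l) x1.
rewrite !mxE ler_norml => /andP[h1 h2]; case: eqP => _; rewrite ltr_norml; last by nra.
by case: b; rewrite /sg; apply/andP; split; nra.
Qed.

(** Three collars fill the holed cube. The shell [mu <= |x| <= 1] carries the homotopy from [f0] to
    [f1]; inside it each half, blown up to a full cube by [unhalf], is a shell around its hole and
    carries the homotopy from [G b] to [f b]. The last two hypotheses say that the halves fit the
    outer shell and agree on the wall [x_j = 0]. *)
Lemma assemble (W : normedModType R) (Y : set W) (mu : R) j (f0 f1 : 'rV[R]_d -> W)
    (G f : bool -> 'rV[R]_d -> W) :
  0 < mu < 1 -> htpy (sup_sphere 'rV[R]_d) Y f0 f1 ->
  (forall b, htpy (sup_sphere 'rV[R]_d) Y (G b) (f b)) ->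
  (forall b z, `|z| = 1 -> 0 <= sg R b * z 0 j -> f1 z = G b (unhalf j b z)) ->
  (forall z, `|z| <= 1 -> z 0 j = 0 -> G false (unhalf j false z) = G true (unhalf j true z)) ->
  exists F : 'rV[R]_d -> W, [/\ cont_on (holed mu j) F, forall x, holed mu j x -> Y (F x),
    forall x, `|x| = 1 -> F x = f0 x & forall b x, `|x| = 1 -> F (hole mu j b x) = f b x].
Proof.
move=> mu01 H0 HG fG GG; have /andP[m0 m1] := mu01.
have mn0 : mu != 0 by rewrite gt_eqF.
have [I0 [c0 Y0 I01 I0m]] := htpy_shell mu01 H0.
have /choice[I HI] : forall b, exists I : 'rV[R]_d -> W,
    [/\ cont_on [set z | mu <= `|z| <= 1] I,
    forall z, mu <= `|z| <= 1 -> Y (I z), forall z, `|z| = 1 -> I z = G b z &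
    forall z, `|z| = 1 -> I (mu *: z) = f b z] by move=> b; exact: htpy_shell (HG b).
pose J b x := I b (unhalf j b (mu^-1 *: x)).
have un b x : holed mu j x -> `|x| <= mu -> 0 <= sg R b * x 0 j ->
    mu <= `|unhalf j b (mu^-1 *: x)| <= 1.
  move=> [x1 xb] xm sx; apply/andP; split.
    have := xb b; rewrite normrZ gtr0_norm ?invr_gt0// mulrC ler_pdivlMr// mul1r//.
  apply: norm_unhalf; first by rewrite normrZ gtr0_norm ?invr_gt0// mulrC ler_pdivrMr// mul1r.
  by rewrite mxE mulrCA mulr_ge0// invr_ge0 ltW.
have cJ b : cont_on [set x | [/\ holed mu j x, `|x| <= mu & 0 <= sg R b * x 0 j]] (J b).
  have [cI _ _ _] := HI b.
  apply: (cont_on_comp (S' := [set z | mu <= `|z| <= 1])) cI => [|x [h1 h2 h3]]; last exact: un.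
  apply: cont_on_unhalf; apply: cont_onZ; [exact: cont_on_cst|exact: cont_on_id].
pose F x := if mu - `|x| <= 0 then I0 x else if x 0 j <= 0 then J false x else J true x.
have cn S : cont_on S (fun x : 'rV[R]_d => mu - `|x|).
  by apply: cont_onBr; [exact: cont_on_cst|apply: cont_on_norm; exact: cont_on_id].
have Jx x b : `|x| = mu -> 0 <= sg R b * x 0 j -> J b x = I0 x.
  move=> xm sx; pose z := mu^-1 *: x.
  have xE : x = mu *: z by rewrite scalerA divff// scale1r.
  have z1 : `|z| = 1 by rewrite normrZ xm gtr0_norm ?invr_gt0// mulVf.
  have sz : 0 <= sg R b * z 0 j by rewrite mxE mulrCA mulr_ge0// invr_ge0 ltW.
  have [_ _ I1 _] := HI b.
  by rewrite xE I0m// (fG b z)// /J scalerA mulVf// scale1r I1// norm_unhalf1.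
exists F; split.
- apply: cont_on_glue => //.
  + apply: cont_on_sub c0 => x [[x1 _] /= h]; rewrite x1 andbT; lra.
  + apply: cont_on_glue.
    * by apply: cont_on_coord; exact: cont_on_id.
    * apply: cont_on_sub (cJ false) => x [[hx /= h] h2]; split=> //; first by rewrite -subr_ge0.
      by rewrite /sg mulN1r oppr_ge0.
    * apply: cont_on_sub (cJ true) => x [[hx /= h] h2]; split=> //; first by rewrite -subr_ge0.
      by rewrite /sg mul1r.
    * move=> x [hx /= h] xj; have [_ _ I1 _] := HI false; have [_ _ I2 _] := HI true.
      have z1 : `|mu^-1 *: x| <= 1.
        by rewrite normrZ gtr0_norm ?invr_gt0// mulrC ler_pdivrMr// mul1r -subr_ge0.
      have zj : (mu^-1 *: x) 0 j = 0 by rewrite mxE xj mulr0.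
      by rewrite /J I1 ?norm_unhalf0// I2 ?norm_unhalf0// GG.
  + move=> x hx /eqP; rewrite subr_eq0 => /eqP /esym xm.
    case: leP => xj; rewrite Jx// /sg ?mulN1r ?oppr_ge0// mul1r ltW//.
- move=> x hx; rewrite /F; case: leP => h.
    by apply: Y0; have [x1 _] := hx; rewrite x1 andbT -subr_le0.
  have xm : `|x| <= mu by rewrite -subr_ge0 ltW.
  case: leP => xj; [have [_ YI _ _] := HI false|have [_ YI _ _] := HI true]; apply: YI; apply: un => //.
    by rewrite /sg mulN1r oppr_ge0.
  by rewrite /sg mul1r ltW.
- by move=> x x1; rewrite /F x1 subr_le0 ltW// I01.
- move=> b x x1; have [_ _ _ If] := HI b.
  have hl : `|half j b (mu *: x)| < 1 by apply: norm_half_lt => //; rewrite x1.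
  have yl : `|hole mu j b x| < mu by rewrite /hole normrZ gtr0_norm// gtr_pMr.
  have JE : J b (hole mu j b x) = f b x.
    by rewrite /J /hole scalerA mulVf// scale1r halfK If.
  rewrite /F subr_le0 leNgt yl /=.
  have xj : `|mu * x 0 j| < 1.
    rewrite normrM gtr0_norm//; apply: (@le_lt_trans _ _ mu) => //.
    apply: ler_piMr; first exact: ltW.
    by have := norm_coord x j; rewrite x1.
  have yj : hole mu j b x 0 j = mu * ((mu * x 0 j + sg R b) / 2) by rewrite !mxE eqxx.
  move: xj; rewrite ltr_norml => /andP[a1 a2].
  case: b JE yj {hl yl If}; rewrite /sg => JE yj.
    by rewrite leNgt yj mulr_gt0//; lra.
  by rewrite ifT// yj pmulr_rle0//; lra.
Qed.
End Assemble.

(** * Quarter turns of the coordinates *)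

Section Rotation.
Variables (R : realType) (d : nat) (p : 'I_d).
Implicit Types (i : 'I_d) (y : 'rV[R]_d).

(** A quarter turn in the plane of the axes [i] and [p], the identity if they coincide. The sign is
    essential: a plain swap of two coordinates is not homotopic to the identity of the sphere. *)
Definition rot i y : 'rV[R]_d := \row_l if l == i then y 0 p else if l == p then - y 0 i else y 0 l.
Definition unrot i y : 'rV[R]_d := \row_l if l == p then y 0 i else if l == i then - y 0 p else y 0 l.

Lemma rotK i : cancel (rot i) (unrot i).
Proof.
move=> y; apply/rowP => l; rewrite !mxE eqxx; case: (eqVneq l p) => [->//|lp].
case: (eqVneq l i) => // li; rewrite -li eq_sym (negbTE lp) eqxx.
by rewrite opprK.
Qed.

Lemma unrotK i : cancel (unrot i) (rot i).
Proof.
move=> y; apply/rowP => l; rewrite !mxE eqxx; case: (eqVneq l i) => [->//|li].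
case: (eqVneq l p) => // lp; rewrite -lp eq_sym (negbTE li) eqxx.
by rewrite opprK.
Qed.

Lemma unrotZ i a y : unrot i (a *: y) = a *: unrot i y.
Proof. by apply/rowP => l; rewrite !mxE; case: ifP => // _; case: ifP => // _; rewrite mulrN. Qed.

Lemma rotB i x y : rot i (x - y) = rot i x - rot i y.
Proof. by apply/rowP => l; rewrite !mxE; case: ifP => // _; case: ifP => // _; rewrite opprD. Qed.

Lemma unrotB i x y : unrot i (x - y) = unrot i x - unrot i y.
Proof. by apply/rowP => l; rewrite !mxE; case: ifP => // _; case: ifP => // _; rewrite opprD. Qed.

Lemma norm_rot_le i y : `|rot i y| <= `|y|.
Proof.
apply: norm_le => // l; rewrite mxE.
by case: ifP => _; [|case: ifP => _]; rewrite ?normrN norm_coord.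
Qed.

Lemma norm_unrot_le i y : `|unrot i y| <= `|y|.
Proof.
apply: norm_le => // l; rewrite mxE.
by case: ifP => _; [|case: ifP => _]; rewrite ?normrN norm_coord.
Qed.

Lemma norm_rot i y : `|rot i y| = `|y|.
Proof. by apply/eqP; rewrite eq_le norm_rot_le -{1}(rotK i y) norm_unrot_le. Qed.

Lemma norm_unrot i y : `|unrot i y| = `|y|.
Proof. by apply/eqP; rewrite eq_le norm_unrot_le -{1}(unrotK i y) norm_rot_le. Qed.

Lemma enorm_unrot i y : enorm (unrot i y) = enorm y.
Proof.
rewrite /enorm; congr Num.sqrt; have [ip|ip] := eqVneq i p.
  by apply: eq_bigr => l _; rewrite mxE ip; case: eqP => // ->.
rewrite (bigD1 p)//= (bigD1 i)//= [RHS](bigD1 i)//= [X in _ = _ + X](bigD1 p)//= 1?eq_sym//.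
rewrite !mxE eqxx (negbTE ip) eqxx sqrrN; congr (_ + (_ + _)).
rewrite (eq_bigl (fun l => (l != i) && (l != p))) => [|l]; last by rewrite andbC.
by apply: eq_bigr => l /andP[li lp]; rewrite mxE (negbTE li) (negbTE lp).
Qed.

Lemma enorm_rot i y : enorm (rot i y) = enorm y.
Proof. by rewrite -(enorm_unrot i) rotK. Qed.

Lemma rad_unrot i y : rad (unrot i y) = unrot i (rad y).
Proof. by rewrite /rad enorm_unrot unrotZ. Qed.

Lemma cubify_unrot i y : cubify (unrot i y) = unrot i (cubify y).
Proof. by rewrite /cubify norm_unrot unrotZ. Qed.

Lemma unrot_half i b y : unrot i (half i b y) = half p b (unrot i y).
Proof.
apply/rowP => l; rewrite !mxE eqxx; case: (eqVneq l p) => [//|lp].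
by case: (eqVneq l i) => // li; rewrite -li eq_sym (negbTE lp).
Qed.

Lemma unrot_hole mu i b y : unrot i (hole mu i b y) = hole mu p b (unrot i y).
Proof. by rewrite /hole unrotZ unrot_half unrotZ. Qed.

Lemma unrot_unhalf i b y : unrot i (unhalf i b y) = unhalf p b (unrot i y).
Proof. by rewrite -{2}(unhalfK i b y) unrot_half halfK. Qed.

Lemma unrot_unhole mu i b y : unrot i (unhole mu i b y) = unhole mu p b (unrot i y).
Proof. by rewrite /unhole unrotZ unrot_unhalf unrotZ. Qed.

Lemma cont_on_unrot (T : topologicalType) (S : set T) (f : T -> 'rV[R]_d) i : cont_on S f ->
  cont_on S (fun x => unrot i (f x)).
Proof.
move=> cf; have cf' l : cont_on S (fun x => f x 0 l) by exact: cont_on_coord.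
apply: cont_on_row => l; under eq_fun do rewrite mxE.
case: (l == _); first exact: cf'.
case: (l == _); last exact: cf'.
by move=> x Sx; apply: cvgN; exact: cf'.
Qed.

Lemma cont_on_rot (T : topologicalType) (S : set T) (f : T -> 'rV[R]_d) i : cont_on S f ->
  cont_on S (fun x => rot i (f x)).
Proof.
move=> cf; have cf' l : cont_on S (fun x => f x 0 l) by exact: cont_on_coord.
apply: cont_on_row => l; under eq_fun do rewrite mxE.
case: (l == _); first exact: cf'.
case: (l == _); last exact: cf'.
by move=> x Sx; apply: cvgN; exact: cf'.
Qed.

Lemma unrot_neqN i y : y != 0 -> unrot i y <> - y.
Proof.
move=> y0 E; case/eqP: y0; have El l := congr1 (fun v : 'rV[R]_d => v 0 l) E.
have yl l : l != i -> l != p -> y 0 l = 0.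
  by move=> li lp; have := El l; rewrite !mxE (negbTE li) (negbTE lp); lra.
have [ip|ip] := eqVneq i p.
  apply/rowP => l; rewrite mxE; have [lp|lp] := eqVneq l p; last by rewrite yl// ip.
  by have := El l; rewrite !mxE lp eqxx ip; lra.
have := El i; have := El p; rewrite !mxE !eqxx (negbTE ip) => h1 h2.
apply/rowP => l; rewrite mxE; have [->|lp] := eqVneq l p; first lra.
by have [->|li] := eqVneq l i; [lra|rewrite yl].
Qed.
End Rotation.

Section RotHtpy.
Variables (R : realType) (d : nat) (p : 'I_d.+1).

Lemma htpy_unrot i : htpy (sphere d) (sphere d) (fun x : 'rV[R]_d.+1 => x) (unrot p i).
Proof.
apply: htpy_sphere => //.
- exact: cont_on_id.
- by apply: cont_on_unrot; exact: cont_on_id.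
- by move=> x x1; rewrite /sphere /= enorm_unrot.
- move=> x /sphere_neq0 x0 E; apply: (@unrot_neqN R _ p i x x0).
  by rewrite [in RHS]E opprK.
Qed.

Lemma htpy_rot i : htpy (sphere d) (sphere d) (fun x : 'rV[R]_d.+1 => x) (rot p i).
Proof.
have c1 : cont_on (sphere d) (fun x : 'rV[R]_d.+1 => rot p i x) by apply: cont_on_rot; exact: cont_on_id.
have c2 (x : 'rV[R]_d.+1) : sphere d x -> sphere d (rot p i x).
  by move=> x1; rewrite /sphere /= enorm_rot.
apply: htpy_sym; apply: htpy_eq (htpy_pre c1 c2 (htpy_unrot i)) => // x _.
by rewrite rotK.
Qed.
End RotHtpy.

Section Filling.
Variables (R : realType) (k n : nat).
Local Notation dom := ('rV[R]_(1 + k.+1)).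
Local Notation cod := ('rV[R]_(1 + n.+1)).
Local Notation o1 := (snd_ord k).
Local Notation ho1 := (snd_ord n).

(** Admitting any [b] freely homotopic to [beta] makes room for the turned copies of [beta] that
    serve the other halving directions. *)
Lemma punctured_filling (beta b : dom -> cod) (mu : R) : cond_star (k := k.+1) (n := n.+1) beta ->
  htpy (sphere k.+1) (sphere n.+1) b beta -> 0 < mu < 1 ->
  exists F : dom -> cod, [/\ cont_on (holed mu o1) F,
    forall x, holed mu o1 x -> @off_poles R n (F x),
    forall x, `|x| = 1 -> F x = cubify (b (rad x)) &
    forall c x, `|x| = 1 -> F (hole mu o1 c x) = half ho1 c (cubify (b (rad x)))].
Proof.
move=> /(_ 2%N isT)[beta' [/cont_onP cb' [b'S [b'spt [fh HH]]]]] bb mu01.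
have bb' : htpy (sphere k.+1) (sphere n.+1) b beta'.
  apply: htpy_trans bb _; have [H [/cont_onP h1 [h2 h3]]] := fh.
  by exists H; split.
have [s sP] := pinch_exists R n.
have H0 := outer_htpy cb' b'S b'spt bb' sP (HH s sP).
pose fs j : 'rV[R]_k.+1 -> cod := Defs.incl n.+1 j \o beta' \o collapse k.+1.
(* The part of the pinched sum in the upper half of the domain, including its constant tail. *)
pose gp (u : 'rV[R]_k.+1) : cod :=
  if u 0 ord0 <= 0 then pinch_map (fs 1%N (tocube (setc0 u (2 * u 0 ord0 + 1)))) else 0.
pose G c : dom -> cod := face_ext 0 (if c then gp else fun u => pinch_map (fs 0%N (tocube u))).
have HG c : htpy (sup_sphere dom) (@off_poles R n) (G c) (fun y => half ho1 c (cubify (b (rad y)))).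
  case: c.
    apply: htpy_trans (inner_htpy cb' b'S bb' true).
    exact: (stretch_htpy cb' b'S b'spt).
  apply: (htpy_eq _ (fun _ _ => erefl) (inner_htpy cb' b'S bb' false)) => y _.
  by rewrite /G (@face_ext_pole _ _ _ beta' b'S b'spt 0).
have fb j (u : 'rV[R]_k.+1) : `|u| = 1 -> pinch_map (fs j (tocube u)) = 0.
  by move=> u1; rewrite (fs_bd b'spt j u1 : fs j _ = 0) qmap0.
have rs c (z : dom) : rsubmx (unhalf o1 c z) = setc0 (rsubmx z) (2 * rsubmx z 0 ord0 - sg R c).
  apply/rowP => l; have [->|l0] := eqVneq l ord0; first by rewrite setc0_hd !mxE.
  by rewrite setc0_tl// !mxE (rshift_o1 l0).
have hdE c (z : dom) : (unhalf o1 c z) 0 ord0 = z 0 ord0 by rewrite mxE.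
have o1E (z : dom) : z 0 o1 = rsubmx z 0 ord0 by rewrite mxE.
apply: (assemble mu01 H0 HG).
- move=> c z z1 sz; rewrite /G /face_ext hdE; case: ifP => // _.
  rewrite cube_sum2E rs -o1E; case: c sz; rewrite /sg ?mul1r ?mulN1r ?oppr_ge0 => sz.
    have setc0E (u : 'rV[R]_k.+1) s' t : setc0 (setc0 u s') t = setc0 u t.
      by apply/rowP => l; rewrite !mxE; case: ifP => [//|->].
    rewrite /gp setc0_hd setc0E.
    have -> : (2 * z 0 o1 - 1 <= 0) = (z 0 o1 <= 2^-1) by apply/idP/idP; lra.
    have -> : 2 * (2 * z 0 o1 - 1) + 1 = 4 * z 0 o1 - 1 by ring.
    (* [cube_sum2E] assigns the wall to the first summand; at that place both summands have reached
       their base value 0. *)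
    case: ifP => [h|_]; last by case: ifP => // _; rewrite qmap0.
    have -> : z 0 o1 = 0 by apply/eqP; rewrite eq_le h sz.
    rewrite ifT; last by lra.
    have n1 : `|rsubmx z| <= 1 by rewrite -z1 norm_rsubmx.
    rewrite !fb//; apply: norm_setc0_bd => //.
    - by rewrite mulr0 add0r normr1.
    - by left; rewrite mulr0 add0r normr1.
    - by rewrite mulr0 sub0r normrN1.
    - by left; rewrite mulr0 sub0r normrN1.
  by rewrite sz opprK.
- move=> z z1 z0; rewrite /G /face_ext !hdE; case: ifP => // _; rewrite !rs -o1E z0 mulr0 /sg.
  have n1 : `|rsubmx z| <= 1 by apply: le_trans z1; exact: norm_rsubmx.
  have h1 : 0 - -1 = 1 :> R by ring.
  have h2 : 0 - 1 = -1 :> R by ring.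
  have h3 : 2 * -1 + 1 = -1 :> R by ring.
  rewrite h1 h2 fb; last first.
    by apply: norm_setc0_bd => //; rewrite normr1; [|left].
  rewrite /gp setc0_hd ifT; last by lra.
  rewrite h3 fb//; apply: norm_setc0_bd; rewrite ?normrN1//; last by left.
  by apply: norm_setc0 => //; rewrite normrN1.
Qed.

(** Quarter turns in domain and target keep [beta] in its free homotopy class, so the case of the
    second axes yields all [i] and [j]. The turn of the domain cancels on composing with [unrot];
    that of the target stays visible in the boundary values. *)
Lemma punctured_filling_rot (beta : dom -> cod) (mu : R) i j : cond_star (k := k.+1) (n := n.+1) beta ->
  (forall x, sphere k.+1 x -> sphere n.+1 (beta x)) -> 0 < mu < 1 ->
  exists F : dom -> cod, [/\ cont_on (holed mu j) F,
    forall x, holed mu j x -> @off_poles R n (F x),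
    forall x, `|x| = 1 -> F x = cubify (unrot ho1 i (beta (rad x))) &
    forall c x, `|x| = 1 -> F (hole mu j c x) = half ho1 c (cubify (unrot ho1 i (beta (rad x))))].
Proof.
move=> cs bS mu01.
have cb : cont_on (sphere k.+1) beta.
  (* Any instance of ( * ) yields the continuity of [beta], as one end of a homotopy. *)
  have [b' [_ [_ [_ [[H [/cont_onP h1 [h2 h3]]] _]]]]] := cs 1%N isT.
  have : htpy (sphere k.+1) (sphere n.+1) beta b' by exists H; split.
  by move/htpy_contl => [].
pose b (x : dom) : cod := unrot ho1 i (beta (rot o1 j x)).
have bb : htpy (sphere k.+1) (sphere n.+1) b beta.
  apply: (@htpy_trans _ _ _ _ _ _ (fun x => beta (rot o1 j x))).
    have c1 : cont_on (sphere k.+1) (fun x : dom => beta (rot o1 j x)).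
      apply: (cont_on_comp (S' := sphere k.+1)) cb => [|x x1].
        by apply: cont_on_rot; exact: cont_on_id.
      by rewrite /sphere /= enorm_rot.
    have c2 (x : dom) : sphere k.+1 x -> sphere n.+1 (beta (rot o1 j x)).
      by move=> x1; apply: bS; rewrite /sphere /= enorm_rot.
    by apply: htpy_sym; exact: (htpy_pre c1 c2 (@htpy_unrot R _ ho1 i)).
  by apply: htpy_sym; apply: (htpy_post cb bS); exact: htpy_rot.
have [F [cF FY F1 Fh]] := punctured_filling cs bb mu01.
have hS x : holed mu j x -> holed mu o1 (unrot o1 j x).
  move=> [x1 xb]; split; first by rewrite norm_unrot.
  by move=> c; rewrite -unrot_unhole norm_unrot.
have bE x : b (rad (unrot o1 j x)) = unrot ho1 i (beta (rad x)).
  by rewrite /b rad_unrot unrotK.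
exists (fun x => F (unrot o1 j x)); split.
- by apply: (cont_on_comp _ hS cF); apply: cont_on_unrot; exact: cont_on_id.
- by move=> x /hS/FY.
- by move=> x x1; rewrite F1 ?norm_unrot// bE.
- by move=> c x x1; rewrite unrot_hole Fh ?norm_unrot// bE.
Qed.
End Filling.

(** * Retraction onto the boundary of the two half cubes *)

Section BoxRetract.
Variables (R : realType) (d : nat) (lo hi : 'I_d -> R) (p : 'rV[R]_d).
Hypothesis lop : forall l, lo l < p 0 l.
Hypothesis phi : forall l, p 0 l < hi l.
Implicit Types y z : 'rV[R]_d.

(** The Minkowski functional of the box [[lo, hi]] as seen from its interior point [p]. *)
Definition gauge z : R :=
  \big[Num.max/0]_(l < d) Num.max (z 0 l / (hi l - p 0 l)) (- z 0 l / (p 0 l - lo l)).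

(** Pushes the box away from [p] onto its boundary and fixes everything outside, so that maps for
    the two half cubes can be composed. *)
Definition rbox y : 'rV[R]_d := p + (Num.min 1 (gauge (y - p)))^-1 *: (y - p).

Let al l : 0 < hi l - p 0 l. Proof. by rewrite subr_gt0. Qed.
Let be l : 0 < p 0 l - lo l. Proof. by rewrite subr_gt0. Qed.

Lemma gauge_ge0 z : 0 <= gauge z.
Proof. exact: bigmax_ge_id. Qed.

Lemma gauge_ge z l : Num.max (z 0 l / (hi l - p 0 l)) (- z 0 l / (p 0 l - lo l)) <= gauge z.
Proof. by apply: (le_bigmax _ (fun l => Num.max (z 0 l / (hi l - p 0 l)) (- z 0 l / (p 0 l - lo l)))). Qed.

Lemma gaugeZ a z : 0 <= a -> gauge (a *: z) = a * gauge z.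
Proof.
move=> a0; rewrite /gauge; elim/big_rec2: _ => [|l x y _ ->]; first by rewrite mulr0.
by rewrite !maxr_pMr// !mxE !mulrA mulrN.
Qed.

Lemma gauge_le1P y : gauge (y - p) <= 1 <-> forall l, lo l <= y 0 l <= hi l.
Proof.
split=> [g1 l|H].
  have := le_trans (gauge_ge (y - p) l) g1; rewrite ge_max !mxE => /andP[].
  by rewrite ler_pdivrMr// mul1r ler_pdivrMr// mul1r => h1 h2; apply/andP; split; lra.
apply: bigmax_le => // l _; rewrite ge_max !mxE !ler_pdivrMr// !mul1r.
by have /andP[h1 h2] := H l; apply/andP; split; lra.
Qed.

Lemma gauge_ge1 y l : y 0 l <= lo l \/ hi l <= y 0 l -> 1 <= gauge (y - p).
Proof.
move=> H; apply: le_trans (gauge_ge _ l); rewrite le_max !mxE !ler_pdivlMr// !mul1r.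
by case: H => h; apply/orP; [right|left]; lra.
Qed.

Lemma gauge_eq1 y : (0 < d)%N -> gauge (y - p) = 1 -> exists l, y 0 l = lo l \/ y 0 l = hi l.
Proof.
move=> d0 g1; have /gauge_le1P yb : gauge (y - p) <= 1 by rewrite g1.
apply: contrapT => H; suff : gauge (y - p) < 1 by rewrite g1 ltxx.
apply: bigmax_lt => // l _; rewrite gt_max !mxE !ltr_pdivrMr// !mul1r.
have /andP[h1 h2] := yb l.
have h3 : y 0 l != lo l by apply/eqP => E; apply: H; exists l; left.
have h4 : y 0 l != hi l by apply/eqP => E; apply: H; exists l; right.
have h5 : lo l < y 0 l by rewrite lt_neqAle eq_sym h3.
have h6 : y 0 l < hi l by rewrite lt_neqAle h4.
by apply/andP; split; lra.
Qed.

Lemma gauge_gt (K : R) z : (forall l, hi l - p 0 l <= K) -> (forall l, p 0 l - lo l <= K) ->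
  `|z| <= K * gauge z.
Proof.
move=> hK lK; have [d0|dn] := eqVneq d 0%N.
  have : `|z| <= 0 by apply: norm_le => // i; move: (ltn_ord i); rewrite [X in (_ < X)%N]d0.
  rewrite normr_le0 => /eqP ->.
  by rewrite normr0 -(scale0r (0 : 'rV[R]_d)) gaugeZ// mul0r mulr0.
have l0 : 'I_d by apply: (@Ordinal _ 0); rewrite lt0n.
have K0 : 0 <= K by apply: le_trans (hK l0); exact: ltW.
apply: norm_le => [|l]; first by rewrite mulr_ge0// gauge_ge0.
have := gauge_ge z l; rewrite ge_max !ler_pdivrMr// => /andP[h1 h2].
have g0 := gauge_ge0 z; rewrite ler_norml; apply/andP; split.
  by have := ler_wpM2l g0 (lK l); rewrite [K * _]mulrC; lra.
by have := ler_wpM2l g0 (hK l); rewrite [K * _]mulrC; lra.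
Qed.

Lemma rbox_id y : 1 <= gauge (y - p) -> rbox y = y.
Proof. by move=> g1; rewrite /rbox min_l// invr1 scale1r addrC subrK. Qed.

Lemma rbox_gauge y : 0 < gauge (y - p) -> 1 <= gauge (rbox y - p).
Proof.
move=> g0; have [g1|g1] := leP 1 (gauge (y - p)); first by rewrite rbox_id.
rewrite /rbox addrC addKr gaugeZ; last by rewrite invr_ge0 le_min ler01 ltW.
have gn0 : gauge (y - p) != 0 by rewrite gt_eqF.
by rewrite min_r; [rewrite mulVf|exact: ltW].
Qed.

Lemma rbox_in y : 0 < gauge (y - p) -> gauge (y - p) <= 1 -> gauge (rbox y - p) = 1.
Proof.
move=> g0 g1; rewrite /rbox addrC addKr min_r// gaugeZ ?invr_ge0 ?ltW//.
by rewrite mulVf// gt_eqF.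
Qed.
End BoxRetract.

(** * Bounded Lipschitz functions that are differentiable almost everywhere *)

Section Nice.
Variables (R : realType) (d : nat) (U Om : set 'rV[R]_d.+1).
Implicit Types f g : 'rV[R]_d.+1 -> R.

(** Boundedness is included because products of Lipschitz functions need it to be Lipschitz. *)
Definition nice f :=
  [/\ exists2 K : R, 0 <= K & forall x y, U x -> U y -> `|f x - f y| <= K * `|x - y|,
   exists2 M : R, 0 <= M & forall x, U x -> `|f x| <= M & adiff Om f].

Lemma nice_cst c : nice (fun=> c).
Proof.
split; last exact: adiff_cst.
  by exists 0 => // x y _ _; rewrite subrr normr0 mul0r.
by exists (`|c|).
Qed.

Lemma niceD f g : nice f -> nice g -> nice (fun x => f x + g x).
Proof.
move=> [[K K0 HK] [M M0 HM] af] [[K' K0' HK'] [M' M0' HM'] ag]; split.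
- exists (K + K') => [|x y Ux Uy]; first exact: addr_ge0.
  have -> : f x + g x - (f y + g y) = (f x - f y) + (g x - g y) by ring.
  by rewrite mulrDl (le_trans (ler_normD _ _))// lerD// ?HK ?HK'.
- exists (M + M') => [|x Ux]; first exact: addr_ge0.
  by rewrite (le_trans (ler_normD _ _))// lerD// ?HM ?HM'.
- exact: adiffD.
Qed.

Lemma niceM f g : nice f -> nice g -> nice (fun x => f x * g x).
Proof.
move=> [[K K0 HK] [M M0 HM] af] [[K' K0' HK'] [M' M0' HM'] ag]; split.
- exists (K * M' + M * K') => [|x y Ux Uy]; first by rewrite addr_ge0// mulr_ge0.
  have -> : f x * g x - f y * g y = (f x - f y) * g x + f y * (g x - g y) by ring.
  apply: le_trans (ler_normD _ _) _; rewrite !normrM mulrDl.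
  apply: lerD; first by rewrite mulrAC ler_pM// ?HK ?HM'.
  by rewrite -mulrA ler_pM// ?HM ?HK'.
- exists (M * M') => [|x Ux]; first exact: mulr_ge0.
  by rewrite normrM ler_pM// ?HM ?HM'.
- exact: adiffM.
Qed.

Lemma niceN f : nice f -> nice (fun x => - f x).
Proof.
move=> nf; have [h1 h2 h3] := niceM (nice_cst (-1)) nf.
split; [case: h1 => K K0 H; exists K => // x y Ux Uy|case: h2 => M M0 H; exists M => // x Ux|exact: adiffN (let: And3 _ _ a := nf in a)].
  by have := H x y Ux Uy; rewrite !mulN1r.
by have := H x Ux; rewrite mulN1r.
Qed.

Lemma niceB f g : nice f -> nice g -> nice (fun x => f x - g x).
Proof. by move=> nf ng; apply: niceD => //; exact: niceN. Qed.

Lemma nice_norm f : nice f -> nice (fun x => `|f x|).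
Proof.
move=> [[K K0 HK] [M M0 HM] af]; split.
- exists K => // x y Ux Uy; exact: le_trans (ler_dist_dist _ _) (HK x y Ux Uy).
- by exists M => // x Ux; rewrite normr_id; exact: HM.
- exact: adiff_norm.
Qed.

Lemma nice_eq f g : f =1 g -> nice f -> nice g.
Proof. by move=> /funext ->. Qed.

Lemma nice_max f g : nice f -> nice g -> nice (fun x => Num.max (f x) (g x)).
Proof.
move=> nf ng; apply: (@nice_eq (fun x => 2^-1 * (f x + g x + `|f x - g x|))).
  by move=> x; rewrite maxr_absE mulrC.
by apply: niceM (nice_cst _) (niceD (niceD nf ng) (nice_norm (niceB nf ng))).
Qed.

Lemma nice_min f g : nice f -> nice g -> nice (fun x => Num.min (f x) (g x)).
Proof.
move=> nf ng; apply: (@nice_eq (fun x => 2^-1 * (f x + g x - `|f x - g x|))).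
  by move=> x; rewrite minr_absE mulrC.
by apply: niceM (nice_cst _) (niceB (niceD nf ng) (nice_norm (niceB nf ng))).
Qed.

Lemma nice_bigmax (I : Type) (s : seq I) c (F : I -> 'rV[R]_d.+1 -> R) :
  (forall i, nice (F i)) -> nice (fun x => \big[Num.max/c]_(i <- s) F i x).
Proof.
move=> nF; elim: s => [|i s IH].
  by under eq_fun do rewrite big_nil; exact: nice_cst.
by under eq_fun do rewrite big_cons; exact: nice_max.
Qed.

Lemma niceV f (e : R) : Om `<=` U -> 0 < e -> (forall x, U x -> e <= f x) -> nice f ->
  nice (fun x => (f x)^-1).
Proof.
move=> OmU e0 fe [[K K0 HK] [M M0 HM] af].
have f0 x : U x -> 0 < f x by move=> /fe; exact: lt_le_trans.
have fi x : U x -> (f x)^-1 <= e^-1 by move=> Ux; rewrite lef_pV2 ?posrE ?f0// fe.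
split.
- exists (e^-1 * K * e^-1) => [|x y Ux Uy]; first by rewrite !mulr_ge0// invr_ge0 ltW.
  have -> : (f x)^-1 - (f y)^-1 = (f x)^-1 * (f y - f x) * (f y)^-1.
    by field; rewrite !gt_eqF ?f0.
  rewrite !normrM !(gtr0_norm (_ : 0 < (f _)^-1)) ?invr_gt0 ?f0//.
  rewrite [_ * e^-1 * _]mulrAC ler_pM// ?fi// ?mulr_ge0 ?invr_ge0 ?(ltW (f0 _ _))// -mulrA.
  by rewrite ler_pM// ?fi// ?invr_ge0 ?(ltW (f0 _ _))// distrC HK.
- exists e^-1 => [|x Ux]; first by rewrite invr_ge0 ltW.
  by rewrite gtr0_norm ?invr_gt0 ?f0// fi.
- by apply: adiffV => // x /OmU /f0 fx; rewrite gt_eqF.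
Qed.

Lemma nice_rbox n (lo hi : 'I_n -> R) (p : 'rV[R]_n) (F : 'rV[R]_d.+1 -> 'rV[R]_n) (e : R) :
  Om `<=` U -> 0 < e -> (forall x, U x -> e <= gauge lo hi p (F x - p)) ->
  (forall l, nice (fun x => F x 0 l)) -> forall l, nice (fun x => rbox lo hi p (F x) 0 l).
Proof.
move=> OmU e0 ge nF l.
have nz i : nice (fun x => (F x - p) 0 i).
  apply: (@nice_eq (fun x => F x 0 i - p 0 i)) => [x|]; first by rewrite !mxE.
  by apply: niceB => //; exact: nice_cst.
have ng : nice (fun x => gauge lo hi p (F x - p)).
  apply: nice_bigmax => i; apply: nice_max; apply: niceM; rewrite //; try exact: nice_cst.
  exact: niceN.
apply: (@nice_eq (fun x => p 0 l + (Num.min 1 (gauge lo hi p (F x - p)))^-1 * (F x - p) 0 l)).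
  by move=> x; rewrite [RHS]mxE [in RHS]mxE.
apply: niceD; first exact: nice_cst.
apply: niceM => //; apply: (@niceV _ (Num.min 1 e)) => //.
- by rewrite lt_min ltr01.
- by move=> x Ux; rewrite le_min ge_min lexx /= ge_min ge// orbT.
- by apply: nice_min => //; exact: nice_cst.
Qed.
End Nice.

Lemma rowBE (R : realType) d (x y : 'rV[R]_d) l : (x - y) 0 l = x 0 l - y 0 l.
Proof. by rewrite !mxE. Qed.

Section Retract.
Variables (R : realType) (n : nat).
Local Notation cod := ('rV[R]_(1 + n.+1)).
Local Notation ho1 := (snd_ord n).
Implicit Types y : cod.

Definition blo (b : bool) (l : 'I_(1 + n.+1)) : R := if (l == ho1) && b then 0 else -1.
Definition bhi (b : bool) (l : 'I_(1 + n.+1)) : R := if (l == ho1) && ~~ b then 0 else 1.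
Definition clamp y : cod := \row_l Num.max (-1) (Num.min 1 (y 0 l)).
Definition hrbox b y : cod := rbox (blo b) (bhi b) (pole R n b) y.
Definition hgauge b y : R := gauge (blo b) (bhi b) (pole R n b) (y - pole R n b).
(** The two half cubes share only a wall, which both pushes fix, so neither push undoes the
    other. *)
Definition retract y : cod := hrbox true (hrbox false (clamp y)).

Lemma pole_coord b l : pole R n b 0 l = if l == ho1 then sg R b / 2 else if l == ord0 then 2^-1 else 0.
Proof. by rewrite mxE; have [->|lh] := eqVneq l ho1. Qed.

Lemma blo_pole b l : blo b l < pole R n b 0 l.
Proof.
rewrite pole_coord /blo; case: (l == ho1); case: b; rewrite /sg /=; try lra;
by case: (l == ord0); lra.
Qed.

Lemma pole_bhi b l : pole R n b 0 l < bhi b l.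
Proof.
rewrite pole_coord /bhi; case: (l == ho1); case: b; rewrite /sg /=; try lra;
by case: (l == ord0); lra.
Qed.

Lemma hgauge_norm b y : `|y - pole R n b| <= 2 * hgauge b y.
Proof.
apply: gauge_gt; [exact: blo_pole|exact: pole_bhi|move=> l|move=> l];
rewrite pole_coord /blo /bhi; case: (l == ho1); case: b; rewrite /sg /=; try lra;
by case: (l == ord0); lra.
Qed.

Lemma clamp_in y l : -1 <= clamp y 0 l <= 1.
Proof. by rewrite mxE le_max lexx /= ge_max ge_min lexx andbT; lra. Qed.

Lemma clamp_id y : `|y| <= 1 -> clamp y = y.
Proof.
move=> y1; apply/rowP => l; rewrite mxE; have := le_trans (norm_coord y l) y1.
by rewrite ler_norml => /andP[h1 h2]; rewrite min_r// max_r.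
Qed.

(** The coordinates of a pole lie in [[-1/2, 1/2]], so a coordinate that is cut off at 1 or -1
    remains at distance at least 1/2 from the pole. *)
Lemma clamp_dist b y (e : R) : e <= 2^-1 -> e <= `|y - pole R n b| ->
  e <= `|clamp y - pole R n b|.
Proof.
move=> e2; apply: contraTT; rewrite -!ltNge => H.
have e0 : 0 < e by apply: le_lt_trans H.
apply: norm_lt => // l; have := le_lt_trans (norm_coord _ l) H; rewrite !rowBE.
have : -2^-1 <= pole R n b 0 l <= 2^-1.
  rewrite pole_coord; case: (l == ho1); first by case: b {H}; rewrite /sg; apply/andP; split; lra.
  by case: (l == ord0); lra.
move=> /andP[p1 p2]; rewrite mxE !ltr_norml.
case: (leP 1 (y 0 l)) => h1.
  by rewrite max_r; lra.
by case: (leP (-1) (y 0 l)) => h2; lra.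
Qed.

Lemma hgauge_other b y : gauge (blo b) (bhi b) (pole R n b) (y - pole R n b) <= 1 ->
  1 <= hgauge (~~ b) y.
Proof.
move=> /(gauge_le1P (blo_pole b) (pole_bhi b)) /(_ ho1); rewrite /blo /bhi eqxx /= => /andP[h1 h2].
apply: (@gauge_ge1 _ _ _ _ _ (blo_pole (~~ b)) (pole_bhi (~~ b)) _ ho1).
rewrite /blo /bhi eqxx /= negbK.
by case: b h1 h2 => /= h1 h2; [right|left].
Qed.

(** A point that moves at all ends on the boundary of the lower half, where the gauge of the upper
    half is at least 1. *)
Lemma hrbox_other (e : R) y : e <= 1 -> 0 < hgauge false y -> e <= hgauge true y ->
  e <= hgauge true (hrbox false y).
Proof.
move=> e1 g0 ge; have [g1|g1] := leP 1 (hgauge false y).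
  by rewrite /hrbox rbox_id.
apply: le_trans e1 _; apply: (@hgauge_other false).
by rewrite (rbox_in g0)// ltW.
Qed.

Lemma hrbox_cube b y : 0 < hgauge b y -> (forall l, -1 <= y 0 l <= 1) ->
  forall l, -1 <= hrbox b y 0 l <= 1.
Proof.
move=> g0 yc; have [g1|g1] := leP 1 (hgauge b y); first by rewrite /hrbox rbox_id.
have : gauge (blo b) (bhi b) (pole R n b) (hrbox b y - pole R n b) <= 1.
  by rewrite (rbox_in g0)// ltW.
move=> /(gauge_le1P (blo_pole b) (pole_bhi b)) H l; have := H l.
by rewrite /blo /bhi; case: (l == ho1); case: b {g0 g1 H} => /=; lra.
Qed.

(** The result lies in the cube but in the interior of neither half, hence on the boundary of the
    half singled out by the sign of its second coordinate; the faces of that half are at -1, 0 and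
    1. *)
Lemma retract_coord y : 0 < hgauge false (clamp y) -> 0 < hgauge true (clamp y) ->
  exists l, [\/ retract y 0 l = -1, retract y 0 l = 0 | retract y 0 l = 1].
Proof.
move=> g0 g1; set y1 := hrbox false (clamp y).
have y1c l : -1 <= y1 0 l <= 1 by apply: hrbox_cube => //; exact: clamp_in.
have y1f : 1 <= hgauge false y1 by exact: rbox_gauge.
have y1t : 0 < hgauge true y1.
  have h : 0 < Num.min 1 (hgauge true (clamp y)) by rewrite lt_min ltr01.
  apply: lt_le_trans h _; apply: hrbox_other => //; first by rewrite ge_min lexx.
  by rewrite ge_min lexx orbT.
have y2c l : -1 <= retract y 0 l <= 1 by apply: hrbox_cube.
have y2t : 1 <= hgauge true (retract y) by exact: rbox_gauge.
have y2f : 1 <= hgauge false (retract y).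
  have [h|h] := leP 1 (hgauge true y1).
    by rewrite /retract -/y1 /hrbox rbox_id.
  by apply: (@hgauge_other true); rewrite (rbox_in y1t)// ltW.
pose b := 0 <= retract y 0 ho1.
have gb : hgauge b (retract y) = 1.
  apply/eqP; rewrite eq_le; apply/andP; split; last by case: b.
  apply/(gauge_le1P (blo_pole b) (pole_bhi b)) => l; have /andP[h1 h2] := y2c l.
  rewrite /blo /bhi; have [->|_] := eqVneq l ho1; last by rewrite /= h1 h2.
  rewrite /=.
  have /andP[h3 h4] := y2c ho1.
  by rewrite /b; case: (leP 0 (retract y 0 ho1)) => /= h5; apply/andP; split; lra.
have [l H] := gauge_eq1 (blo_pole b) (pole_bhi b) isT gb.
exists l; move: H; rewrite /blo /bhi.
by case: ifP => _; case: ifP => _ -[] ->; (exact: Or31 || exact: Or32 || exact: Or33).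
Qed.

Lemma retract_id y : `|y| <= 1 -> (forall b, 1 <= hgauge b y) -> retract y = y.
Proof. by move=> y1 g; rewrite /retract clamp_id// /hrbox (rbox_id (g false)) (rbox_id (g true)). Qed.

Lemma hgauge_cube b y : `|y| = 1 -> 1 <= hgauge b y.
Proof.
move=> /norm1_coord[l yl]; apply: (@gauge_ge1 _ _ _ _ _ (blo_pole b) (pole_bhi b) _ l).
rewrite /blo /bhi; have : y 0 l = 1 \/ y 0 l = -1.
  by case: (leP 0 (y 0 l)) => h; move: yl; [rewrite ger0_norm//; left|rewrite ltr0_norm//; right]; lra.
by case=> ->; [right|left]; case: ifP => _; lra.
Qed.

Lemma hgauge_half b c y : `|y| = 1 -> 1 <= hgauge b (half ho1 c y).
Proof.
move=> y1; have yh := norm_coord y ho1; rewrite y1 ler_norml in yh.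
have [bc|bc] := eqVneq b c; last first.
  apply: (@gauge_ge1 _ _ _ _ _ (blo_pole b) (pole_bhi b) _ ho1); rewrite mxE eqxx /blo /bhi eqxx /sg.
  by case: b c bc => -[] //= _; [left|right]; lra.
have [l yl] := norm1_coord y1; apply: (@gauge_ge1 _ _ _ _ _ (blo_pole b) (pole_bhi b) _ l).
have : y 0 l = 1 \/ y 0 l = -1.
  by case: (leP 0 (y 0 l)) => h; move: yl; [rewrite ger0_norm//; left|rewrite ltr0_norm//; right]; lra.
rewrite mxE /blo /bhi bc; case: (l == ho1) => /=; case: c {bc} => /=; rewrite /sg;
by case=> ->; [right|left]; lra.
Qed.
End Retract.

(** * The building block *)

Section SmoothRetract.
Variables (R : realType) (d n : nat).
Variables (U A : set 'rV[R]_d.+1).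
Hypotheses (cU : compact U) (cA : closed A) (AU : A `<=` U).

Lemma nice_lip m (g : 'rV[R]_d.+1 -> 'rV[R]_m) (Om : set 'rV[R]_d.+1) :
  (forall l, nice U Om (fun x => g x 0 l)) ->
  exists2 K : R, 0 <= K & forall x y, U x -> U y -> `|g x - g y| <= K * `|x - y|.
Proof.
move=> ng; have /choice[K HK] : forall l, exists K : R, 0 <= K /\
    forall x y, U x -> U y -> `|g x 0 l - g y 0 l| <= K * `|x - y|.
  by move=> l; have [[K K0 H] _ _] := ng l; exists K.
have [e e0 He] := seq_upper (enum 'I_m) K; exists e => // x y Ux Uy.
apply: norm_le => [|l]; first by rewrite mulr_ge0.
rewrite !mxE; apply: le_trans ((HK l).2 x y Ux Uy) _.
by rewrite ler_wpM2r// He// mem_enum.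
Qed.

Lemma nice_mxnorm m (g : 'rV[R]_d.+1 -> 'rV[R]_m) (Om : set 'rV[R]_d.+1) :
  (forall l, nice U Om (fun x => g x 0 l)) -> nice U Om (fun x => `|g x|).
Proof.
move=> ng; under eq_fun do rewrite /Num.norm /= mx_normrE.
by apply: nice_bigmax => -[i j] /=; rewrite (ord1 i); apply: nice_norm.
Qed.

Lemma nice_smoothing m (f : 'rV[R]_d.+1 -> 'rV[R]_m) (L eta eps : R) :
  cont_on U f -> 0 < eta ->
  (forall a b, A a -> A b -> `|a - b| < eta -> `|f a - f b| <= L * `|a - b|) -> 0 < eps ->
  exists F : 'rV[R]_d.+1 -> 'rV[R]_m, [/\ forall l, nice U (U `\` A) (fun x => F x 0 l),
    forall a, A a -> F a = f a & forall x, U x -> `|F x - f x| <= eps].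
Proof.
move=> cf eta0 fL eps0.
have [F [K K0 [FK FA Ff Fa]]] := vector_smoothing cU cA AU cf eta0 fL eps0.
have [M HM] := compact_bounded_fun cU cf.
exists F; split=> // l; split=> //.
  exists K => // x y _ _; apply: le_trans (FK x y).
  by have := norm_coord (F x - F y) l; rewrite rowBE.
exists (`|M| + eps) => [|x Ux]; first by rewrite addr_ge0// ltW.
apply: le_trans (norm_coord _ _) _; rewrite -[F x](subrK (f x)) addrC.
apply: le_trans (ler_normD _ _) _; apply: lerD; last exact: Ff.
exact: le_trans (HM x Ux) (ler_norm _).
Qed.

(** On the compact set [U] the map [f] keeps a positive distance from the poles. A smoothing within
    half that distance can still be retracted, and away from the poles the retraction is made of
    operations under which [nice] is closed. *)
Lemma smooth_retract (f : 'rV[R]_d.+1 -> 'rV[R]_(1 + n.+1)) (L eta : R) :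
  cont_on U f -> 0 < eta ->
  (forall a b, A a -> A b -> `|a - b| < eta -> `|f a - f b| <= L * `|a - b|) ->
  (forall x, U x -> @off_poles R n (f x)) -> (forall a, A a -> retract (f a) = f a) ->
  exists g : 'rV[R]_d.+1 -> 'rV[R]_(1 + n.+1), [/\ forall l, nice U (U `\` A) (fun x => g x 0 l),
    forall a, A a -> g a = f a &
    forall x, U x -> exists l, [\/ g x 0 l = -1, g x 0 l = 0 | g x 0 l = 1]].
Proof.
move=> cf eta0 fL fo fr.
have pos b : exists2 e, 0 < e & forall x, U x -> e <= `|f x - pole R n b|.
  apply: compact_pos_lower => //.
    by apply: cont_on_norm; apply: cont_onB => //; exact: cont_on_cst.
  by move=> x Ux; rewrite normr_gt0 subr_eq0; apply/eqP; exact: fo.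
have [et et0 Het] := pos true; have [ef ef0 Hef] := pos false.
(* Half the distance to the poles, capped at 1/2 as [clamp_dist] requires. *)
pose e := Num.min (Num.min et ef) 1 / 2.
have e0 : 0 < e by rewrite divr_gt0// !lt_min et0 ef0 ltr01.
have e2 : e <= 2^-1 by rewrite /e ler_pdivrMr// mulVf// ge_min lexx orbT.
have eb b x : U x -> 2 * e <= `|f x - pole R n b|.
  move=> Ux; rewrite /e mulrC divfK//; case: b.
    by apply: le_trans (Het x Ux); rewrite !ge_min lexx.
  by apply: le_trans (Hef x Ux); rewrite !ge_min lexx orbT.
have [F [nF FA Ff]] := nice_smoothing cf eta0 fL e0.
have cg b x : U x -> e / 2 <= hgauge b (clamp (F x)).
  move=> Ux; rewrite ler_pdivrMr// mulrC; apply: le_trans (hgauge_norm _ _).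
  apply: clamp_dist => //; have := eb b x Ux; have := Ff x Ux.
  have := ler_normD (f x - F x) (F x - pole R n b); rewrite subrKA [`|f x - F x|]distrC; lra.
have OmU : U `\` A `<=` U by move=> x [].
have nc l : nice U (U `\` A) (fun x => clamp (F x) 0 l).
  apply: (@nice_eq _ _ _ _ (fun x => Num.max (-1) (Num.min 1 (F x 0 l)))).
    by move=> x; rewrite mxE.
  by apply: nice_max; [exact: nice_cst|apply: nice_min => //; exact: nice_cst].
have e20 : 0 < e / 2 by rewrite divr_gt0.
have n1 := nice_rbox OmU e20 (cg false) nc.
have cg2 x : U x -> e / 2 <= hgauge true (hrbox false (clamp (F x))).
  move=> Ux; apply: hrbox_other; [by lra| |exact: cg].
  exact: lt_le_trans (cg false x Ux).
exists (fun x => retract (F x)); split.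
- exact: (nice_rbox OmU e20 cg2 n1).
- by move=> a Aa; rewrite FA// fr.
- by move=> x Ux; apply: retract_coord; exact: lt_le_trans (cg _ x Ux).
Qed.

Lemma smooth_cubify m (f : 'rV[R]_d.+1 -> 'rV[R]_m) (L eta : R) :
  cont_on U f -> 0 < eta ->
  (forall a b, A a -> A b -> `|a - b| < eta -> `|f a - f b| <= L * `|a - b|) ->
  (forall x, U x -> `|f x| = 1) ->
  exists g : 'rV[R]_d.+1 -> 'rV[R]_m, [/\ forall l, nice U (U `\` A) (fun x => g x 0 l),
    forall a, A a -> g a = f a & forall x, U x -> `|g x| = 1].
Proof.
move=> cf eta0 fL f1.
have h0 : 0 < 2^-1 :> R by rewrite invr_gt0.
have [F [nF FA Ff]] := nice_smoothing cf eta0 fL h0.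
have F2 x : U x -> 2^-1 <= `|F x|.
  move=> Ux; have := Ff x Ux; have := f1 x Ux; have := ler_normD (f x - F x) (F x).
  by rewrite subrK [`|f x - F x|]distrC; lra.
exists (fun x => cubify (F x)); split.
- move=> l; apply: (@nice_eq _ _ _ _ (fun x => `|F x|^-1 * F x 0 l)) => [x|]; first by rewrite [RHS]mxE.
  by apply: niceM => //; apply: (niceV _ h0 F2); [move=> x []|exact: nice_mxnorm].
- by move=> a Aa; rewrite FA// /cubify f1 ?invr1 ?scale1r//; exact: AU.
- by move=> x Ux; apply: norm_cubify; rewrite -normr_gt0; exact: lt_le_trans (F2 x Ux).
Qed.
End SmoothRetract.

Section LipMaps.
Variable R : realType.

Lemma rad_lip d (x y : 'rV[R]_d) : 1 <= enorm x -> 1 <= enorm y -> `|x| <= 1 ->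
  `|rad x - rad y| <= (d%:R + 1) * `|x - y|.
Proof.
move=> x1 y1 nx; have x0 : 0 < enorm x by exact: lt_le_trans x1.
have y0 : 0 < enorm y by exact: lt_le_trans y1.
have -> : rad x - rad y = ((enorm x)^-1 - (enorm y)^-1) *: x + (enorm y)^-1 *: (x - y).
  by rewrite /rad scalerBl scalerBr addrA subrK.
apply: le_trans (ler_normD _ _) _; rewrite mulrDl mul1r; apply: lerD.
  rewrite normrZ -[leRHS]mulr1; apply: ler_pM => //.
  have -> : (enorm x)^-1 - (enorm y)^-1 = (enorm y - enorm x) * ((enorm x)^-1 * (enorm y)^-1).
    by field; rewrite !gt_eqF.
  rewrite normrM distrC -[leRHS]mulr1; apply: ler_pM => //; first exact: enorm_lip.
  by rewrite ger0_norm ?mulr_ge0 ?invr_ge0 ?enorm_ge0// mulr_ile1 ?invr_ge0 ?enorm_ge0// invf_le1.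
rewrite normrZ ger0_norm ?invr_ge0 ?enorm_ge0// ler_piMl// invf_le1//.
Qed.

Lemma cubify_lip d (x y : 'rV[R]_d) : enorm x = 1 -> enorm y = 1 ->
  `|cubify x - cubify y| <= 2 * d%:R * `|x - y|.
Proof.
move=> x1 y1; have x0 : 0 < `|x| by rewrite normr_gt0; exact: sphere_neq0.
have y0 : 0 < `|y| by rewrite normr_gt0; exact: sphere_neq0.
have yi : `|y|^-1 <= d%:R.
  by have := enorm_le y; rewrite y1 -ler_pdivrMr// mul1r.
have -> : cubify x - cubify y = (`|x|^-1 - `|y|^-1) *: x + `|y|^-1 *: (x - y).
  by rewrite /cubify scalerBl scalerBr addrA subrK.
have H : `|(`|x|^-1 - `|y|^-1) *: x| <= `|y|^-1 * `|x - y|.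
  rewrite normrZ; have -> : `|x|^-1 - `|y|^-1 = (`|y| - `|x|) * (`|x|^-1 * `|y|^-1).
    by field; rewrite !gt_eqF.
  rewrite normrM [`|_ * _^-1|]ger0_norm ?mulr_ge0 ?invr_ge0// -!mulrA.
  have -> : `|x|^-1 * (`|y|^-1 * `|x|) = `|y|^-1 by field; rewrite !gt_eqF.
  rewrite mulrC ler_wpM2l ?invr_ge0// distrC; exact: ler_dist_dist.
apply: le_trans (ler_normD _ _) _.
have -> : `| `|y|^-1 *: (x - y)| = `|y|^-1 * `|x - y| by rewrite normrZ normfV normr_id.
have := ler_wpM2r (normr_ge0 (x - y)) yi; lra.
Qed.

Lemma sphere_map_lip d m (beta : 'rV[R]_d.+1 -> 'rV[R]_m.+1) :
  (forall x, sphere d x -> sphere m (beta x)) -> lip_on (sphere d) beta ->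
  exists2 K : R, 0 <= K & forall x y : 'rV[R]_d.+1, 1 <= enorm x -> 1 <= enorm y -> `|x| <= 1 ->
    `|cubify (beta (rad x)) - cubify (beta (rad y))| <= K * `|x - y|.
Proof.
move=> bS [L bL]; pose D : R := d.+1%:R; pose D' : R := m.+1%:R.
exists (2 * D' * (`|L| * (D * (D + 1)))) => [|x y x1 y1 nx]; first by rewrite !mulr_ge0// addr_ge0.
have rS (z : 'rV[R]_d.+1) : 1 <= enorm z -> sphere d (rad z).
  move=> z1; apply: enorm_rad; apply/eqP => z0; move: z1; rewrite z0 -(scale0r (0 : 'rV[R]_d.+1)) enormZ.
  by rewrite normr0 mul0r ler10.
apply: le_trans (cubify_lip (bS _ (rS _ x1)) (bS _ (rS _ y1))) _.
rewrite -[leRHS]mulrA; apply: ler_wpM2l; first by rewrite mulr_ge0.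
apply: le_trans (norm_le_enorm _) _; apply: le_trans (bL _ _ (rS _ x1) (rS _ y1)) _.
rewrite -mulrA; apply: (@le_trans _ _ (`|L| * enorm (rad x - rad y))).
  by rewrite ler_wpM2r ?enorm_ge0// ler_norm.
apply: ler_wpM2l => //; apply: le_trans (enorm_le _) _; rewrite -mulrA.
by apply: ler_wpM2l => //; exact: rad_lip.
Qed.
End LipMaps.

Definition hole_bd (R : realType) d (mu : R) (j : 'I_d) : set 'rV[R]_d :=
  [set x | holed mu j x /\ (`|x| = 1 \/ exists b, `|unhole mu j b x| = 1)].

Section Block.
Variables (R : realType) (k n : nat).
Local Notation dom := ('rV[R]_(1 + k.+1)).
Local Notation cod := ('rV[R]_(1 + n.+1)).
Local Notation ho1 := (snd_ord n).

Lemma continuous_unhole d (mu : R) (j : 'I_d) b : continuous (unhole mu j b).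
Proof.
apply/continuous_subspace_setT/cont_onP.
apply: cont_onZ; first exact: cont_on_cst.
by apply: cont_on_unhalf; apply: cont_onZ; [exact: cont_on_cst|exact: cont_on_id].
Qed.

Lemma continuous_normf (f : dom -> dom) : continuous f -> continuous (fun x => `|f x|).
Proof.
move=> cf; apply/continuous_subspace_setT/cont_onP; apply: cont_on_norm.
exact: continuous_cont_on.
Qed.

Lemma closed_bigcap2 (P : bool -> set dom) : (forall b, closed (P b)) ->
  closed [set x | forall b, P b x].
Proof.
move=> cP; rewrite (_ : [set x | _] = P true `&` P false); first exact: closedI.
by apply/seteqP; split => x /=; [move=> H; split; exact: H|move=> [h1 h2] []].
Qed.

Lemma closed_holed (mu : R) j : closed (@holed R (1 + k.+1) mu j).
Proof.
have -> : @holed R (1 + k.+1) mu j =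
    [set x | `|x| <= 1] `&` [set x | forall b, 1 <= `|unhole mu j b x|] by [].
apply: closedI; first by apply: closed_preimage_le; exact: norm_continuous.
apply: closed_bigcap2 => b; apply: closed_preimage_ge.
by apply: continuous_normf; exact: continuous_unhole.
Qed.

Lemma compact_holed (mu : R) j : compact (@holed R (1 + k.+1) mu j).
Proof.
by apply: (@bounded_closed_compactP _ _ _ 1) => [x []//|]; exact: closed_holed.
Qed.

Lemma holeB (mu : R) (j : 'I_(1 + k.+1)) b x y : `|unhole mu j b x - unhole mu j b y| <= 2 * (mu^-1 * mu^-1) * `|x - y|.
Proof.
have m0 : 0 <= mu^-1 * mu^-1 by rewrite -expr2 sqr_ge0.
apply: norm_le => [|l]; first by rewrite mulr_ge0// mulr_ge0.
have xy := norm_coord (x - y) l; rewrite rowBE in xy; rewrite rowBE !mxE.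
have -> : mu^-1 * (if l == j then 2 * (mu^-1 * x 0 l) - sg R b else mu^-1 * x 0 l) -
  mu^-1 * (if l == j then 2 * (mu^-1 * y 0 l) - sg R b else mu^-1 * y 0 l) =
  (mu^-1 * mu^-1) * ((if l == j then 2 else 1) * (x 0 l - y 0 l)) by case: ifP => _; ring.
rewrite normrM ger0_norm// -[leRHS]mulrA [leRHS]mulrCA ler_wpM2l//.
case: ifP => _; first by rewrite normrM ger0_norm// ler_wpM2l.
by rewrite mul1r; apply: le_trans xy _; have := normr_ge0 (x - y); lra.
Qed.

Lemma closed_hole_bd (mu : R) (j : 'I_(1 + k.+1)) : closed (hole_bd mu j).
Proof.
have cu b : closed [set x : dom | `|unhole mu j b x| = 1].
  by apply: closed_preimage_eq; apply: continuous_normf; exact: continuous_unhole.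
have -> : hole_bd mu j = holed mu j `&` ([set x : dom | `|x| = 1] `|`
    ([set x : dom | `|unhole mu j true x| = 1] `|` [set x : dom | `|unhole mu j false x| = 1])).
  apply/seteqP; split => x /=.
    by move=> [hx [x1|[[] xb]]]; split=> //; [left|right; left|right; right].
  by move=> [hx [x1|[xb|xb]]]; split=> //; [left|right; exists true|right; exists false].
apply: closedI; first exact: closed_holed.
apply: closedU; last exact: closedU.
by apply: closed_preimage_eq; exact: norm_continuous.
Qed.

(* The three boundary components of the holed cube lie at distance at least mu(1-mu) from one another. *)
Lemma hole_bd_lip (mu K : R) j (f : dom -> cod) (g : dom -> cod) (h : bool -> dom -> cod) :
  0 < mu < 1 -> 0 <= K ->
  (forall x y, `|x| = 1 -> `|y| = 1 -> `|f x - f y| <= K * `|x - y|) ->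
  (forall b x y, `|x| = 1 -> `|y| = 1 ->
    `|f (hole mu j b x) - f (hole mu j b y)| <= K * `|x - y|) ->
  forall a b, hole_bd mu j a -> hole_bd mu j b -> `|a - b| < mu * (1 - mu) ->
    `|f a - f b| <= (K + K * (2 * (mu^-1 * mu^-1))) * `|a - b|.
Proof.
move=> mu01 K0 f1 fh; have /andP[m0 m1] := mu01; have mn0 : mu != 0 by rewrite gt_eqF.
have C0 : 0 <= K * (2 * (mu^-1 * mu^-1)) by rewrite mulr_ge0// mulr_ge0// -expr2 sqr_ge0.
have hl b x : `|x| = 1 -> `|hole mu j b x| < mu.
  by move=> x1; rewrite /hole normrZ gtr0_norm// gtr_pMr//; apply: norm_half_lt; rewrite ?x1.
have hj b x : `|x| = 1 -> mu * (1 - mu) / 2 <= sg R b * hole mu j b x 0 j.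
  move=> x1; have := norm_coord x j; rewrite x1 ler_norml => /andP[a1 a2].
  by rewrite !mxE eqxx; case: b; rewrite /sg; nra.
have m2 : mu * (1 - mu) <= 1 - mu by rewrite ler_piMl ?subr_ge0 ?ltW.
have out x y b : `|x| = 1 -> `|y| = 1 -> ~ (`|x - hole mu j b y| < mu * (1 - mu)).
  move=> x1 y1; have := ler_normD (x - hole mu j b y) (hole mu j b y); rewrite subrK x1.
  by have := hl b y y1; lra.
have sep x y : `|x| = 1 -> `|y| = 1 -> ~ (`|hole mu j true x - hole mu j false y| < mu * (1 - mu)).
  move=> x1 y1; have := hj true x x1; have := hj false y y1; rewrite /sg => h1 h2.
  have := norm_coord (hole mu j true x - hole mu j false y) j; rewrite rowBE.
  have := ler_norm (hole mu j true x 0 j - hole mu j false y 0 j); lra.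
move=> a b [_ Ha] [_ Hb] ab.
have bdE x : (exists c, `|unhole mu j c x| = 1) -> exists c, exists2 y, `|y| = 1 & x = hole mu j c y.
  by move=> [c xc]; exists c, (unhole mu j c x) => //; rewrite unholeK.
case: Ha => [a1|/bdE[c [a' a1 aE]]]; case: Hb => [b1|/bdE[c' [b' b1 bE]]].
- by apply: le_trans (f1 a b a1 b1) _; rewrite ler_wpM2r// lerDl.
- by exfalso; rewrite bE in ab; exact: out ab.
- by exfalso; rewrite aE distrC in ab; exact: out ab.
have [cc'|cc'] := eqVneq c c'; last first.
  exfalso; move: ab; rewrite aE bE; case: c c' cc' {aE bE} => -[] // _; first exact: sep.
  by rewrite distrC; exact: sep.
rewrite aE bE -cc'; apply: le_trans (fh c a' b' a1 b1) _.
have := holeB mu j c (hole mu j c a') (hole mu j c b'); rewrite !holeK// => H.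
apply: (@le_trans _ _ (K * (2 * (mu^-1 * mu^-1)) * `|hole mu j c a' - hole mu j c b'|)).
  by rewrite -mulrA ler_wpM2l.
by rewrite ler_wpM2r// lerDr.
Qed.

(** On [hole_bd] the continuous filling takes values in the boundary of the cube or of one of its
    halves; [retract] fixes these, so smoothing leaves them alone. The final [rot] undoes the
    quarter turn of the target, and as it permutes coordinates up to sign, it respects the values
    -1, 0 and 1. *)
Lemma block (beta : dom -> cod) (mu : R) i j : cond_star (k := k.+1) (n := n.+1) beta ->
  (forall x, sphere k.+1 x -> sphere n.+1 (beta x)) -> lip_on (sphere k.+1) beta ->
  0 < mu < 1 ->
  exists G : dom -> cod, [/\
    exists2 K : R, 0 <= K & forall x y, holed mu j x -> holed mu j y -> `|G x - G y| <= K * `|x - y|,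
    forall x, `|x| = 1 -> G x = cubify (beta (rad x)),
    forall c x, `|x| = 1 -> G (hole mu j c x) = half i c (cubify (beta (rad x))),
    forall x, holed mu j x -> exists l, [\/ G x 0 l = -1, G x 0 l = 0 | G x 0 l = 1] &
    forall l, adiff (holed mu j `\` hole_bd mu j) (fun x => G x 0 l)].
Proof.
move=> cs bS bL mu01; have /andP[m0 m1] := mu01; have mn0 : mu != 0 by rewrite gt_eqF.
have [F [cF FY F1 Fh]] := punctured_filling_rot i j cs bS mu01.
have [K K0 HK] := sphere_map_lip bS bL.
have e1 (x : dom) : `|x| = 1 -> 1 <= enorm x by move=> <-; exact: norm_le_enorm.
have lip1 (x y : dom) : `|x| = 1 -> `|y| = 1 ->
    `|cubify (unrot ho1 i (beta (rad x))) - cubify (unrot ho1 i (beta (rad y)))| <= K * `|x - y|.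
  move=> x1 y1; rewrite !cubify_unrot -unrotB norm_unrot.
  by apply: HK; rewrite ?e1// x1.
have halfB c (u v : cod) : `|half ho1 c u - half ho1 c v| <= `|u - v|.
  apply: norm_le => // l; have := norm_coord (u - v) l; rewrite rowBE => h; rewrite rowBE !mxE.
  case: ifP => _ //; have -> : (u 0 l + sg R c) / 2 - (v 0 l + sg R c) / 2 = (u 0 l - v 0 l) / 2 by ring.
  by rewrite normrM [`|2^-1|]ger0_norm//; have := normr_ge0 (u 0 l - v 0 l); lra.
have AU : hole_bd mu j `<=` holed mu j by move=> x [].
have eta0 : 0 < mu * (1 - mu) by rewrite mulr_gt0// subr_gt0.
have nz (x : dom) : `|x| = 1 -> `|cubify (unrot ho1 i (beta (rad x)))| = 1.
  move=> x1; apply: norm_cubify; apply: sphere_neq0; rewrite enorm_unrot.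
  by apply: bS; apply: enorm_rad; exact: sup_sphere_neq0.
have fr a : hole_bd mu j a -> retract (F a) = F a.
  move=> [_ [a1|[c ac]]].
    rewrite F1// retract_id ?nz// => b; exact/hgauge_cube/nz.
  have -> : a = hole mu j c (unhole mu j c a) by rewrite unholeK.
  rewrite Fh// retract_id// => [|b]; last exact/hgauge_half/nz.
  apply: norm_le => // l; have := norm_coord (cubify (unrot ho1 i (beta (rad (unhole mu j c a))))) l.
  rewrite nz// ler_norml => /andP[h1 h2]; rewrite mxE ler_norml.
  by case: ifP => _; last (by rewrite h1 h2); have [s|s] := sgE R c; rewrite s; lra.
have Fl' a b : hole_bd mu j a -> hole_bd mu j b -> `|a - b| < mu * (1 - mu) ->
    `|F a - F b| <= (K + K * (2 * (mu^-1 * mu^-1))) * `|a - b|.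
  apply: (@hole_bd_lip mu K j F F (fun=> F) mu01 K0).
    by move=> x y x1 y1; rewrite !F1//; exact: lip1.
  by move=> c x y x1 y1; rewrite !Fh//; apply: le_trans (halfB _ _ _) (lip1 _ _ x1 y1).
have [g [ng gA gl]] := smooth_retract (compact_holed (mu := mu) (j := j)) (closed_hole_bd (mu := mu) (j := j)) AU cF eta0 Fl' FY fr.
have hole_in c x : `|x| = 1 -> hole_bd mu j (hole mu j c x).
  move=> x1; split; last by right; exists c; rewrite holeK.
  have hl : `|half j c (mu *: x)| < 1 by apply: norm_half_lt; rewrite ?x1.
  split; first by rewrite /hole normrZ gtr0_norm// mulr_ile1// ltW.
  move=> c'; have [->|cc'] := eqVneq c' c; first by rewrite holeK// x1.
  apply: le_trans (norm_coord _ j); rewrite /unhole /hole scalerA mulVf// scale1r !mxE eqxx.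
  have := norm_coord x j; rewrite x1 ler_norml => /andP[a1 a2].
  rewrite normrM gtr0_norm ?invr_gt0// mulrC ler_pdivlMr// mul1r.
  case: c' c cc' {hl} => -[] //= _; rewrite /sg ler_normr; apply/orP; [right|left]; nra.
have sph_in x : `|x| = 1 -> hole_bd mu j x.
  move=> x1; split; last by left.
  split=> [|c]; first by rewrite x1.
  have [l xl] := norm1_coord x1; apply: le_trans (norm_coord _ l); rewrite !mxE.
  have xE : x 0 l = 1 \/ x 0 l = -1.
    by case: (leP 0 (x 0 l)) => h; move: xl; [rewrite ger0_norm//; left|rewrite ltr0_norm//; right]; lra.
  have mi : 1 <= mu^-1 by rewrite invf_ge1// ltW.
  case: ifP => _.
    rewrite normrM gtr0_norm ?invr_gt0//; apply: (le_trans mi); rewrite ler_peMr ?invr_ge0 ?(ltW m0)//.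
    case: xE => ->; case: c; rewrite /sg ler_normr; apply/orP; ((left; lra) || (right; lra)).
  rewrite normrM normrM xl mulr1 gtr0_norm ?invr_gt0//.
  by apply: (le_trans mi); rewrite ler_peMr// invr_ge0 ltW.
have [Kg Kg0 HKg] := nice_lip ng.
exists (fun x => rot ho1 i (g x)); split.
- by exists Kg => // x y hx hy; rewrite -rotB norm_rot; exact: HKg.
- by move=> x x1; rewrite gA ?F1 ?cubify_unrot ?unrotK//; exact: sph_in.
- by move=> c x x1; rewrite gA ?Fh ?cubify_unrot -?unrot_half ?unrotK//; exact: hole_in.
- move=> x hx; have [l Hl] := gl x hx; have [li|li] := eqVneq l ho1.
    by exists i; rewrite mxE eqxx -li.
  have [lp|lp] := eqVneq l i.
    exists ho1; rewrite mxE eqxx -lp eq_sym (negbTE li); case: Hl => ->.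
    - by rewrite opprK; exact: Or33.
    - by rewrite oppr0; exact: Or32.
    - exact: Or31.
  by exists l; rewrite mxE (negbTE lp) (negbTE li).
- move=> l; have ag m : adiff (holed mu j `\` hole_bd mu j) (fun x => g x 0 m).
    by have [_ _] := ng m.
  have [E|E] := boolP (l == i).
    by apply: adiff_eq (ag ho1) => x; rewrite mxE E.
  have [E'|E'] := boolP (l == ho1).
    by apply: adiff_eq (adiffN (ag i)) => x; rewrite mxE (negbTE E) E'.
  by apply: adiff_eq (ag l) => x; rewrite mxE (negbTE E) (negbTE E').
Qed.
End Block.

(** * Iterated subdivision *)

Section Boxes.
Variables (R : realType) (d : nat).
Implicit Types N : set 'rV[R]_d.+1.

(** An instance of [leb_null_zero_diff]. The derivative of the coordinate is not computed: if it
    vanished in direction [j], a step of length [e / 2] would violate the first-order bound with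
    slope 1/2. *)
Lemma leb_null_hyperplane (j : 'I_d.+1) (c : R) : leb_null [set x : 'rV[R]_d.+1 | x 0 j = c].
Proof.
apply: leb_null_sub (@leb_null_zero_diff R d (fun x => x 0 j - c)) => x /= xj.
have dc : differentiable (fun x : 'rV[R]_d.+1 => x 0 j) x by exact: differentiable_coord.
have df : differentiable (fun x : 'rV[R]_d.+1 => x 0 j - c) x.
  exact: differentiableB dc (differentiable_cst _ _).
split; first by rewrite xj subrr.
split=> //; exists (delta_mx 0 j) => d0.
have h2 : 0 < 2^-1 :> R by rewrite invr_gt0.
have /nbhs_ex_ball[e e0 He] := differentiable_bound df h2.
have nd : `|(e / 2) *: delta_mx 0 j : 'rV[R]_d.+1| = e / 2.
  have -> : `|(e / 2) *: delta_mx 0 j : 'rV[R]_d.+1| = (e / 2) * `|delta_mx 0 j : 'rV[R]_d.+1|.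
    by rewrite normrZ ger0_norm// divr_ge0// ltW.
  have -> : `|delta_mx 0 j : 'rV[R]_d.+1| = 1; last by rewrite mulr1.
  apply/eqP; rewrite eq_le; apply/andP; split.
    by apply: norm_le => // i; rewrite mxE; case: (_ && _); rewrite ?normr1 ?normr0.
  by have := norm_coord (delta_mx 0 j : 'rV[R]_d.+1) j; rewrite mxE !eqxx normr1.
have vj : (x + (e / 2) *: delta_mx 0 j) 0 j = x 0 j + e / 2 by rewrite !mxE !eqxx mulr1.
have : `|x + (e / 2) *: delta_mx 0 j - x| < e by rewrite [x + _]addrC addrK nd; lra.
move/He; rewrite [x + _ - x]addrAC subrr add0r nd vj linearZ /= d0 scaler0 subr0.
have -> : x 0 j + e / 2 - c - (x 0 j - c) = e / 2 by ring.
have e2 : 0 < e / 2 by rewrite divr_gt0.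
rewrite gtr0_norm// => H; lra.
Qed.

Lemma leb_null_sup_sphere : leb_null [set x : 'rV[R]_d.+1 | `|x| = 1].
Proof.
apply: (@leb_null_sub _ _ _ [set x | exists p : 'I_d.+1 * bool, x 0 p.1 = sg R p.2]).
  move=> x /norm1_coord[l xl]; case: (leP 0 (x 0 l)) => h.
    by exists (l, true); rewrite /= -xl ger0_norm.
  by exists (l, false); rewrite /= -[x 0 l]opprK -(ltr0_norm h) xl.
by apply: leb_null_countable => p; exact: leb_null_hyperplane.
Qed.

(** Finite covers with an explicit total volume, suited to an induction on the depth of the
    subdivision. *)
Definition boxcov N (v : R) := exists s : seq ('rV[R]_d.+1 * 'rV[R]_d.+1),
  [/\ forall p, p \in s -> forall j, p.1 0 j <= p.2 0 j,
   forall x, N x -> exists2 p, p \in s & forall j, p.1 0 j <= x 0 j <= p.2 0 j &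
   \sum_(p <- s) box_vol p.1 p.2 <= v].

Lemma boxcovU N N' v v' : boxcov N v -> boxcov N' v' -> boxcov (N `|` N') (v + v').
Proof.
move=> [s [h1 h2 h3]] [s' [h1' h2' h3']]; exists (s ++ s'); split.
- by move=> p; rewrite mem_cat => /orP[/h1|/h1'].
- move=> x [/h2[p ps xp]|/h2'[p ps xp]]; exists p => //; rewrite mem_cat ps ?orbT//.
- by rewrite big_cat /= lerD.
Qed.

Lemma boxcov_affine N v (c e : 'I_d.+1 -> R) : (forall j, 0 < c j) -> boxcov N v ->
  boxcov [set x | exists2 y, N y & forall j, x 0 j = c j * y 0 j + e j] ((\prod_j c j) * v).
Proof.
move=> c0 [s [h1 h2 h3]].
pose f (u : 'rV[R]_d.+1) : 'rV[R]_d.+1 := \row_j (c j * u 0 j + e j).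
exists [seq (f p.1, f p.2) | p <- s]; split.
- move=> _ /mapP[p ps ->] j; rewrite !mxE lerD2r ler_pM2l//; exact: h1.
- move=> x [y /h2[p ps yp] xy]; exists (f p.1, f p.2); first exact: map_f.
  by move=> j; rewrite !mxE xy !lerD2r !ler_pM2l.
rewrite big_map (eq_bigr (fun p => (\prod_j c j) * box_vol p.1 p.2)) => [|p _]; last first.
  by rewrite /box_vol -big_split /=; apply: eq_bigr => j _; rewrite !mxE; ring.
by rewrite -mulr_sumr ler_pM2l//; apply: prodr_gt0 => j _.
Qed.

Lemma boxcov_null N : (forall eps : R, 0 < eps -> boxcov N eps) -> leb_null N.
Proof.
move=> H; apply: leb_null_cover => eps /H[s [h1 h2 h3]].
exists 'I_(size s), (fun i : 'I_(size s) => (nth (0, 0) s i).1),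
  (fun i : 'I_(size s) => (nth (0, 0) s i).2); split.
  by move=> i j; apply: h1; rewrite mem_nth.
split=> [x /h2[p ps xp]|t ut].
  have ip : (index p s < size s)%N by rewrite index_mem.
  by exists (Ordinal ip) => j; rewrite /= nth_index.
apply: le_trans h3; rewrite (big_nth (0, 0)) big_mkord.
have -> : \sum_(i < size s) box_vol (nth (0, 0) s i).1 (nth (0, 0) s i).2 =
    \sum_(i <- enum 'I_(size s)) box_vol (nth (0, 0) s i).1 (nth (0, 0) s i).2.
  by rewrite big_enum.
apply: ler_sum_uniq => //; first exact: enum_uniq.
  by move=> i _; rewrite mem_enum.
by move=> i; apply: box_vol_ge0; apply: h1; rewrite mem_nth.
Qed.
End Boxes.

Section DiffRow.
Variable R : realType.

Lemma differentiable_row (V : normedModType R) n (f : V -> 'rV[R]_n) (x : V) :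
  (forall i, differentiable (fun y => f y 0 i) x) -> differentiable f x.
Proof.
move=> df; have -> : f = \sum_(i < n) (fun y => f y 0 i *: delta_mx 0 i).
  by apply/funext => y; rewrite fct_sumE -row_sum_delta.
by apply: differentiable_sum => i; exact: differentiableZl.
Qed.
End DiffRow.

Section Crossing.
Variables (R : realType) (V W : normedModType R).

Lemma segment_cross (f : V -> W) (x y : V) : continuous f -> `|f x| <= 1 -> 1 <= `|f y| ->
  exists2 t : R, 0 <= t <= 1 & `|f (x + t *: (y - x))| = 1.
Proof.
move=> cf fx fy; pose h (t : R) := `|f (x + t *: (y - x))|.
have ch : continuous h.
  apply/continuous_subspace_setT/cont_onP; apply: cont_on_norm.
  apply: (@cont_on_comp _ _ _ _ setT (fun t : R => x + t *: (y - x)) f) => //.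
    apply: cont_onD; first exact: cont_on_cst.
    by apply: cont_onZ; [exact: cont_on_id|exact: cont_on_cst].
  exact: continuous_cont_on.
have h0 : h 0 = `|f x| by rewrite /h scale0r addr0.
have h1 : h 1 = `|f y| by rewrite /h scale1r addrC subrK.
have hb : Num.min (h 0) (h 1) <= 1 <= Num.max (h 0) (h 1).
  by rewrite h0 h1 ge_min fx /= le_max fy orbT.
have [t t01 ht] := IVT ler01 (continuous_subspaceT ch) hb.
by exists t => //; rewrite in_itv /= in t01.
Qed.
End Crossing.

Section HoleFacts.
Variables (R : realType) (d : nat) (mu : R).
Hypothesis mu01 : 0 < mu < 1.
Implicit Types (x : 'rV[R]_d) (j : 'I_d).

Let mu0 : 0 < mu. Proof. by case/andP: mu01. Qed.
Let mun0 : mu != 0. Proof. by rewrite gt_eqF. Qed.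

Lemma holeE j b x l : hole mu j b x 0 l =
  (mu ^+ 2 * (if l == j then 2^-1 else 1)) * x 0 l + (if l == j then sg R b * mu / 2 else 0).
Proof. by rewrite !mxE; case: ifP => _; ring. Qed.

Lemma unhole_sign j b x : `|unhole mu j b x| <= 1 -> 0 < sg R b * x 0 j.
Proof.
have /andP[_ m1] := mu01.
move=> h; rewrite -(unholeK j b mun0 x) holeE eqxx; have := le_trans (norm_coord _ j) h.
move: (unhole mu j b x 0 j) => z; rewrite ler_norml => /andP[z1 z2].
have := mu0; case: b {h}; rewrite /sg; nra.
Qed.

Lemma unhole_disj j b c x : `|unhole mu j b x| <= 1 -> `|unhole mu j c x| <= 1 -> b = c.
Proof.
move=> /unhole_sign hb /unhole_sign; move: hb.
by case: b; case: c => //; rewrite /sg => h1 h2; exfalso; lra.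
Qed.

Lemma unhole_sup_sphere j b x : `|x| = 1 -> 1 < `|unhole mu j b x|.
Proof.
have /andP[_ m1] := mu01.
move=> x1; rewrite ltNge; apply/negP => h.
have : `|hole mu j b (unhole mu j b x)| < 1.
  by rewrite /hole normrZ gtr0_norm// mulr_ilt1// ?(ltW mu0)//; exact: norm_half_lt.
by rewrite unholeK// x1 ltxx.
Qed.
End HoleFacts.

(** * Cell sizes under cyclic halving *)

Section Weights.
Variable R : realType.

(** Bernoulli's inequality. *)
Lemma pow_onem_ge (t : R) m : 0 <= t <= 1 -> 1 - m%:R * t <= (1 - t) ^+ m.
Proof.
move=> /andP[t0 t1]; elim: m => [|m IH]; first by rewrite mul0r subr0 expr0.
rewrite exprS; have m0 : 0 <= m%:R :> R by [].
have h : (1 - t) * (1 - m%:R * t) <= (1 - t) * (1 - t) ^+ m by rewrite ler_wpM2l// subr_ge0.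
apply: le_trans h; rewrite -natr1; have : 0 <= m%:R * t * t by rewrite !mulr_ge0.
lra.
Qed.

Lemma pow_small (t c eps : R) : 0 <= t < 1 -> 0 <= c -> 0 < eps -> exists m, t ^+ m * c <= eps.
Proof.
move=> /andP[t0 t1] c0 e0; have c1 : 0 < c + 1 by lra.
have /cvgrPdist_lt/(_ _ (divr_gt0 e0 c1)) : (fun m => t ^+ m) @ \oo --> (0 : R).
  by apply: cvg_expr; rewrite ger0_norm.
move=> [m _ /(_ m (leqnn m))] /=; rewrite sub0r normrN ger0_norm ?exprn_ge0// => h.
exists m; have := exprn_ge0 m t0; move: h; rewrite ltr_pdivlMr//; nra.
Qed.

(** The relative length of edge [i] after [l] steps that halve the edges 0, ..., [E] in turn: for
    [i <= E] the exponent counts the steps [l' < l] congruent to [i] modulo [E + 1]. *)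
Definition cut_weight E (i l : nat) : R := 2^-1 ^+ ((l + (E - i)) %/ E.+1).

Lemma cut_weight0 E (i : nat) : cut_weight E i 0 = 1.
Proof. by rewrite /cut_weight add0n divn_small ?expr0// ltnS leq_subr. Qed.

Lemma cut_weight_gt0 E i l : 0 < cut_weight E i l. Proof. by rewrite exprn_gt0// invr_gt0. Qed.

Lemma cut_weightS E i l : (i <= E)%N ->
  cut_weight E i l.+1 = cut_weight E i l * (if i == (l %% E.+1)%N then 2^-1 else 1).
Proof.
move=> iE; rewrite /cut_weight addSn divnS// -addnS -subSn//.
have -> : (E.+1 %| l + (E.+1 - i))%N = (i == l %% E.+1)%N.
  have h : ((l + (E.+1 - i) == i + (E.+1 - i) %[mod E.+1]) = (l == i %[mod E.+1]))%N.
    by rewrite eqn_modDr.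
  rewrite subnKC in h; last by rewrite ltnW.
  by rewrite /dvdn; move: h; rewrite modnn (modn_small (_ : i < E.+1)%N)// => ->; rewrite eq_sym.
by case: ifP => _; rewrite /= ?add1n ?add0n ?mulr1// exprS mulrC.
Qed.

(* Target edges are halved every [E + 1] steps and domain edges only every [D + 1] steps, which
   leaves room for the shrinking factor [lam ^+ l]. *)
Lemma cut_weight_le E D i j l (lam : R) : (E < D)%N -> 0 < lam -> 2^-1 <= lam ^+ (E.+1 * D.+1) -> lam <= 1 ->
  (j <= D)%N -> cut_weight E i l <= 4 * (lam ^+ l * cut_weight D j l).
Proof.
move=> ED l0 l2 l1 jD; rewrite /cut_weight.
(* In [p] steps each target edge is halved [D + 1] times and each domain edge only [E + 1 <= D]
   times; the surplus pays for [lam^p >= 1/2]. The factor 4 covers the incomplete periods of the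
   shrinking and of the domain halving. *)
set p := (E.+1 * D.+1)%N; set q := (l %/ p)%N.
have p0 : (0 < p)%N by rewrite muln_gt0.
have h2 : 0 <= 2^-1 :> R by [].
have h21 : 2^-1 <= 1 :> R by lra.
have ll : 2^-1 ^+ q.+1 <= lam ^+ l.
  apply: (@le_trans _ _ (lam ^+ (p * q.+1))).
    by rewrite exprM; apply: lerXn2r; rewrite ?nnegrE ?exprn_ge0// ltW.
  apply: ler_wiXn2l => //; first exact: ltW.
  by rewrite mulnC ltnW// /q ltn_ceil.
have fd : ((l + (D - j)) %/ D.+1 <= (l %/ D.+1).+1)%N.
  apply: (@leq_trans ((l + D.+1) %/ D.+1)); first by apply: leq_div2r; rewrite leq_add2l leqW// leq_subr.
  by rewrite divnDr// divnn addn1.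
have fa : (l %/ D.+1 + q <= (l + (E - i)) %/ E.+1)%N.
  apply: (@leq_trans (l %/ E.+1)); last by rewrite leq_div2r// leq_addr.
  rewrite {1 2}(divn_eq l p) -/q.
  have -> : (q * p + l %% p = (q * D.+1) * E.+1 + l %% p)%N by rewrite /p; ring.
  rewrite divnMDl// [X in (X %/ D.+1)%N](_ : _ = ((q * E.+1) * D.+1 + l %% p)%N); last by ring.
  rewrite divnMDl//.
  have : (l %% p %/ D.+1 <= l %% p %/ E.+1)%N by apply: leq_div2l => //; exact: ltnW.
  by move=> h; rewrite addnAC -mulnSr; apply: leq_add => //; rewrite leq_mul2l [(_ < D.+1)%N]ltnS ED orbT.
apply: (@le_trans _ _ (2^-1 ^+ (l %/ D.+1 + q) : R)); first by apply: ler_wiXn2l.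
have -> : 2^-1 ^+ (l %/ D.+1 + q) = 4 * (2^-1 ^+ q.+1 * 2^-1 ^+ (l %/ D.+1).+1) :> R.
  by rewrite exprD !exprS; field; rewrite ?expf_neq0//.
rewrite ler_pM2l//; apply: ler_pM; rewrite ?exprn_ge0//.
exact: ler_wiXn2l.
Qed.
End Weights.

Section Tree.
Variables (R : realType) (d e : nat) (mu : R).
Local Notation dom := 'rV[R]_d.+1.
Local Notation cod := 'rV[R]_e.+1.
Variables (B : dom -> cod) (G : 'I_e.+1 -> 'I_d.+1 -> dom -> cod) (K : R).
Hypothesis mu01 : 0 < mu < 1.
Hypothesis K0 : 0 <= K.
Hypothesis GL : forall i j x y, holed mu j x -> holed mu j y -> `|G i j x - G i j y| <= K * `|x - y|.
Hypothesis G1 : forall i j x, `|x| = 1 -> G i j x = B x.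
Hypothesis Gh : forall i j c x, `|x| = 1 -> G i j (hole mu j c x) = half i c (B x).
Hypothesis Gq : forall i j x, holed mu j x ->
  exists l, [\/ G i j x 0 l = -1, G i j x 0 l = 0 | G i j x 0 l = 1].
Hypothesis Gd : forall i j l, adiff (holed mu j `\` hole_bd mu j) (fun x => G i j x 0 l).

Let mu0 : 0 < mu. Proof. by case/andP: mu01. Qed.
Let mun0 : mu != 0. Proof. by rewrite gt_eqF. Qed.

Let il l : 'I_e.+1 := inord (l %% e.+1).
Let jl l : 'I_d.+1 := inord (l %% d.+1).
Let unh l b x := unhole mu (jl l) b x.

(* [M] steps of the subdivision starting at depth [l]; the value [0] reached for [M = 0] is junk,
   and [tree_dom M l] is the set where the recursion stops before. *)
Fixpoint tree_map M l (x : dom) : cod :=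
  if M is M'.+1 then
    if [pick b | `|unh l b x| < 1] is Some b then half (il l) b (tree_map M' l.+1 (unh l b x))
    else G (il l) (jl l) x
  else 0.

Fixpoint tree_dom M l (x : dom) : Prop :=
  if M is M'.+1 then `|x| <= 1 /\ forall b, `|unh l b x| < 1 -> tree_dom M' l.+1 (unh l b x) else False.

Lemma tree_dom_norm M l x : tree_dom M l x -> `|x| <= 1. Proof. by case: M => // M []. Qed.

Lemma tree_map_hole M l b x : `|unh l b x| < 1 -> tree_map M.+1 l x = half (il l) b (tree_map M l.+1 (unh l b x)).
Proof.
move=> h /=; case: pickP => [c hc|/(_ b)]; last by rewrite h.
by rewrite (@unhole_disj _ _ _ mu01 (jl l) c b x)// ltW.
Qed.

Lemma tree_map_out M l x : (forall b, 1 <= `|unh l b x|) -> tree_map M.+1 l x = G (il l) (jl l) x.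
Proof. by move=> h /=; case: pickP => // b; rewrite ltNge h. Qed.

Lemma sup_sphere_out l x : `|x| = 1 -> forall b, 1 <= `|unh l b x|.
Proof. by move=> x1 b; apply/ltW/unhole_sup_sphere. Qed.

Lemma tree_map_sup_sphere M l x : `|x| = 1 -> tree_map M.+1 l x = B x.
Proof. by move=> x1; rewrite tree_map_out ?G1//; exact: sup_sphere_out. Qed.

Lemma tree_dom_out M l x : `|x| <= 1 -> (forall b, 1 <= `|unh l b x|) -> tree_dom M.+1 l x.
Proof. by move=> x1 h; split=> // b; rewrite ltNge h. Qed.

Lemma tree_dom_sup_sphere M l x : `|x| = 1 -> tree_dom M.+1 l x.
Proof. by move=> x1; apply: tree_dom_out; [rewrite x1|exact: sup_sphere_out]. Qed.

Lemma hole_bd_out l b x : `|unh l b x| = 1 -> forall c, 1 <= `|unh l c x|.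
Proof.
move=> xb c; rewrite leNgt; apply/negP => xc.
have xb1 : `|unh l b x| <= 1 by rewrite xb.
have bc := @unhole_disj _ _ _ mu01 (jl l) b c x xb1 (ltW xc).
by move: xc; rewrite -bc xb ltxx.
Qed.

(** On the boundary of a hole the outer block is in charge, and [Gh] identifies its values with the
    scaled copy. The depth is at least 2 so that the inner map is not the default value 0. *)
Lemma tree_map_hole_closed M l b x : `|unh l b x| <= 1 ->
  tree_map M.+2 l x = half (il l) b (tree_map M.+1 l.+1 (unh l b x)).
Proof.
rewrite le_eqVlt => /orP[/eqP h|h]; last exact: tree_map_hole.
rewrite tree_map_out; last exact: hole_bd_out h.
by rewrite tree_map_sup_sphere// -[in LHS](unholeK (jl l) b mun0 x) Gh.
Qed.

Lemma tree_dom_hole M l b x : tree_dom M.+2 l x -> `|unh l b x| <= 1 -> tree_dom M.+1 l.+1 (unh l b x).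
Proof.
by move=> [_ hx]; rewrite le_eqVlt => /orP[/eqP|]; [exact: tree_dom_sup_sphere|exact: hx].
Qed.

Lemma tree_step M l x : tree_dom M l x -> tree_dom M.+1 l x /\ tree_map M.+1 l x = tree_map M l x.
Proof.
elim: M l x => // M IH l x [x1 hx].
have hx' b : `|unh l b x| < 1 -> tree_dom M.+1 l.+1 (unh l b x) by move=> /hx/IH[].
split; first by split.
have [[b xb]|no] := pselect (exists b, `|unh l b x| < 1).
  by rewrite !(tree_map_hole _ xb) (IH _ _ (hx _ xb)).2.
have out b : 1 <= `|unh l b x| by rewrite leNgt; apply/negP => h; apply: no; exists b.
by rewrite !tree_map_out.
Qed.

Lemma tree_mono M M' l x : (M <= M')%N -> tree_dom M l x -> tree_dom M' l x /\ tree_map M' l x = tree_map M l x.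
Proof.
move=> MM' dx; rewrite -(subnKC MM'); elim: (M' - M)%N => [|m [d1 t1]]; first by rewrite addn0.
by rewrite addnS; have [? ->] := tree_step d1.
Qed.

Section Lipschitz.
Variables (a : 'I_e.+1 -> nat -> R) (dd : 'I_d.+1 -> nat -> R) (C : R).
Hypothesis a0 : forall i l, 0 < a i l.
Hypothesis aS : forall (i : 'I_e.+1) l, a i l.+1 = a i l * (if i == il l then 2^-1 else 1).
Hypothesis dS : forall (j : 'I_d.+1) l, dd j l.+1 = dd j l * (mu ^+ 2 * (if j == jl l then 2^-1 else 1)).
Hypothesis ad : forall (i : 'I_e.+1) (j : 'I_d.+1) l, K * a i l <= C * dd j l.
Hypothesis C0 : 0 <= C.

(** [a i l] and [dd j l] stand for the edges of the target and domain cells of depth [l] relative to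
    the whole cubes, so [P] bounds distances in the original scale although [x] and [y] are
    positions within a cell. *)
Let P M l (x y : dom) := forall r : R, (forall j, dd j l * `|x 0 j - y 0 j| <= r) ->
  forall i, a i l * `|tree_map M l x 0 i - tree_map M l y 0 i| <= C * r.

Let Psym M l x y : P M l x y -> P M l y x.
Proof. by move=> h r hr i; rewrite distrC; apply: h => j; rewrite distrC. Qed.

Let Pseg M l x y t : 0 <= t <= 1 -> P M l x (x + t *: (y - x)) -> P M l (x + t *: (y - x)) y -> P M l x y.
Proof.
move=> /andP[t0 t1] h1 h2 r hr i; set z := x + _ in h1 h2.
have z1 j : dd j l * `|x 0 j - z 0 j| <= t * r.
  have -> : x 0 j - z 0 j = t * (x 0 j - y 0 j) by rewrite !mxE; ring.
  by rewrite normrM ger0_norm// mulrCA ler_wpM2l.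
have z2 j : dd j l * `|z 0 j - y 0 j| <= (1 - t) * r.
  have -> : z 0 j - y 0 j = (1 - t) * (x 0 j - y 0 j) by rewrite !mxE; ring.
  by rewrite normrM ger0_norm ?subr_ge0// mulrCA ler_wpM2l ?subr_ge0.
have := ler_distD (tree_map M l z 0 i) (tree_map M l x 0 i) (tree_map M l y 0 i).
rewrite -(ler_pM2l (a0 i l)) mulrDr => /le_trans; apply.
by apply: (le_trans (lerD (h1 _ z1 i) (h2 _ z2 i))); rewrite le_eqVlt; apply/orP; left; apply/eqP; ring.
Qed.

Let Pout M l x y : `|x| <= 1 -> `|y| <= 1 -> (forall b, 1 <= `|unh l b x|) -> (forall b, 1 <= `|unh l b y|) ->
  P M.+1 l x y.
Proof.
move=> x1 y1 ox oy r hr i; rewrite !tree_map_out//.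
have [j hj] : exists j, `|x - y| = `|x 0 j - y 0 j|.
  have [z|nz] := eqVneq (x - y) 0.
    exists ord0; have := congr1 (fun v : dom => v 0 ord0) z.
    by rewrite rowBE z mxE => ->; rewrite !normr0.
  have [|j hj] := @norm1_coord R _ (cubify (x - y)); first exact: norm_cubify.
  exists j; move: hj; rewrite mxE rowBE normrM normfV normr_id => hj.
  have n0 : 0 < `|x - y| by rewrite normr_gt0.
  by apply: (mulfI (lt0r_neq0 (_ : 0 < `|x - y|^-1))); rewrite ?invr_gt0// hj mulVf// gt_eqF.
have h := le_trans (norm_coord _ i) (@GL (il l) (jl l) x y (conj x1 ox) (conj y1 oy)).
rewrite rowBE hj in h; apply: (@le_trans _ _ (a i l * (K * `|x 0 j - y 0 j|))).
  by rewrite ler_pM2l.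
rewrite mulrA [a i l * K]mulrC; apply: (@le_trans _ _ (C * dd j l * `|x 0 j - y 0 j|)).
  by rewrite ler_wpM2r.
by rewrite -mulrA ler_wpM2l.
Qed.

Let Phole M l b x y : P M.+1 l.+1 (unh l b x) (unh l b y) -> `|unh l b x| <= 1 -> `|unh l b y| <= 1 ->
  P M.+2 l x y.
Proof.
move=> h xb yb r hr i; rewrite !(tree_map_hole_closed M _ (b := b))//.
have hr' j : dd j l.+1 * `|unh l b x 0 j - unh l b y 0 j| <= r.
  rewrite dS; apply: le_trans (hr j).
  rewrite -[in leRHS](unholeK (jl l) b mun0 x) -[in leRHS](unholeK (jl l) b mun0 y) !holeE.
  rewrite -/(unh l b x) -/(unh l b y); set u := unh l b x 0 j; set v := unh l b y 0 j.
  set c := mu ^+ 2 * _; have c0 : 0 <= c by rewrite /c mulr_ge0 ?exprn_ge0 ?(ltW mu0)//; case: ifP.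
  rewrite opprD addrACA subrr addr0 -mulrBr normrM (ger0_norm c0) mulrA.
  by rewrite /c !mulrA.
apply: le_trans (h r hr' i); rewrite aS !mxE; case: (i == il l); last by rewrite mulr1.
rewrite -!mulrA ler_pM2l// -mulrBl opprD addrACA subrr addr0 normrM.
by rewrite [`|2^-1|]ger0_norm// mulrC.
Qed.

(* A segment joining different cells crosses the boundary of a hole, where the map does not
   depend on the deeper levels. *)
Lemma tree_map_lip M l x y : tree_dom M l x -> tree_dom M l y -> P M l x y.
Proof.
elim: M l x y => // M IH l x y dx dy.
have x1 := tree_dom_norm dx; have y1 := tree_dom_norm dy.
have Poo u v : `|u| <= 1 -> `|v| <= 1 -> (forall b, 1 <= `|unh l b u|) -> (forall b, 1 <= `|unh l b v|) ->
  P M.+1 l u v by exact: Pout.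
have split_out u : tree_dom M.+1 l u -> (forall b, 1 <= `|unh l b u|) \/ exists2 b, `|unh l b u| < 1 & (0 < M)%N.
  move=> du; have [[b ub]|no] := pselect (exists b, `|unh l b u| < 1).
    by right; exists b => //; case: (M) du => // -[_ /(_ b ub)].
  by left => b; rewrite leNgt; apply/negP => h; apply: no; exists b.
have seg1 (u v : dom) (t : R) : `|u| <= 1 -> `|v| <= 1 -> 0 <= t <= 1 -> `|u + t *: (v - u)| <= 1.
  move=> u1 v1 /andP[t0 t1].
  have -> : u + t *: (v - u) = (1 - t) *: u + t *: v by rewrite scalerBr scalerBl scale1r addrA addrAC.
  rewrite (le_trans (ler_normD _ _))// !normrZ !ger0_norm// ?subr_ge0//.
  have : 0 <= 1 - t by rewrite subr_ge0.
  have := normr_ge0 u; have := normr_ge0 v; nra.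
have Pcl u v b : tree_dom M.+1 l u -> tree_dom M.+1 l v -> (0 < M)%N -> `|unh l b u| <= 1 -> `|unh l b v| <= 1 -> P M.+1 l u v.
  case: (M) IH => // M' IH du dv _ ub vb.
  by apply: (Phole (b := b)) => //; apply: IH; exact: tree_dom_hole.
have cross u v b : tree_dom M.+1 l u -> `|v| <= 1 -> (0 < M)%N -> `|unh l b u| < 1 -> 1 <= `|unh l b v| ->
    (forall z, `|z| <= 1 -> (forall c, 1 <= `|unh l c z|) -> P M.+1 l z v) -> P M.+1 l u v.
  move=> du v1 M0 ub vb H.
  have cu : continuous (unh l b) by exact: continuous_unhole.
  have [t t01 ht] := segment_cross cu (ltW ub) vb.
  have zo := hole_bd_out ht; have z1 := seg1 _ _ _ (tree_dom_norm du) v1 t01.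
  apply: (Pseg t01); last exact: H.
  by apply: (Pcl _ _ b) => //; [exact: tree_dom_out|exact: ltW|rewrite ht].
have Po u v : tree_dom M.+1 l u -> `|v| <= 1 -> (forall b, 1 <= `|unh l b v|) -> P M.+1 l u v.
  move=> du v1 vo; have [uo|[b ub M0]] := split_out u du; first exact: Poo (tree_dom_norm du) v1 uo vo.
  by apply: (cross _ _ b) => // z z1 zo; exact: Poo.
have [yo|[b yb M0]] := split_out y dy; first exact: Po.
have [xb|xb] := ltP (`|unh l b x|) 1; first by apply: (Pcl _ _ b) => //; exact: ltW.
apply: Psym; apply: (cross _ _ b) => // z z1 zo; apply: Psym; exact: Po.
Qed.
End Lipschitz.

Lemma unhole_affine l b (x : dom) j : x 0 j =
  (mu ^+ 2 * (if j == jl l then 2^-1 else 1)) * unh l b x 0 j + (if j == jl l then sg R b * mu / 2 else 0).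
Proof. by rewrite -holeE unholeK. Qed.

Lemma tree_map_rat M l x : tree_dom M l x -> exists i q, tree_map M l x 0 i = ratr q.
Proof.
elim: M l x => // M IH l x [x1 hx].
have [[b xb]|no] := pselect (exists b, `|unh l b x| < 1).
  have [i [q iq]] := IH _ _ (hx _ xb); exists i.
  exists (if i == il l then (q + (if b then 1 else -1)) / 2 else q).
  rewrite (tree_map_hole _ xb) mxE iq; case: ifP => // _.
  rewrite fmorph_div rmorphD/= (rmorph_nat _ 2); congr ((_ + _) / _).
  by case: b {xb iq}; rewrite /= ?rmorphN rmorph1.
have out b : 1 <= `|unh l b x| by rewrite leNgt; apply/negP => h; apply: no; exists b.
rewrite tree_map_out//; have [i hi] := Gq (il l) (conj x1 out); exists i; case: hi => ->.
- by exists (-1); rewrite rmorphN rmorph1.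
- by exists 0; rewrite rmorph0.
- by exists 1; rewrite rmorph1.
Qed.

Let cc j l := mu ^+ 2 * (if j == jl l then 2^-1 else 1) : R.
Let cc0 l j : 0 < cc j l.
Proof. by rewrite /cc mulr_gt0 ?exprn_gt0//; case: ifP; rewrite ?invr_gt0. Qed.

Lemma leb_null_hole l b (N : set dom) : leb_null N -> leb_null [set x | N (unh l b x)].
Proof.
move=> nN; have := @leb_null_affine R _ N (fun j => cc j l)
  (fun j => if j == jl l then sg R b * mu / 2 else 0) (cc0 l) nN.
apply: leb_null_sub => x Nx; exists (unh l b x) => // j; exact: unhole_affine.
Qed.

Lemma prod_cc l : \prod_j cc j l = (mu ^+ 2) ^+ d.+1 / 2.
Proof.
rewrite big_split /= prodr_const card_ord; congr (_ * _).
by rewrite (bigD1 (jl l)) //= eqxx big1 ?mulr1// => j /negbTE ->.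
Qed.

(** A step replaces the leftover set by two affine copies, each with volume factor
    [(mu^2)^(d+1) / 2]. The halving cancels the number of copies, so only the shrinking makes the
    volume decay. *)
Lemma boxcov_not_tree_dom M l :
  boxcov [set x : dom | `|x| <= 1 /\ ~ tree_dom M l x] (((mu ^+ 2) ^+ d.+1) ^+ M * 2 ^+ d.+1).
Proof.
elim: M l => [|M IH] l.
  exists [:: (const_mx (-1), const_mx 1)]; split.
  - by move=> p; rewrite inE => /eqP -> j; rewrite !mxE; lra.
  - move=> x [x1 _]; exists (const_mx (-1), const_mx 1); first by rewrite inE.
    by move=> j; rewrite !mxE -ler_norml (le_trans (norm_coord x j)).
  - rewrite big_seq1 expr0 mul1r /box_vol (eq_bigr (fun=> 2)) => [|j _]; last by rewrite !mxE; lra.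
    by rewrite prodr_const card_ord.
have h b := @boxcov_affine R _ _ _ (fun j => cc j l)
  (fun j => if j == jl l then sg R b * mu / 2 else 0) (cc0 l) (IH l.+1).
have := boxcovU (h true) (h false); rewrite prod_cc => -[s [h1 h2 h3]].
exists s; split=> //; last first.
  apply: (le_trans h3); rewrite le_eqVlt; apply/orP; left; apply/eqP.
  set P := (mu ^+ 2) ^+ d.+1; rewrite [P ^+ M.+1]exprS -[RHS]mulrA.
  by move: P (P ^+ M * _) => P Q; field.
move=> x [x1 nx]; apply: h2.
have [b xb nb] : exists2 b, `|unh l b x| < 1 & ~ tree_dom M l.+1 (unh l b x).
  apply: contrapT => H; apply: nx; split=> // b xb; apply: contrapT => nb.
  by apply: H; exists b.
have H : exists2 y : dom, `|y| <= 1 /\ ~ tree_dom M l.+1 y &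
    forall j, x 0 j = cc j l * y 0 j + (if j == jl l then sg R b * mu / 2 else 0).
  by exists (unh l b x) => [|j]; [split=> //; exact: ltW|exact: unhole_affine].
by case: b xb nb H => _ _ H; [left|right].
Qed.

Lemma leb_null_not_tree_dom l : leb_null [set x : dom | `|x| <= 1 /\ forall M, ~ tree_dom M l x].
Proof.
apply: boxcov_null => eps e0.
have t01 : 0 <= (mu ^+ 2) ^+ d.+1 < 1.
  rewrite !exprn_ge0 ?(ltW mu0)//=; have /andP[_ m1] := mu01.
  by rewrite exprn_ilt1 ?exprn_ge0 ?(ltW mu0)// expr2 mulr_ilt1 ?(ltW mu0).
have [M hM] := pow_small t01 (exprn_ge0 d.+1 (ler0n R 2)) e0.
have [s [h1 h2 h3]] := boxcov_not_tree_dom M l; exists s; split=> //; last exact: le_trans h3 hM.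
by move=> x [x1 nx]; apply: h2; split.
Qed.

(** The exceptional set consists of the preimages of cell boundaries and of the exceptional sets of
    the blocks. At any other point the same cells stay in charge on a neighbourhood, where the map
    is one block composed with affine maps. *)
Lemma tree_map_adiff M l : exists2 N, leb_null N & forall x, `|x| < 1 -> tree_dom M l x -> ~ N x ->
  (\forall y \near x, tree_dom M l y) /\ forall i, differentiable (fun y => tree_map M l y 0 i) x.
Proof.
have cn (f : dom -> dom) : continuous f -> continuous (fun x => `|f x|).
  by move=> cf x; exact: (cvg_norm (cf x)).
have cu m b : continuous (unh m b) by exact: continuous_unhole.
have nlt (f : dom -> dom) x : continuous f -> `|f x| < 1 -> \forall y \near x, `|f y| < 1.
  by move=> cf h; have /(cn f cf x) := lt_nbhsl h.
have ngt (f : dom -> dom) x : continuous f -> 1 < `|f x| -> \forall y \near x, 1 < `|f y|.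
  by move=> cf h; have /(cn f cf x) := lt_nbhsr h.
have du m b x : differentiable (unh m b) x.
  apply: differentiable_row => j.
  pose f (y : dom) := (cc j m)^-1 * y 0 j - (cc j m)^-1 * (if j == jl m then sg R b * mu / 2 else 0).
  have -> : (fun y => unh m b y 0 j) = f.
    apply/funext => y; rewrite /f -mulrBr [y 0 j](unhole_affine m b) addrK mulKf//.
    by rewrite gt_eqF.
  apply: differentiableB; last exact: differentiable_cst.
  apply: differentiableM; first exact: differentiable_cst.
  exact: differentiable_coord.
elim: M l => [|M IH] l; first by exists set0; [exact: leb_null0|].
have [N' nN' HN'] := IH l.+1.
have [NG nNG HG] : exists2 N, leb_null N & forall i x, (holed mu (jl l) `\` hole_bd mu (jl l)) x -> ~ N x ->
    differentiable (fun y => G (il l) (jl l) y 0 i) x.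
  pose Q i N := leb_null N /\ forall x, (holed mu (jl l) `\` hole_bd mu (jl l)) x -> ~ N x ->
    differentiable (fun y => G (il l) (jl l) y 0 i) x.
  have /choice[F HF] : forall i, exists N, Q i N by move=> i; have [N ? ?] := Gd (il l) (jl l) i; exists N.
  exists [set x | exists i, F i x]; first by apply: leb_null_countable => i; exact: (HF i).1.
  by move=> i x xU nx; apply: (HF i).2 => // Fx; apply: nx; exists i.
pose N := NG `|` [set x | exists b, (N' `|` sup_sphere dom) (unh l b x)].
exists N.
  apply: leb_nullU => //; apply: leb_null_countable => b.
  by apply: leb_null_hole; apply: leb_nullU => //; exact: leb_null_sup_sphere.
move=> x x1 dx nNx.
have nb b : ~ N' (unh l b x) /\ `|unh l b x| <> 1.
  by split=> h; apply: nNx; right; exists b; [left|right].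
have x1n : \forall y \near x, `|y| < 1 by apply: (nlt id) => //; move=> ?; exact: cvg_id.
have [[b xb]|no] := pselect (exists b, `|unh l b x| < 1).
  have xbn := nlt _ _ (cu l b) xb.
  have [dn ddf] := HN' _ xb (dx.2 b xb) (nb b).1.
  have dnx : \forall y \near x, tree_dom M l.+1 (unh l b y) by exact: (cu l b x).
  split.
    near=> y; split; first by apply/ltW; near: y.
    move=> c yc; have yb : `|unh l b y| < 1 by near: y.
    rewrite -(@unhole_disj _ _ _ mu01 (jl l) b c y (ltW yb) (ltW yc)); near: y; exact: dnx.
  move=> i; pose f y := half (il l) b (tree_map M l.+1 (unh l b y)) 0 i.
  have df : differentiable f x.
    have dt : differentiable (fun y => tree_map M l.+1 (unh l b y) 0 i) x.
      by apply: (@differentiable_comp _ _ _ _ (unh l b) (fun z => tree_map M l.+1 z 0 i)).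
    have [li|li] := boolP (i == il l); last first.
      by have -> : f = fun y => tree_map M l.+1 (unh l b y) 0 i by apply/funext => y; rewrite /f mxE (negbTE li).
    have -> : f = fun y => (tree_map M l.+1 (unh l b y) 0 i + sg R b) / 2 by apply/funext => y; rewrite /f mxE li.
    apply: differentiableM; last exact: differentiable_cst.
    by apply: differentiableD => //; exact: differentiable_cst.
  apply: (differentiable_near _ df).1.
  by near=> y; rewrite /f (tree_map_hole _ (b := b))//; near: y.
have out b : 1 < `|unh l b x|.
  rewrite lt_neqAle leNgt; apply/andP; split; first by apply/eqP => h; apply: (nb b).2.
  by apply/negP => h; apply: no; exists b.
have outn : \forall y \near x, forall b, 1 <= `|unh l b y|.
  have nt := ngt _ _ (cu l true) (out true); have nf := ngt _ _ (cu l false) (out false).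
  by near=> y; case; apply/ltW; near: y.
split; first by near=> y; apply: tree_dom_out; [apply/ltW; near: y|near: y].
move=> i; apply: (differentiable_near _ (HG i x _ _)).1.
- by near=> y; rewrite tree_map_out//; near: y.
- split; first by split; [exact: ltW|move=> b; exact: (ltW (out b))].
  case=> _ [h|[b h]]; first by move: x1; rewrite h ltxx.
  by have := out b; rewrite /unh h ltxx.
- by move=> h; apply: nNx; left.
Unshelve. all: by end_near.
Qed.

(** No limit is taken: the recursion stops at a finite depth, the value does not depend on the depth
    chosen ([tree_mono]), and 0 elsewhere is a default. *)
Let lim_map (x : dom) : cod := if pselect (exists M, tree_dom M 0 x) is left h then tree_map (sval (cid h)) 0 x else 0.

Let lim_mapE M x : tree_dom M 0 x -> lim_map x = tree_map M 0 x.
Proof.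
move=> dx; rewrite /lim_map; case: pselect => [h|[]]; last by exists M.
case: (cid h) => M' dx' /=.
have [_ <-] := tree_mono (leq_maxl M M') dx.
by have [_ <-] := tree_mono (leq_maxr M M') dx'.
Qed.

Lemma tree_fill : (e < d)%N -> 2^-1 <= (mu ^+ 2) ^+ (e.+1 * d.+1) ->
  exists (g : dom -> cod) (Om : set dom), [/\
    forall x y, Om x -> Om y -> `|g x - g y| <= 4 * K * `|x - y|,
    forall x, `|x| = 1 -> Om x /\ g x = B x,
    forall x, Om x -> `|x| <= 1 /\ exists i q, g x 0 i = ratr q,
    leb_null [set x | `|x| <= 1 /\ ~ Om x] &
    exists2 N, leb_null N & forall x, `|x| < 1 -> Om x -> ~ N x ->
      (\forall y \near x, Om y) /\ forall i, differentiable (fun y => g y 0 i) x].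
Proof.
move=> ed lam2; have /andP[_ m1] := mu01.
have lam0 : 0 < mu ^+ 2 by rewrite exprn_gt0.
have lam1 : mu ^+ 2 <= 1 by rewrite expr2 mulr_ile1// ltW.
exists lim_map, [set x | exists M, tree_dom M 0 x]; split.
- move=> x y [M dx] [M' dy].
  have [dx' tx] := tree_mono (leq_maxl M M') dx; have [dy' ty] := tree_mono (leq_maxr M M') dy.
  rewrite (lim_mapE dx') (lim_mapE dy').
  apply: norm_le => [|i]; first by rewrite !mulr_ge0.
  pose a (i : 'I_e.+1) l := cut_weight R e i l.
  pose dd (j : 'I_d.+1) l := (mu ^+ 2) ^+ l * cut_weight R d j l.
  have jlE l (j : 'I_d.+1) : (j == jl l) = (j == (l %% d.+1)%N :> nat).
    by rewrite -val_eqE /= inordK// ltn_mod.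
  have ilE l (j : 'I_e.+1) : (j == il l) = (j == (l %% e.+1)%N :> nat).
    by rewrite -val_eqE /= inordK// ltn_mod.
  have a0 i' l : 0 < a i' l by exact: cut_weight_gt0.
  have aS i' l : a i' l.+1 = a i' l * (if i' == il l then 2^-1 else 1).
    by rewrite ilE; apply: cut_weightS; exact: leq_ord.
  have dS j l : dd j l.+1 = dd j l * (mu ^+ 2 * (if j == jl l then 2^-1 else 1)).
    by rewrite /dd jlE (cut_weightS _ _ (leq_ord j)) exprSr; case: ifP => _; ring.
  have ad i' j l : K * a i' l <= 4 * K * dd j l.
    rewrite [4 * K]mulrC -mulrA; apply: ler_wpM2l => //.
    by apply: cut_weight_le => //; exact: leq_ord.
  have C0 : 0 <= 4 * K by rewrite mulr_ge0.
  have := @tree_map_lip a dd (4 * K) a0 aS dS ad C0 (maxn M M') 0 x y dx' dy' `|x - y|.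
  rewrite /a /dd => /(_ _ i); rewrite cut_weight0 mul1r rowBE; apply => j.
  by rewrite expr0 cut_weight0 !mul1r -rowBE; exact: norm_coord.
- move=> x x1; have d1 := tree_dom_sup_sphere 0 0 x1; split; first by exists 1%N.
  by rewrite (lim_mapE d1) tree_map_sup_sphere.
- move=> x [M dx]; split; first exact: tree_dom_norm dx.
  by rewrite (lim_mapE dx); exact: tree_map_rat.
- apply: leb_null_sub (leb_null_not_tree_dom 0) => x [x1 nx]; split=> // M dx; apply: nx; by exists M.
have /choice[N HN] : forall M, exists N, leb_null N /\ forall x, `|x| < 1 -> tree_dom M 0 x -> ~ N x ->
  (\forall y \near x, tree_dom M 0 y) /\ forall i, differentiable (fun y => tree_map M 0 y 0 i) x.
  by move=> M; have [N ? ?] := tree_map_adiff M 0; exists N.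
exists [set x | exists M, N M x]; first by apply: leb_null_countable => M; exact: (HN M).1.
move=> x x1 [M dx] nx; have [dn ddf] := (HN M).2 x x1 dx (fun h => nx (ex_intro _ M h)).
split; first by apply: filterS dn => y dy; exists M.
move=> i; apply: (differentiable_near _ (ddf i)).1.
by apply: filterS dn => y dy; rewrite (lim_mapE dy).
Qed.
End Tree.

(** * Rank and assembly *)

Section Rank.
Variable R : realType.

Lemma diff_dominated (V W W' : normedModType R) (f : V -> W) (g : V -> W') (x v : V) (L : R) :
  0 <= L -> (forall y, `|f y - f x| <= L * `|g y - g x|) ->
  differentiable f x -> differentiable g x -> 'd g x v = 0 -> 'd f x v = 0.
Proof.
move=> L0 fg df dg gv; apply/eqP; rewrite -normr_le0; apply/ler_addgt0Pl => e e0; rewrite addr0.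
have v1 : 0 < `|v| + 1 by rewrite ltr_wpDl.
have L1 : 0 < L + 1 by rewrite ltr_wpDl.
pose e' := e / ((L + 1) * (`|v| + 1)).
have e'0 : 0 < e' by rewrite divr_gt0// mulr_gt0.
have nf := differentiable_bound df e'0; have ng := differentiable_bound dg e'0.
have /nbhs_ex_ball[r r0 Hr] : \forall y \near x, `|f y - f x - 'd f x (y - x)| <= e' * `|y - x| /\
    `|g y - g x - 'd g x (y - x)| <= e' * `|y - x| by exact: (filterI nf ng).
pose t := r / 2 / (`|v| + 1).
have t0 : 0 < t by rewrite !divr_gt0.
have tv : `|t *: v| < r.
  rewrite normrZ gtr0_norm// /t mulrAC ltr_pdivrMr//.
  have := normr_ge0 v; nra.
have yx : x + t *: v - x = t *: v by rewrite addrAC subrr add0r.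
have := Hr (x + t *: v); rewrite yx => /(_ tv)[hf hg].
rewrite [X in _ - X]linearZ /= gv scaler0 subr0 in hg.
have := fg (x + t *: v).
have ht : `|t *: v| = t * `|v| by rewrite normrZ gtr0_norm.
have hd : `|'d f x (t *: v)| = t * `|'d f x v| by rewrite linearZ /= normrZ gtr0_norm.
have := ler_distD (f (x + t *: v) - f x) ('d f x (t *: v)) 0.
rewrite !subr0 distrC hd; rewrite !ht in hf hg; move: hf hg.
set a := `|f _ - f x - _|; set b := `|f _ - f x|; set c := `|g _ - _|; set q := `|'d f x v| => h1 h2 h3 h4.
have h5 : L * c <= L * (e' * (t * `|v|)) by rewrite ler_wpM2l.
have h6 : t * q <= t * ((L + 1) * e' * `|v|) by nra.
rewrite ler_pM2l// in h6; apply: (le_trans h6).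
have -> : (L + 1) * e' = e / (`|v| + 1) by rewrite /e'; field; rewrite !gt_eqF.
by rewrite mulrAC ler_pdivrMr// ler_pM2l// lerDl.
Qed.

Lemma rank_col0 m n (M : 'M[R]_(m, n.+1)) i : (forall l, M l i = 0) -> (\rank M <= n)%N.
Proof.
move=> Mi; rewrite -mxrank_tr.
have h : ((delta_mx 0 i : 'rV_n.+1) <= kermx M^T)%MS.
  by apply/sub_kermxP; rewrite -rowE; apply/rowP => l; rewrite !mxE.
by have := mxrankS h; rewrite mxrank_delta mxrank_ker subn_gt0 ltnS.
Qed.

Lemma rank_ker_le m n p (M : 'M[R]_(m, n)) (M' : 'M[R]_(m, p)) :
  (forall v : 'rV_m, v *m M' = 0 -> v *m M = 0) -> (\rank M <= \rank M')%N.
Proof.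
move=> H; have h : (kermx M' <= kermx M)%MS.
  apply/row_subP => i; apply/sub_kermxP/H; apply/sub_kermxP; exact: row_sub.
by have := mxrankS h; rewrite !mxrank_ker leq_sub2lE// rank_leq_row.
Qed.
End Rank.

Lemma radZ (R : realType) d (c : R) (x : 'rV[R]_d) : 0 < c -> rad (c *: x) = rad x.
Proof.
move=> c0; rewrite /rad enormZ gtr0_norm// invfM scalerA mulrAC mulVf ?mul1r//.
by rewrite gt_eqF.
Qed.

(** * The radial map of the cube onto the ball *)

Section CubeToSphere.
Variables (R : realType) (d : nat).
Implicit Types x y : 'rV[R]_d.

(* The inverse of [cubify], extended by homogeneity from the unit sphere to all of [R^d] (with value [0] at [0]). *)
Definition spherify x : 'rV[R]_d := (`|x| / enorm x) *: x.

Let ratio_le1 x : 0 <= `|x| / enorm x <= 1.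
Proof.
rewrite divr_ge0 ?enorm_ge0//=; have [->|x0] := eqVneq x 0; first by rewrite normr0 mul0r.
by rewrite ler_pdivrMr ?mul1r ?norm_le_enorm// enorm_gt0.
Qed.

Let ratioM x : `|x| / enorm x * enorm x = `|x|.
Proof.
have [->|x0] := eqVneq x 0; first by rewrite normr0 !mul0r.
by rewrite divfK// gt_eqF// enorm_gt0.
Qed.

Lemma norm_spherify x : `|spherify x| <= `|x|.
Proof.
have /andP[s0 s1] := ratio_le1 x.
by rewrite normrZ ger0_norm// ler_piMl.
Qed.

Lemma spherify_lip x y : `|spherify x - spherify y| <= (d%:R + 2) * `|x - y|.
Proof.
have /andP[s0 s1] := ratio_le1 x; have /andP[s0' s1'] := ratio_le1 y.
have := ratioM x; have := ratioM y; rewrite /spherify.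
move: s0 s1 s0' s1'; set s := `|x| / _; set s' := `|y| / _ => s0 s1 s0' s1' hy hx.
have -> : s *: x - s' *: y = s *: (x - y) + (s - s') *: y.
  by rewrite scalerBr scalerBl addrA subrK.
apply: le_trans (ler_normD _ _) _; rewrite (normrZ s) (normrZ (s - s')) (ger0_norm s0).
have h1 : s * `|x - y| <= `|x - y| by rewrite ler_piMl.
have h2 : `|s - s'| * `|y| <= `|s - s'| * enorm y by rewrite ler_wpM2l// norm_le_enorm.
have h3 : `|s - s'| * enorm y = `|s * (enorm y - enorm x) + (`|x| - `|y|)|.
  by rewrite -[X in _ * X](ger0_norm (enorm_ge0 y)) -normrM -hx -hy; congr `|_|; ring.
have h4 := ler_normD (s * (enorm y - enorm x)) (`|x| - `|y|).
have h5 : `|s * (enorm y - enorm x)| <= d%:R * `|x - y|.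
  rewrite normrM (ger0_norm s0) distrC; apply: le_trans (enorm_lip x y).
  by rewrite ler_piMl.
have h6 := ler_dist_dist x y.
by rewrite mulrDl; lra.
Qed.

Lemma spherifyK x : enorm x = 1 -> spherify (cubify x) = x.
Proof.
move=> x1; have x0 := sphere_neq0 x1; have n0 : 0 < `|x| by rewrite normr_gt0.
rewrite /spherify norm_cubify// enormZ x1 mulr1 gtr0_norm ?invr_gt0// invrK mul1r.
by rewrite scalerA divff ?scale1r// gt_eqF.
Qed.
End CubeToSphere.

Section DiffSpherify.
Variables (R : realType) (d m : nat) (Om : set 'rV[R]_d.+1) (F : 'rV[R]_d.+1 -> 'rV[R]_m.+1).

Lemma differentiable_sqrt (x : R) : 0 < x -> differentiable (@Num.sqrt R) x.
Proof. by move=> x0; apply/derivable1_diffP; have [] := is_derive1_sqrt x0. Qed.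

(** At almost every zero of [F] all its coordinates have derivative 0, and since [spherify] does not
    increase the sup norm, the composite has derivative 0 there; elsewhere it is an explicit
    quotient with nonzero denominator. *)
Lemma adiff_spherify : (forall i, adiff Om (fun x => F x 0 i)) ->
  exists2 N, leb_null N & forall x, Om x -> ~ N x -> differentiable F x /\ differentiable (fun y => spherify (F y)) x.
Proof.
move=> aF; have [N0 nN0 H0] := adiff_mxnorm aF.
have /choice[N HN] : forall i, exists N, leb_null N /\ forall x, Om x -> ~ N x ->
    differentiable (fun x => F x 0 i) x /\ (F x 0 i = 0 -> 'd (fun x => F x 0 i) x = (fun=> 0) :> (_ -> _)).
  by move=> i; have [N ? ?] := adiff_zero (aF i); exists N.
exists (N0 `|` [set x | exists i, N i x]).
  by apply: leb_nullU => //; apply: leb_null_countable => i; exact: (HN i).1.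
move=> x Ox /not_orP[x0 xN]; have dm := H0 x Ox x0.
have dF i : differentiable (fun x => F x 0 i) x /\ (F x 0 i = 0 -> 'd (fun x => F x 0 i) x = (fun=> 0) :> (_ -> _)).
  by apply: (HN i).2 => // h; apply: xN; exists i.
split; first by apply: differentiable_row => i; exact: (dF i).1.
have [Fx0|Fx0] := eqVneq (F x) 0.
  apply: (proj1 (differentiable_small _)) => e e0.
  have /filter_forall nF : forall i, \forall y \near x, `|F y 0 i| <= e * `|y - x|.
    move=> i; have [di d0] := dF i.
    have Fi : F x 0 i = 0 by rewrite Fx0 mxE.
    have := differentiable_bound di e0; apply: filterS => y.
    by rewrite Fi d0// !subr0.
  apply: filterS nF => y hy /=.
  rewrite Fx0 /spherify scaler0 subr0; apply: le_trans (norm_spherify _) _.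
  by apply: norm_le => //; rewrite mulr_ge0// ltW.
apply: differentiable_row => i.
have -> : (fun y => spherify (F y) 0 i) = (fun y => `|F y| / enorm (F y) * F y 0 i).
  by apply/funext => y; rewrite /= mxE.
apply: differentiableM; last exact: (dF i).1.
apply: differentiableM => //.
apply: differentiableV; last by rewrite gt_eqF// enorm_gt0.
apply: (@differentiable_comp _ _ _ _ (fun y => \sum_(i < m.+1) F y 0 i ^+ 2) (@Num.sqrt R)).
  have -> : (fun y => \sum_(i < m.+1) F y 0 i ^+ 2) = \sum_(i < m.+1) ((fun y => F y 0 i) * (fun y => F y 0 i)).
    by apply/funext => y; rewrite fct_sumE; apply: eq_bigr => l _; rewrite expr2.
  by apply: differentiable_sum => l; apply: differentiableM; exact: (dF l).1.
by apply: differentiable_sqrt; rewrite -enorm_sqr exprn_gt0// enorm_gt0.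
Qed.
End DiffSpherify.

Lemma lip_cont_on (R : realType) (V W : normedModType R) (S : set V) (f : V -> W) (K : R) : 0 <= K ->
  (forall x y, S x -> S y -> `|f x - f y| <= K * `|x - y|) -> cont_on S f.
Proof.
move=> K0 fK x Sx; apply/cvgrPdist_lt => e e0.
have d0 : 0 < e / (K + 1) by rewrite divr_gt0// ltr_wpDl.
have : \forall y \near x, `|x - y| < e / (K + 1) by exact: cvgr_dist_lt.
rewrite /within /=; apply: filterS => y xy Sy.
apply: (le_lt_trans (fK _ _ Sx Sy)); rewrite ltr_pdivlMr ?ltr_wpDl// in xy.
by have := normr_ge0 (x - y); move: xy; nra.
Qed.

(** * The inner cube, the shell around it and their union *)

Section Fillings.
Variables (R : realType) (k n : nat).
Local Notation dom := ('rV[R]_(1 + k.+1)).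
Local Notation cod := ('rV[R]_(1 + n.+1)).
Variable beta : dom -> cod.
Hypothesis bS : forall x, sphere k.+1 x -> sphere n.+1 (beta x).
Hypothesis bL : lip_on (sphere k.+1) beta.

Lemma cube_fill : (n < k)%N -> cond_star (k := k.+1) (n := n.+1) beta ->
  exists (K : R) (g : dom -> cod) (Om : set dom), 0 <= K /\ [/\
    forall x y, Om x -> Om y -> `|g x - g y| <= K * `|x - y|,
    forall x, `|x| = 1 -> Om x /\ g x = cubify (beta (rad x)),
    forall x, Om x -> `|x| <= 1 /\ exists i q, g x 0 i = ratr q,
    leb_null [set x | `|x| <= 1 /\ ~ Om x] &
    exists2 N, leb_null N & forall x, `|x| < 1 -> Om x -> ~ N x ->
      (\forall y \near x, Om y) /\ forall i, differentiable (fun y => g y 0 i) x].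
Proof.
(* With [mu = 1 - t] and [t = 1 / (4 p)], Bernoulli's inequality gives
   [mu^(2 p) >= 1 - 2 p t = 1/2], the bound that [tree_fill] requires. *)
move=> nk cs; pose p : nat := (n.+2 * k.+2)%N; pose t : R := (4 * p%:R)^-1.
have p0 : 0 < p%:R :> R by rewrite ltr0n.
have p1 : 1 <= p%:R :> R by rewrite ler1n.
have t0 : 0 < t by rewrite invr_gt0 mulr_gt0.
have pt : p%:R * t = 4^-1 by rewrite /t; field; rewrite gt_eqF.
have t1 : t < 1.
  have : t <= p%:R * t by rewrite ler_peMl// ltW.
  rewrite pt; lra.
have mu01 : 0 < 1 - t < 1 by rewrite subr_gt0 t1/= ltrBlDr ltrDl.
have lam : 2^-1 <= ((1 - t) ^+ 2) ^+ p.
  rewrite -exprM; apply: (le_trans _ (pow_onem_ge _ _)); last by rewrite !ltW.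
  by rewrite natrM -mulrA pt; lra.
have /choice[G HG] : forall ij : 'I_(1 + n.+1) * 'I_(1 + k.+1), exists G : dom -> cod, [/\
    exists2 K : R, 0 <= K & forall x y, holed (1 - t) ij.2 x -> holed (1 - t) ij.2 y -> `|G x - G y| <= K * `|x - y|,
    forall x, `|x| = 1 -> G x = cubify (beta (rad x)),
    forall c x, `|x| = 1 -> G (hole (1 - t) ij.2 c x) = half ij.1 c (cubify (beta (rad x))),
    forall x, holed (1 - t) ij.2 x -> exists l, [\/ G x 0 l = -1, G x 0 l = 0 | G x 0 l = 1] &
    forall l, adiff (holed (1 - t) ij.2 `\` hole_bd (1 - t) ij.2) (fun x => G x 0 l)].
  by case=> i j; exact: block cs bS bL mu01.
have /choice[K HK] : forall ij, exists K : R, 0 <= K /\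
    forall x y, holed (1 - t) ij.2 x -> holed (1 - t) ij.2 y -> `|G ij x - G ij y| <= K * `|x - y|.
  by move=> ij; have [[K K0 h] _ _ _ _] := HG ij; exists K.
have [L L0 HL] := seq_upper (enum {: 'I_(1 + n.+1) * 'I_(1 + k.+1)}) K.
have GL i j x y : holed (1 - t) j x -> holed (1 - t) j y -> `|G (i, j) x - G (i, j) y| <= L * `|x - y|.
  move=> hx hy; apply: (le_trans ((HK (i, j)).2 _ _ hx hy)); apply: ler_wpM2r => //.
  by apply: HL; rewrite mem_enum.
have [g [Om H]] := @tree_fill R k.+1 n.+1 (1 - t) (fun x => cubify (beta (rad x))) (fun i j => G (i, j)) L
  mu01 L0 GL (fun i j => let: And5 _ h _ _ _ := HG (i, j) in h)
  (fun i j => let: And5 _ _ h _ _ := HG (i, j) in h) (fun i j => let: And5 _ _ _ h _ := HG (i, j) in h)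
  (fun i j => let: And5 _ _ _ _ h := HG (i, j) in h) nk lam.
exists (4 * L), g, Om; split=> //; by rewrite mulr_ge0.
Qed.

(** [cubify (beta (rad x))] already fits both boundaries and has sup norm 1, hence a coordinate 1 or
    -1. It is smoothed because [beta] is not known to be differentiable anywhere, and then divided
    by its sup norm. The choice of [a] puts the cube [|x| <= a] inside the ball of radius 1/2. *)
Lemma shell_fill (a : R) : a * k.+2%:R = 2^-1 ->
  exists (K : R) (g : dom -> cod), 0 <= K /\ [/\
    forall x y, enorm x <= 1 -> a <= `|x| -> enorm y <= 1 -> a <= `|y| -> `|g x - g y| <= K * `|x - y|,
    forall x, enorm x = 1 \/ `|x| = a -> g x = cubify (beta (rad x)),
    forall x, enorm x <= 1 -> a <= `|x| -> `|g x| = 1 &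
    forall i, adiff [set x | enorm x < 1 /\ a < `|x|] (fun x => g x 0 i)].
Proof.
move=> aD; pose D : R := k.+2%:R.
have D2 : 2 <= D by rewrite ler_nat.
have D0 : 0 < D by lra.
have a0 : 0 < a by rewrite -(pmulr_lgt0 _ D0) aD.
have a4 : a <= 4^-1 by have := aD; rewrite -/D; nra.
pose U : set dom := [set x | enorm x <= 1 /\ a <= `|x|].
pose A : set dom := [set x | U x /\ (enorm x = 1 \/ `|x| = a)].
have cU : closed U.
  have -> : U = [set x | enorm x <= 1] `&` [set x | a <= `|x|] by [].
  apply: closedI; first by apply: closed_preimage_le; exact: continuous_enorm.
  by apply: closed_preimage_ge; exact: norm_continuous.
have kU : compact U.
  apply: (@bounded_closed_compactP _ _ _ 1) => // x [x1 _]; exact: le_trans (norm_le_enorm x) x1.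
have cA : closed A.
  have -> : A = U `&` ([set x | enorm x = 1] `|` [set x | `|x| = a]) by [].
  apply: closedI => //; apply: closedU; apply: closed_preimage_eq; first exact: continuous_enorm.
  exact: norm_continuous.
have AU : A `<=` U by move=> x [].
have [K K0 HK] := sphere_map_lip bS bL.
have n0 (x : dom) : a <= `|x| -> x != 0.
  by move=> ax; rewrite -normr_gt0; exact: lt_le_trans ax.
have cf : cont_on U (fun x => cubify (beta (rad x))).
  apply: (cont_on_eq (f := fun x => cubify (beta (rad (rad x))))).
    by move=> x [_ /n0 x0]; rewrite (rad_id (enorm_rad x0)).
  apply: (@cont_on_comp _ _ _ _ (sphere k.+1) (@rad R (1 + k.+1)) (fun x => cubify (beta (rad x)))).
  - by apply: cont_on_sub (@cont_on_rad R (1 + k.+1)) => x [_ /n0].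
  - by move=> x [_ /n0 x0]; exact: enorm_rad.
  apply: (lip_cont_on K0) => x y x1 y1; apply: HK; rewrite ?x1 ?y1//.
  by rewrite -x1; exact: norm_le_enorm.
have radZa (x : dom) : rad (a^-1 *: x) = rad x by apply: radZ; rewrite invr_gt0.
have eta0 : 0 < a by [].
have fL x y : A x -> A y -> `|x - y| < a ->
    `|cubify (beta (rad x)) - cubify (beta (rad y))| <= (K + K / a) * `|x - y|.
  (* A Euclidean unit vector has sup norm at least [1 / D = 2 a], so the two boundary components are
     at least [a] apart. *)
  have mix (u v : dom) : enorm u = 1 -> `|v| = a -> ~ `|u - v| < a.
    move=> u1 va uv; have := enorm_le u; rewrite u1.
    have := ler_normD (u - v) v; rewrite subrK va => h1 h2.
    have h3 : `|u| < 2 * a by lra.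
    have h4 : D * `|u| < 1 by have := aD; rewrite -/D; nra.
    by rewrite -/D in h2; lra.
  have Ka : 0 <= K / a by rewrite divr_ge0// ltW.
  have nn := normr_ge0 (x - y).
  move=> [_ [x1|xa]] [_ [y1|ya]] xy.
  - rewrite mulrDl; apply: (@le_trans _ _ (K * `|x - y|)); last by rewrite lerDl mulr_ge0.
    by apply: HK; rewrite ?x1 ?y1// -x1; exact: norm_le_enorm.
  - by case: (mix x y).
  - by case: (mix y x) => //; rewrite distrC.
  rewrite mulrDl; apply: (@le_trans _ _ (K / a * `|x - y|)); last by rewrite lerDr mulr_ge0.
  have sc (u : dom) : `|u| = a -> `|a^-1 *: u| = 1.
    by move=> ua; rewrite normrZ ua gtr0_norm ?invr_gt0// mulVf// gt_eqF.
  rewrite -(radZa x) -(radZa y); apply: le_trans (HK _ _ _ _ _) _.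
  - by rewrite -(sc x xa); exact: norm_le_enorm.
  - by rewrite -(sc y ya); exact: norm_le_enorm.
  - by rewrite sc.
  by rewrite -scalerBr normrZ gtr0_norm ?invr_gt0// mulrA.
have f1 x : U x -> `|cubify (beta (rad x))| = 1.
  by move=> [_ /n0 x0]; apply: norm_cubify; apply: sphere_neq0; apply: bS; exact: enorm_rad.
have [g [ng gA g1]] := smooth_cubify kU cA AU cf eta0 fL f1.
have /choice[L HL] : forall i, exists L : R, forall x y, U x -> U y -> `|g x 0 i - g y 0 i| <= L * `|x - y|.
  by move=> i; have [[L _ h] _ _] := ng i; exists L.
have [M M0 HM] := seq_upper (enum 'I_(1 + n.+1)) L.
exists M, g; split=> //; split.
- move=> x y x1 xa y1 ya; apply: norm_le => [|i]; first by rewrite mulr_ge0.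
  rewrite rowBE; apply: (le_trans (HL i x y _ _)) => //.
  by apply: ler_wpM2r => //; apply: HM; rewrite mem_enum.
- move=> x h; apply: gA; split=> //; split; last first.
    by case: h => [x1|->//]; have := enorm_le x; rewrite x1 -/D; have := aD; rewrite -/D; nra.
  case: h => [->//|xa]; apply: le_trans (enorm_le x) _; rewrite xa -/D mulrC aD; lra.
- by move=> x x1 xa; apply: g1.
- move=> i; have [_ _ [N nN HN]] := ng i; exists N => // x [x1 xa] Nx; apply: HN => //.
  split; first by split; exact: ltW.
  by move=> [_ [h|h]]; [move: x1|move: xa]; rewrite h ltxx.
Qed.
End Fillings.

Lemma diff_coord_eq0 (R : realType) (V : normedModType R) m (F : V -> 'rV[R]_m) (x v : V) i (c : R) :
  differentiable F x -> differentiable (fun y => F y 0 i) x -> 'd (fun y => F y 0 i - c) x v = 0 ->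
  'd F x v 0 i = 0.
Proof.
move=> dF di; have dc : differentiable (fun y => F y 0 i - c) x.
  exact: differentiableB di (differentiable_cst _ _).
rewrite -!deriveE// derive_mx; last exact: diff_derivable.
rewrite mxE => <-; rewrite (@deriveB _ _ _ (fun y => F y 0 i) (cst c)); first by rewrite derive_cst subr0.
  exact: diff_derivable.
by apply: diff_derivable; exact: differentiable_cst.
Qed.

Section RankSpherify.
Variables (R : realType) (d m : nat) (T Om : set 'rV[R]_d.+1) (F : 'rV[R]_d.+1 -> 'rV[R]_m.+1).

(* Almost everywhere some coordinate of [F] equals a rational [q] with derivative [0]: each set
   [F_i = q] meets the points where [F_i] has nonzero derivative in a null set. *)
Lemma spherify_rank : (forall i, adiff Om (fun x => F x 0 i)) ->
  (forall x, Om x -> T x) -> (forall x, T x -> exists i q, F x 0 i = ratr q) ->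
  exists2 N, leb_null N & forall x, Om x -> ~ N x ->
    differentiable (fun y => spherify (F y)) x /\
    (\rank (lin1_mx ('d (fun y => spherify (F y)) x)) <= m)%N.
Proof.
move=> aF OT Tq; have [N0 nN0 H0] := adiff_spherify aF.
have /choice[N1 HN1] : forall i, exists N, leb_null N /\ forall x, Om x -> ~ N x -> differentiable (fun x => F x 0 i) x.
  by move=> i; have [N ? ?] := aF i; exists N.
pose Z (p : 'I_m.+1 * rat) := [set x | F x 0 p.1 - ratr p.2 = 0 /\
  differentiable (fun y => F y 0 p.1 - ratr p.2) x /\ exists v, 'd (fun y => F y 0 p.1 - ratr p.2) x v <> 0].
exists ((N0 `|` [set x | exists i, N1 i x]) `|` [set x | exists p, Z p x]).
  apply: leb_nullU; last by apply: leb_null_countable => p; exact: leb_null_zero_diff.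
  by apply: leb_nullU => //; apply: leb_null_countable => i; exact: (HN1 i).1.
move=> x Ox /not_orP[/not_orP[x0 x1] x2]; have [dF dS] := H0 x Ox x0; split=> //.
have [i [q iq]] := Tq x (OT x Ox).
have di : differentiable (fun y => F y 0 i) x by apply: (HN1 i).2 => // h; apply: x1; exists i.
have Fi0 v : 'd F x v 0 i = 0.
  apply: (@diff_coord_eq0 _ _ _ _ _ _ _ (ratr q)) => //; apply: contrapT => h; apply: x2; exists (i, q).
  split; first by rewrite /= iq subrr.
  by split; [exact: differentiableB di (differentiable_cst _ _)|exists v].
have r1 : (\rank (lin1_mx ('d F x)) <= m)%N.
  by apply: (@rank_col0 _ _ _ _ i) => l; rewrite mxE Fi0.
apply: (leq_trans _ r1); apply: (@rank_ker_le R _ _ _ (lin1_mx ('d (fun y => spherify (F y)) x)) (lin1_mx ('d F x))) => v vF.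
have {}vF : 'd F x v = 0 by rewrite -vF (mul_rV_lin1 ('d F x)).
apply: (etrans (mul_rV_lin1 ('d (fun y => spherify (F y)) x) v)).
have L0 : 0 <= m.+1%:R + 2 :> R by rewrite addr_ge0.
by apply: (diff_dominated L0 _ dS dF vF) => y; exact: spherify_lip.
Qed.
End RankSpherify.

Section Assembly.
Variables (R : realType) (k n : nat).
Local Notation dom := ('rV[R]_(1 + k.+1)).
Local Notation cod := ('rV[R]_(1 + n.+1)).
Variable beta : dom -> cod.
Hypothesis bS : forall x, sphere k.+1 x -> sphere n.+1 (beta x).
Hypothesis bL : lip_on (sphere k.+1) beta.

Lemma cubified_filling : (n < k)%N -> cond_star (k := k.+1) (n := n.+1) beta ->
  exists (T : set dom) (C : R) (F : dom -> cod), 0 <= C /\ [/\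
    forall x y, `|F x - F y| <= C * `|x - y|,
    forall x, enorm x = 1 -> F x = cubify (beta x),
    forall x, T x -> exists i q, F x 0 i = ratr q &
    exists2 N, leb_null N & forall x, enorm x < 1 -> ~ N x ->
      T x /\ forall i, differentiable (fun y => F y 0 i) x].
Proof.
move=> nk cs; pose D : R := k.+2%:R; pose a : R := (2 * D)^-1.
have D2 : 2 <= D by rewrite ler_nat.
have D0 : 0 < D by lra.
have aD : a * D = 2^-1 by rewrite /a; field; rewrite gt_eqF.
have a0 : 0 < a by rewrite invr_gt0 mulr_gt0.
have an0 : a != 0 by rewrite gt_eqF.
have [K1 [g1 [Om [K10 [L1 b1 q1 n1 [N1 nN1 d1]]]]]] := cube_fill bS bL nk cs.
have [K2 [g2 [K20 [L2 b2 s2 d2]]]] := shell_fill bS bL aD.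
have ai0 : 0 < a^-1 by rewrite invr_gt0.
have ns (x : dom) : `|a^-1 *: x| = `|x| / a by rewrite normrZ (gtr0_norm ai0) mulrC.
have ns1 (x : dom) : (`|a^-1 *: x| <= 1) = (`|x| <= a) by rewrite ns ler_pdivrMr// mul1r.
have ns2 (x : dom) : (`|a^-1 *: x| = 1) -> `|x| = a.
  by rewrite ns => h; rewrite -[LHS](divfK an0) h mul1r.
have small (x : dom) : `|x| <= a -> enorm x < 1.
  by move=> xa; apply: le_lt_trans (enorm_le x) _; have := aD; rewrite -/D; nra.
pose h (x : dom) : cod := if `|x| < a then g1 (a^-1 *: x) else g2 x.
pose T : set dom := [set x | enorm x <= 1 /\ (`|x| <= a -> Om (a^-1 *: x))].
have hout x : a <= `|x| -> h x = g2 x by move=> ax; rewrite /h ltNge ax.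
have hin x : `|x| <= a -> h x = g1 (a^-1 *: x).
  rewrite le_eqVlt => /orP[/eqP xa|xa]; last by rewrite /h xa.
  by rewrite hout ?xa// b2; [rewrite (b1 _ _).2 ?(radZ _ ai0)// ns xa divff|right].
have cf : continuous (fun z : dom => a^-1 *: z) by move=> z; exact: scaler_continuous.
have K1a : 0 <= K1 / a by rewrite divr_ge0// ltW.
pose C := K1 / a + K2.
have C0 : 0 <= C by rewrite addr_ge0.
have Lin x y : T x -> T y -> `|x| <= a -> `|y| <= a -> `|h x - h y| <= K1 / a * `|x - y|.
  move=> [_ Tx] [_ Ty] xa ya; rewrite !hin//; apply: (le_trans (L1 _ _ (Tx xa) (Ty ya))).
  by rewrite -scalerBr ns mulrA mulrAC.
have Lout x y : T x -> T y -> a <= `|x| -> a <= `|y| -> `|h x - h y| <= K2 * `|x - y|.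
  by move=> [Tx _] [Ty _] xa ya; rewrite !hout//; exact: L2.
have LC x y : T x -> T y -> `|h x - h y| <= C * `|x - y|.
  move=> Tx Ty; wlog xy : x y Tx Ty / `|x| <= `|y|.
    move=> W; have [|/ltW] := leP `|x| `|y|; first exact: W.
    by move=> yx; rewrite distrC [X in _ <= _ * X]distrC; exact: W.
  have nn := normr_ge0 (x - y).
  have [ya|/ltW ya] := leP `|y| a.
    apply: (le_trans (Lin _ _ Tx Ty (le_trans xy ya) ya)).
    by rewrite mulrDl lerDl mulr_ge0.
  have [xa|/ltW xa] := leP `|x| a; last first.
    by apply: (le_trans (Lout _ _ Tx Ty xa ya)); rewrite mulrDl lerDr mulr_ge0.
  have ya' : 1 <= `|a^-1 *: y| by rewrite ns ler_pdivlMr// mul1r.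
  have xa' : `|a^-1 *: x| <= 1 by rewrite ns1.
  (* The segment is cut where it meets the interface [|z| = a], which lies in [T] and where the
     formulas for cube and shell agree. *)
  have [t /andP[t0 t1] hz] := segment_cross cf xa' ya'.
  have za := ns2 _ hz; have [Oz _] := b1 _ hz; set z := x + _ in za Oz.
  have Tz : T z by split=> //; apply/ltW/small; rewrite za.
  have xz : `|x - z| = t * `|x - y|.
    by rewrite /z opprD addNKr normrN normrZ ger0_norm// distrC.
  have zy : `|z - y| = (1 - t) * `|x - y|.
    have -> : z - y = (1 - t) *: (x - y).
      by rewrite /z scalerBl scale1r -[y - x]opprB scalerN addrAC.
    by rewrite normrZ ger0_norm ?subr_ge0.
  have e1 := Lin x z Tx Tz xa; rewrite za xz in e1.
  have e2 := Lout z y Tz Ty; rewrite za zy in e2.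
  apply: le_trans (ler_distD (h z) _ _) _; apply: (le_trans (lerD (e1 (lexx _)) (e2 (lexx _) ya))).
  rewrite /C [leRHS]mulrDl !mulrA; apply: lerD; apply: ler_wpM2r => //.
    by rewrite ler_piMr.
  by rewrite ler_piMr// lerBlDr lerDl.
(* Off [T] the values of [h] mean nothing, so each coordinate is extended from [T] with the same
   Lipschitz constant. Differentiability is unaffected, being claimed only at points with a
   neighbourhood in [T]. *)
have /choice[F HF] : forall i, exists f : dom -> R, (forall x, T x -> f x = h x 0 i) /\
    forall x y, `|f x - f y| <= C * `|x - y|.
  move=> i; have [|f f1 f2] := @mcshane R _ T (fun x => h x 0 i) C _ C0; last by exists f.
  move=> x y Tx Ty; apply: le_trans (LC _ _ Tx Ty); rewrite -rowBE; exact: norm_coord.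
have FT x : T x -> (\row_i F i x : cod) = h x.
  by move=> Tx; apply/rowP => i; rewrite mxE (HF i).1.
have Ts (x : dom) : enorm x = 1 -> a < `|x|.
  by move=> x1; rewrite ltNge; apply/negP => /small; rewrite x1 ltxx.
exists T, C, (fun x => \row_i F i x); split=> //; split.
- move=> x y; apply: norm_le => [|i]; first by rewrite mulr_ge0.
  by rewrite rowBE !mxE; exact: (HF i).2.
- move=> x x1; have xa := Ts x x1.
  rewrite FT; last by split=> [|]; rewrite ?x1// leNgt xa.
  by rewrite hout ?ltW// b2 ?rad_id//; left.
- move=> x Tx; rewrite FT//; have [xa|xa] := leP `|x| a.
    by rewrite hin//; exact: (q1 _ (Tx.2 xa)).2.
  have [i hi] := norm1_coord (s2 x Tx.1 (ltW xa)); exists i; rewrite hout ?ltW//.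
  have [g0|g0] := leP 0 (g2 x 0 i); first by exists 1; rewrite rmorph1 -hi ger0_norm.
  by exists (-1); rewrite rmorphN rmorph1 -hi ltr0_norm// opprK.
have sc (N : set dom) : leb_null N -> leb_null [set x | N (a^-1 *: x)].
  move=> nN; apply: leb_null_sub (leb_null_affine (fun=> 0) (fun=> a0) nN) => x Nx.
  by exists (a^-1 *: x) => // j; rewrite mxE addr0 mulVKf.
have /choice[N2 HN2] : forall i, exists N, leb_null N /\ forall x, enorm x < 1 /\ a < `|x| -> ~ N x ->
    differentiable (fun x => g2 x 0 i) x.
  by move=> i; have [N ? ?] := d2 i; exists N.
exists ([set x | (sup_sphere dom `|` [set x | `|x| <= 1 /\ ~ Om x] `|` N1) (a^-1 *: x)] `|`
        [set x | exists i, N2 i x]).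
  apply: leb_nullU; last by apply: leb_null_countable => i; exact: (HN2 i).1.
  by apply: sc; apply: leb_nullU => //; apply: leb_nullU => //; exact: leb_null_sup_sphere.
move=> x x1 /not_orP[/not_orP[/not_orP[xu xo] xn1] xn2].
have xa : `|x| != a by apply/eqP => xa; apply: xu; rewrite /sup_sphere /= ns xa divff.
have Tx : T x.
  split; [exact: ltW|move=> xa'; apply: contrapT => nO; apply: xo].
  by split=> //; rewrite ns1.
split=> // i.
have near1 : \forall y \near x, enorm y < 1.
  by have /(continuous_enorm (x := x)) := lt_nbhsl x1.
have cn : continuous (fun z : dom => `|z|) by exact: norm_continuous.
suff [f df Hf] : exists2 f : dom -> R, differentiable f x & \forall y \near x, T y /\ f y = h y 0 i.
  apply: (differentiable_near _ df).1; apply: filterS Hf => y [Ty ->].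
  by rewrite mxE (HF i).1.
have [xa'|xa'] := ltP `|x| a.
  have x1' : `|a^-1 *: x| < 1 by rewrite ns ltr_pdivrMr// mul1r.
  have [nO dg] := d1 _ x1' (Tx.2 (ltW xa')) xn1.
  have nO' : \forall y \near x, Om (a^-1 *: y) by exact: (cf x _ nO).
  have na : \forall y \near x, `|y| < a by have /(cn x) := lt_nbhsl xa'.
  exists (fun y => g1 (a^-1 *: y) 0 i).
    apply: (@differentiable_comp _ _ _ _ (fun y : dom => a^-1 *: y) (fun z => g1 z 0 i)) => //.
  near=> y; have ya : `|y| < a by near: y.
  by rewrite hin ?(ltW ya)//; split=> //; split=> [|_]; [apply/ltW; near: y|near: y].
have {}xa : a < `|x| by rewrite lt_neqAle eq_sym xa.
have na : \forall y \near x, a < `|y| by have /(cn x) := lt_nbhsr xa.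
exists (fun y => g2 y 0 i).
  by apply: (HN2 i).2 => // hN; apply: xn2; exists i.
near=> y; have ya : a < `|y| by near: y.
rewrite hout ?(ltW ya)//; split=> //; split=> [|]; first by apply/ltW; near: y.
by rewrite leNgt ya.
Unshelve. all: by end_near.
Qed.
End Assembly.

Theorem theorem4 (R : realType) (n k : nat) (beta : 'rV[R]_k.+1 -> 'rV[R]_n.+1) :
  (2 <= n)%N -> (n.+1 <= k)%N ->
  (forall x, sphere k x -> sphere n (beta x)) ->
  lip_on (sphere k) beta ->
  cond_star beta ->
  exists gamma : 'rV[R]_k.+1 -> 'rV[R]_n.+1,
    (forall x, sphere k x -> gamma x = beta x) /\
    lip_on (ball1 k) gamma /\
    exists N : set 'rV[R]_k.+1, leb_null N /\
      forall x, enorm x < 1 -> ~ N x ->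
        differentiable gamma x /\ (\rank (lin1_mx ('d gamma x)) <= n)%N.
Proof.
case: n k beta => [//|n] [//|k] beta _ nk bS bL cs.
have [T [C [F [C0 [FL Fs Tq [N nN HN]]]]]] := cubified_filling bS bL nk cs.
exists (fun x => spherify (F x)); split.
  by move=> x x1; rewrite Fs// spherifyK//; exact: bS.
split.
  exists (n.+2%:R * ((n.+2%:R + 2) * C)) => x y _ _.
  apply: (le_trans (enorm_le _)); rewrite -mulrA; apply: ler_wpM2l => //.
  apply: (le_trans (spherify_lip _ _)); rewrite -mulrA; apply: ler_wpM2l; first by rewrite addr_ge0.
  apply: (le_trans (FL x y)); apply: ler_wpM2l => //; exact: norm_le_enorm.
pose Om : set 'rV[R]_k.+2 := [set x | enorm x < 1 /\ ~ N x].
have aF i : adiff Om (fun x => F x 0 i).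
  by apply: differentiable_adiff => x [x1 Nx]; exact: (HN x x1 Nx).2.
have OT x : Om x -> T x by move=> [x1 Nx]; exact: (HN x x1 Nx).1.
have [N' nN' HN'] := spherify_rank aF OT Tq.
exists (N `|` N'); split; first exact: leb_nullU.
by move=> x x1 /not_orP[Nx N'x]; apply: HN'.
Qed.
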